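(* Let $\mathbf{b}$ be a closed, compact, non-self-intersecting Bézier surface, for $k\ge0$ let $\mathbf{l}^{(k)}$ be the control surface obtained after $k$ subdivisions, and let $\tilde{\mathbf{b}}$ be a smooth approximation of $\mathbf{b}$. Then for all sufficiently large $k$, $$\sum_{p\in\mathbf{l}^{(k)}}K(p)=\int_{\tilde{\mathbf{b}}}K\,dA,$$ where the sum is over the vertices $p$ of $\mathbf{l}^{(k)}$, $K(p)$ is the total Gaussian curvature at $p$, and $K$ on the right is the Gaussian curvature of $\tilde{\mathbf{b}}$.
   Context: Bézier surface: for control points $p_{ij}\in\mathbb{R}^3$, $0\le i\le n$, $0\le j\le m$, it is the map (or its image) $\mathbf{b}(u,v)=\sum_{i=0}^n\sum_{j=0}^m B_i^n(u)B_j^m(v)p_{ij}$, $(u,v)\in[0,1]^2$, where $B_i^n(u)=\binom{n}{i}u^i(1-u)^{n-i}$. It is closed if $p_{i0}=p_{im}$ and $p_{0j}=p_{nj}$ for all $i,j$. A closed surface is non-self-intersecting if its parametrization is injective on $[0,1]^2$ except for the identifications of end points $(u,0)\sim(u,1)$, $(0,v)\sim(1,v)$. Subdivision (de Casteljau, in both the $u$ and $v$ directions, at the midpoint): for $0\le r,s<2^k$, the restriction of $\mathbf{b}$ to $[\frac{r}{2^k},\frac{r+1}{2^k}]\times[\frac{s}{2^k},\frac{s+1}{2^k}]$, affinely reparametrized to $[0,1]^2$, is a Bézier surface with unique control points of the same bidegree, denoted $p^{(k)}_{rn+i,\,sm+j}$, $0\le i\le n$, $0\le j\le m$. This gives the control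 net $p^{(k)}_{ij}$, $0\le i\le 2^kn$, $0\le j\le 2^km$, after $k$ subdivisions ($k=0$ is the original net). Control surface: writing $n_k=2^kn$, $m_k=2^km$, $\mathbf{l}^{(k)}:[0,1]^2\to\mathbb{R}^3$ is the map with $\mathbf{l}^{(k)}(\frac{i}{n_k},\frac{j}{m_k})=p^{(k)}_{ij}$ which is affine on each of the two triangles into which the cell $[\frac{i}{n_k},\frac{i+1}{n_k}]\times[\frac{j}{m_k},\frac{j+1}{m_k}]$ is cut by the diagonal from $(\frac{i}{n_k},\frac{j}{m_k})$ to $(\frac{i+1}{n_k},\frac{j+1}{m_k})$. Standing regularity assumption on the control nets: any two control points are distinct except possibly for end points (the boundary points identified in a closed surface), and among any four adjacent control points $p_{i,j},p_{i,j+1},p_{i+1,j},p_{i+1,j+1}$ any three are non-collinear. Total Gaussian curvature at a vertex $p$ of a polyhedral surface: $K(p)=2\pi-\sum_i\theta_i(p)$, where $\theta_i(p)$ is the interior angle at $p$ of the face $f_i$, over all faces containing $p$. Smooth approximation: a closed $\mathbf{b}$ need not be smooth at the junction points, i.e. along the curves $\mathbf{b}(u,0)=\mathbf{b}(u,1)$ and $\mathbf{b}(0,v)=\mathbf{b}(1,v)$ where common edges are connected. A smooth approximation $\tilde{\mathbf{b}}$ is a smooth surface obtained by smoothing $\mathbf{b}$ at the junction points, namely a member of a sequence of smooth surfaces $\mathbf{b}_q$ ($q\ge1$) such that each $\mathbf{b}_q$ is homeomorphic to $\mathbf{b}$, $\mathbf{b}_q=\mathbf{b}$ outside the $\frac1q$-neighborhood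 of the junction curves, and $\mathbf{b}_q\to\mathbf{b}$ in the Hausdorff metric. *)

(* Defs.v *)
From HB Require Import structures.
From mathcomp Require Import all_boot all_order all_algebra.
From mathcomp Require Import all_classical all_reals all_analysis.
From mathcomp Require Import ring zify.

Set Implicit Arguments.
Unset Strict Implicit.
Unset Printing Implicit Defensive.

Import Order.TTheory GRing.Theory Num.Theory.
Import numFieldNormedType.Exports.

Local Open Scope classical_set_scope.
Local Open Scope ring_scope.

Section Euclidean.
Context {R : realType}.
Implicit Types (a b c x y : 'rV[R]_3) (A B : set 'rV[R]_3).

Definition dot x y : R := \sum_(i < 3) x ord0 i * y ord0 i.

(* The library norm on 'rV[R]_3 is the sup norm. *)
Definition enorm x : R := Num.sqrt (dot x x).

Definition cross x y : 'rV[R]_3 :=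
  \row_(i < 3) (x ord0 (i + 1) * y ord0 (i + 2%:R)
                - x ord0 (i + 2%:R) * y ord0 (i + 1)).

Definition collinear a b c :=
  exists o d : 'rV[R]_3, forall x, [\/ x = a, x = b | x = c] ->
    exists t : R, x = o + t *: d.

(* Interior angle at a of the triangle with corners a, b, c. *)
Definition angle a b c : R :=
  acos (dot (b - a) (c - a) / (enorm (b - a) * enorm (c - a))).

Definition thickening (e : R) A : set 'rV[R]_3 :=
  [set x | exists2 a, A a & enorm (x - a) < e].

Definition hausdorff_dist A B : \bar R :=
  ereal_inf [set e%:E | e in [set e : R |
    [/\ 0 < e, A `<=` thickening e B & B `<=` thickening e A]]].

End Euclidean.

Definition homeomorphism_on {T U : topologicalType} (A : set T) (B : set U)
    (f : T -> U) :=
  [/\ set_bij A B f, {within A, continuous f} &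
      exists g : U -> T, {within B, continuous g} /\
        (forall x, A x -> g (f x) = x)].

Definition homeomorphic {T U : topologicalType} (A : set T) (B : set U) :=
  exists f : T -> U, homeomorphism_on A B f.

Section Bezier.
Context {R : realType}.
Implicit Types (n m k : nat) (p : nat -> nat -> 'rV[R]_3).

Definition bernstein n i (u : R) : R := 'C(n, i)%:R * u ^+ i * (1 - u) ^+ (n - i).

(* Only the control points p i j with i <= n and j <= m are relevant. *)
Definition bezier n m p (w : R * R) : 'rV[R]_3 :=
  \sum_(i < n.+1) \sum_(j < m.+1) (bernstein n i w.1 * bernstein m j w.2) *: p i j.

Definition unit_square : set (R * R) := `[0, 1] `*` `[0, 1].

Definition bezier_surface n m p : set 'rV[R]_3 := bezier n m p @` unit_square.

Definition junction_curves n m p : set 'rV[R]_3 :=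
  bezier n m p @` [set w | unit_square w /\ (w.1 = 0 \/ w.2 = 0)].

Definition closed_net n m p :=
  (forall i, (i <= n)%N -> p i 0%N = p i m) /\
  (forall j, (j <= m)%N -> p 0%N j = p n j).

Definition end_identified (u u' : R) :=
  [\/ u = u', u = 0 /\ u' = 1 | u = 1 /\ u' = 0].

Definition non_self_intersecting n m p :=
  forall w w', unit_square w -> unit_square w' ->
    bezier n m p w = bezier n m p w' ->
    end_identified w.1 w'.1 /\ end_identified w.2 w'.2.

(* For indices in [0, n] x [0, m], congruence mod n and mod m identifies
   exactly the end points that a closed net identifies. *)
Definition regular_net n m p :=
  (forall i j i' j', (i <= n)%N -> (j <= m)%N -> (i' <= n)%N -> (j' <= m)%N ->
     p i j = p i' j' -> i = i' %[mod n] /\ j = j' %[mod m]) /\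
  (forall i j, (i < n)%N -> (j < m)%N ->
     [/\ ~ collinear (p i j) (p i j.+1) (p i.+1 j),
         ~ collinear (p i j) (p i j.+1) (p i.+1 j.+1),
         ~ collinear (p i j) (p i.+1 j) (p i.+1 j.+1) &
         ~ collinear (p i j.+1) (p i.+1 j) (p i.+1 j.+1)]).

Fixpoint de_casteljau (V : lmodType R) (q : nat -> V) (l i : nat) : V :=
  if l is l'.+1 then
    2%:R^-1 *: (de_casteljau q l' i + de_casteljau q l' i.+1)
  else q i.

(* Midpoint subdivision of a piecewise Bézier curve of degree n whose c-th piece
   has control points q (c * n), ..., q (c * n + n).  The two halves of a piece
   have control points b_0^i and b_i^(n-i), for 0 <= i <= n, where b_i^l is the
   i-th point of the l-th de Casteljau level; they share the point b_0^n. *)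
Definition subdivide_curve (V : lmodType R) n (q : nat -> V) (a : nat) : V :=
  let c := (a %/ n.*2)%N in
  let i := (a %% n.*2)%N in
  de_casteljau (fun l => q (c * n + l)%N)
    (if (i <= n)%N then i else n.*2 - i)%N (i - n)%N.

Definition subdivide n m p : nat -> nat -> 'rV[R]_3 :=
  fun a b => subdivide_curve n (fun i => subdivide_curve m (p i) b) a.

Definition control_net n m p k := iter k (subdivide n m) p.

End Bezier.

Section SubdivisionCorrect.
Context {R : realType} {V : lmodType R}.
Implicit Types (q : nat -> V) (u : R).

Let bez n q u := \sum_(i < n.+1) bernstein n i u *: q i.

Let bez_rec n q u :
  bez n.+1 q u = (1 - u) *: bez n q u + u *: bez n (fun i => q i.+1) u.
Proof.
rewrite /bez !scaler_sumr big_ord_recl [in RHS]big_ord_recl -addrA.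
congr (_ + _).
  by rewrite scalerA /bernstein !bin0 !expr0 !mulr1 !mul1r !subn0 exprS.
transitivity (\sum_(i < n.+1) ((1 - u) * bernstein n i.+1 u) *: q i.+1 +
              \sum_(i < n.+1) (u * bernstein n i u) *: q i.+1).
  rewrite -big_split /=; apply: eq_bigr => i _.
  rewrite -scalerDl; congr (_ *: _).
  rewrite /bernstein /bump /= add1n binS natrD subSS.
  case: (ltnP i n) => [lin|].
    rewrite -(subnSK lin) [(1 - u) ^+ _.+1]exprS exprS.
    by ring.
  move=> nin; rewrite bin_small ?ltnS// add0r !mul0r mulr0 add0r.
  by rewrite exprS; ring.
rewrite big_ord_recr /= {2}/bernstein bin_small// !mul0r mulr0 scale0r addr0.
congr (_ + _); last by apply: eq_bigr => i _; rewrite scalerA.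
by apply: eq_bigr => i _; rewrite scalerA.
Qed.

Let mid q i : V := 2%:R^-1 *: (q i + q i.+1).

Let dcS q l i : de_casteljau q l.+1 i = de_casteljau (mid q) l i.
Proof.
elim: l i => [//|l IH] i.
by rewrite -[RHS]/(_ *: (de_casteljau _ l i + de_casteljau _ l i.+1)) -!IH.
Qed.

Let dc_shift q l i :
  de_casteljau (fun a => q a.+1) l i = de_casteljau q l i.+1.
Proof. by elim: l i => [//|l IH] i /=; rewrite !IH. Qed.

Let bez_mid n q u :
  bez n (mid q) u = 2%:R^-1 *: (bez n q u + bez n (fun i => q i.+1) u).
Proof.
rewrite /bez -big_split scaler_sumr; apply: eq_bigr => i _ /=.
by rewrite /mid -scalerDr !scalerA mulrC.
Qed.

Let eq_bez n q q' u :
  (forall i, (i <= n)%N -> q i = q' i) -> bez n q u = bez n q' u.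
Proof. by move=> e; apply: eq_bigr => i _; rewrite e// -ltnS. Qed.

Let bez_left n q u :
  bez n (fun i => de_casteljau q i 0) u = bez n q (u / 2%:R).
Proof.
elim: n q => [|n IH] q.
  by rewrite /bez !big_ord1 /bernstein !subnn !expr0.
rewrite !bez_rec IH.
rewrite (eq_bez (q := fun i => de_casteljau q i.+1 0)
  (q' := fun i => de_casteljau (mid q) i 0)); last by move=> i _; rewrite dcS.
rewrite IH bez_mid scalerA scalerDr addrA -scalerDl.
by congr (_ *: _ + _); field.
Qed.

Let bez_right n q u :
  bez n (fun i => de_casteljau q (n - i) i) u = bez n q ((1 + u) / 2%:R).
Proof.
elim: n q => [|n IH] q.
  by rewrite /bez !big_ord1 /bernstein !subnn !expr0.
rewrite !bez_rec.
rewrite (eq_bez (q' := fun i => de_casteljau (mid q) (n - i) i)); last first.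
  by move=> i lin; rewrite subSn// dcS.
rewrite IH bez_mid.
rewrite (eq_bez (q := fun i => de_casteljau q (n.+1 - i.+1) i.+1)
  (q' := fun i => de_casteljau (fun a => q a.+1) (n - i) i));
  last by move=> i lin; rewrite subSS dc_shift.
rewrite IH scalerA scalerDr -addrA -scalerDl.
have e1 : (1 - u) / 2%:R = 1 - (1 + u) / 2%:R.
  by field.
have e2 : (1 - u) / 2%:R + u = (1 + u) / 2%:R.
  by field.
by rewrite e2 e1.
Qed.

Let subdivide_curveP n q c u (b : bool) :
  bez n (fun i => subdivide_curve n q (c.*2 * n + b * n + i)) u =
  bez n (fun i => q (c * n + i)%N) ((b%:R + u) / 2%:R).
Proof.
case: n => [|n].
  rewrite /bez !big_ord1 /= !muln0 /subdivide_curve /= /bernstein.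
  by rewrite muln0 !subnn !expr0.
have dm i : (i < n.+1.*2)%N ->
  ((c.*2 * n.+1 + i) %/ n.+1.*2 = c /\ (c.*2 * n.+1 + i) %% n.+1.*2 = i)%N.
  move=> li; rewrite -doubleMl doubleMr; split.
    by rewrite divnMDl ?double_gt0// divn_small// addn0.
  by rewrite modnMDl modn_small.
case: b; rewrite ?mul0n ?mul1n ?addn0 ?add0r.
  rewrite -bez_right; apply: eq_bez => i; rewrite leq_eqVlt => /orP[/eqP->|li].
    rewrite /subdivide_curve.
    have -> : (c.*2 * n.+1 + n.+1 + n.+1 = c.+1 * n.+1.*2)%N by lia.
    rewrite mulnK ?double_gt0// modnMl /= sub0n subnn /= addn0.
    by congr q; lia.
  have l2 : (n.+1 + i < n.+1.*2)%N by lia.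
  rewrite /subdivide_curve -addnA; have [-> ->] := dm _ l2.
  rewrite addKn; case: i li l2 => [|i] li l2.
    by rewrite addn0 leqnn subn0.
  by rewrite ifF; [congr de_casteljau|]; lia.
rewrite -bez_left; apply: eq_bez => i lin.
rewrite /subdivide_curve; have [-> ->] := dm i ltac:(lia).
by rewrite lin; move: lin; rewrite -subn_eq0 => /eqP->.
Qed.

Lemma bezier_subdivide_curve n q c u (b : bool) :
  \sum_(i < n.+1) bernstein n i u *:
     subdivide_curve n q ((c.*2 + b) * n + i)%N =
  \sum_(i < n.+1) bernstein n i ((b%:R + u) / 2%:R) *: q (c * n + i)%N.
Proof.
rewrite -[RHS]/(bez n (fun i => q (c * n + i)%N) _) -subdivide_curveP.
by apply: eq_bigr => i _; rewrite mulnDl.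
Qed.

End SubdivisionCorrect.

Lemma bezier_subdivide {R : realType} n m (p : nat -> nat -> 'rV[R]_3)
    (c d : nat) (b b' : bool) (w : R * R) :
  bezier n m (fun i j => subdivide n m p ((c.*2 + b) * n + i)
                                         ((d.*2 + b') * m + j)) w =
  bezier n m (fun i j => p (c * n + i)%N (d * m + j)%N)
    ((b%:R + w.1) / 2%:R, (b'%:R + w.2) / 2%:R).
Proof.
have bezC q x : bezier n m q x =
    \sum_(j < m.+1) bernstein m j x.2 *: \sum_(i < n.+1) bernstein n i x.1 *: q i j.
  rewrite /bezier exchange_big; apply: eq_bigr => j _.
  by rewrite scaler_sumr; apply: eq_bigr => i _; rewrite scalerA mulrC.
have bezE q x : bezier n m q x =
    \sum_(i < n.+1) bernstein n i x.1 *: \sum_(j < m.+1) bernstein m j x.2 *: q i j.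
  rewrite /bezier; apply: eq_bigr => i _.
  by rewrite scaler_sumr; apply: eq_bigr => j _; rewrite scalerA.
rewrite bezC.
transitivity (bezier n m (fun i j => subdivide_curve m (p (c * n + i)%N)
    ((d.*2 + b') * m + j)) ((b%:R + w.1) / 2%:R, w.2)).
  rewrite bezC; apply: eq_bigr => j _; congr (_ *: _).
  rewrite /subdivide bezier_subdivide_curve /=.
  by apply: eq_bigr => i _.
rewrite !bezE; apply: eq_bigr => i _; congr (_ *: _).
by rewrite bezier_subdivide_curve.
Qed.

(* The cells of the k-th control net are the control nets of the affinely
   reparametrized restrictions of the surface to the dyadic squares. *)
Lemma bezier_control_net {R : realType} n m (p : nat -> nat -> 'rV[R]_3) k
    (r s : nat) (w : R * R) :
  (r < 2 ^ k)%N -> (s < 2 ^ k)%N ->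
  bezier n m (fun i j => control_net n m p k (r * n + i) (s * m + j)) w =
  bezier n m p ((r%:R + w.1) / 2%:R ^+ k, (s%:R + w.2) / 2%:R ^+ k).
Proof.
elim: k r s w => [|k IH] r s w.
  rewrite expn0 !ltnS !leqn0 => /eqP-> /eqP->.
  by rewrite !expr0 !divr1 !add0r !mul0n; case: w.
move=> rk sk; rewrite [control_net _ _ _ _]/=.
have dE t : t = (t./2.*2 + odd t)%N by rewrite addnC odd_double_half.
rewrite {1}(dE r) {1}(dE s) bezier_subdivide IH ?ltn_half_double; last 2 first.
- by rewrite -mul2n -expnS.
- by rewrite -mul2n -expnS.
have h t (x : R) : (t./2%:R + ((odd t)%:R + x) / 2%:R) / 2%:R ^+ k =
    (t%:R + x) / 2%:R ^+ k.+1.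
  rewrite [in RHS](dE t) natrD -muln2 natrM exprS invfM mulrA.
  by congr (_ / _); field.
by rewrite !h.
Qed.

Section PolyhedralSurface.
Context {R : realType}.

(* A triangle is given by its three corners, and a polyhedral surface with
   triangular faces by the set of its faces. *)
Definition triangle := ('rV[R]_3 * 'rV[R]_3 * 'rV[R]_3)%type.

Implicit Types (t : triangle) (F : set triangle) (x : 'rV[R]_3).

Definition corner t x := let: (a, b, c) := t in [\/ x = a, x = b | x = c].

Definition vertices F : set 'rV[R]_3 := [set x | exists2 t, F t & corner t x].

Definition corner_angle t x : R :=
  let: (a, b, c) := t in
  if x == a then angle a b c else if x == b then angle b c a else angle c a b.

Definition total_curvature F x : R :=
  2%:R * pi - \sum_(t \in [set t | F t /\ corner t x]) corner_angle t x.

(* Each cell of the grid is cut by the diagonal from (i, j) to (i+1, j+1). *)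
Definition net_surface n m (p : nat -> nat -> 'rV[R]_3) : set triangle :=
  [set t | exists i j, [/\ (i < n)%N, (j < m)%N &
     t = (p i j, p i.+1 j, p i.+1 j.+1) \/ t = (p i j, p i j.+1, p i.+1 j.+1)]].

Definition control_surface n m (p : nat -> nat -> 'rV[R]_3) k : set triangle :=
  net_surface (2 ^ k * n) (2 ^ k * m) (control_net n m p k).

End PolyhedralSurface.

Section SmoothSurface.
Context {R : realType}.
Implicit Types (U : set (R * R)) (f : R * R -> 'rV[R]_3) (S : set 'rV[R]_3).

Fixpoint Ck_on (k : nat) U f : Prop :=
  if k is k'.+1 then
    [/\ forall w, U w -> {for w, continuous f},
        forall w v, U w -> derivable f w v &
        forall v, Ck_on k' U ('D_v f)]
  else forall w, U w -> {for w, continuous f}.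

Definition smooth_on U f := forall k, Ck_on k U f.

Definition eu : R * R := (1, 0).
Definition ev : R * R := (0, 1).

Definition normal_field f w : 'rV[R]_3 := cross ('D_eu f w) ('D_ev f w).

Definition local_parametrization S U f :=
  [/\ open U, smooth_on U f, (forall w, U w -> normal_field f w != 0) &
      exists W, open W /\ homeomorphism_on U (S `&` W) f].

Definition smooth_surface S :=
  forall x, S x -> exists U f, local_parametrization S U f /\ (f @` U) x.

(* (L N - M^2) / (E G - F^2), from the two fundamental forms of f at w *)
Definition curvature_in f (w : R * R) : R :=
  let E := dot ('D_eu f w) ('D_eu f w) in
  let F := dot ('D_eu f w) ('D_ev f w) in
  let G := dot ('D_ev f w) ('D_ev f w) in
  let nu := (enorm (normal_field f w))^-1 *: normal_field f w in
  let L := dot ('D_eu ('D_eu f) w) nu in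
  let M := dot ('D_ev ('D_eu f) w) nu in
  let N := dot ('D_ev ('D_ev f) w) nu in
  (L * N - M ^+ 2) / (E * G - F ^+ 2).

Definition gauss_curvature S (x : 'rV[R]_3) : R :=
  xget 0 [set K | exists U f w,
    [/\ local_parametrization S U f, U w, f w = x & K = curvature_in f w]].

Definition borel3 := g_sigma_algebraType (@open 'rV[R]_3).

Definition is_area_measure S (mu : {measure set borel3 -> \bar R}) :=
  mu (~` S) = 0%E /\
  forall U f (B : set borel3), local_parametrization S U f ->
    measurable B -> B `<=` f @` U ->
    mu B = (\int[(lebesgue_measure \x lebesgue_measure)%E]_(w in U `&` f @^-1` B)
             (enorm (normal_field f w))%:E)%E.

(* The area element |f_u x f_v| du dv of the local parametrizations determines
   a unique Borel measure on a smooth surface S. *)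
Definition area_measure S : {measure set borel3 -> \bar R} :=
  if pselect (exists mu, is_area_measure S mu) is left e then projT1 (cid e)
  else mzero.

Definition smooth_approximation n m (p : nat -> nat -> 'rV[R]_3) S :=
  exists bs : nat -> set 'rV[R]_3,
    [/\ forall q, (0 < q)%N ->
          let far := ~` thickening q%:R^-1 (junction_curves n m p) in
          [/\ smooth_surface (bs q),
              homeomorphic (bs q) (bezier_surface n m p) &
              bs q `&` far = bezier_surface n m p `&` far],
        hausdorff_dist (bs q) (bezier_surface n m p) @[q --> \oo] --> 0%E &
        exists2 q, (0 < q)%N & S = bs q].

End SmoothSurface.

(* Main.v *)
(** Both sides vanish.  The control surface is a triangulated torus with [N M]
vertices and [2 N M] triangles, so that its total curvature is
[2 pi N M - pi (2 N M) = 0].  For the integral, a small translation of the torus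
moves every point of the surface [S] by a chord which, [S] being locally a graph over
its tangent planes, is not normal to [S]; averaging such chords with bump functions
gives a smooth vector field which is nowhere normal to [S], hence a unit tangent field
[Y], defined in each chart up to the sign of the unit normal [N].  Its connection form
[omega = <N, Y x dY>] satisfies [d omega = - K dA], and [omega] is defined globally up
to orientation.  For a partition of unity [rho_i] subordinate to charts, Stokes' theorem
in the plane turns [int rho_i K dA] into [int d rho_i /\ omega], and these sum to [0]
because the [d rho_i] do. *)

Require Import Defs.
From HB Require Import structures.
From mathcomp Require Import all_boot all_order all_algebra.
From mathcomp Require Import all_classical all_reals all_analysis.
From mathcomp Require Import measurable_realfun.
From mathcomp Require Import ring lra zify.

Set Implicit Arguments.
Unset Strict Implicit.
Unset Printing Implicit Defensive.

Import Order.TTheory GRing.Theory Num.Theory.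
Import numFieldNormedType.Exports.

Local Open Scope classical_set_scope.
Local Open Scope ring_scope.

(** * Functions of two variables *)

(** [S] is only homeomorphic to the torus, so no tangent field can be pushed forward to it: all that
    a homeomorphism transports is a fixed-point free translation. Its chords depend only
    continuously on the point and are not tangent. But being non-normal is an open condition, and
    positive combinations of nearby chords keep it, so finite sums of constant vectors weighted by
    bumps supply the missing regularity. Two more obstacles shape the proof. No orientation of [S]
    is known: each integrand is built so that the sign by which the normal changes cancels against
    the sign of the Jacobian. And a chart has an inverse that is merely continuous, so transition
    maps are not known to be differentiable: derivatives in two charts are compared through
    first-order expansions of functions along [S] in space. Regularity is counted instead of asked
    to be infinite: [omega] contains one derivative of [Y] and [d omega] a second one, so bumps of
    class C^2 suffice and truncated cubes serve. *)

Section ScalarCalculus.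
Context {R : realType}.
Implicit Types (U : set (R * R)) (g h : R * R -> R) (w v : R * R).

(** Derivatives are taken in every direction, as in [Ck_on], so that the coordinates of a smooth map
    satisfy it directly. *)
Fixpoint Ck (k : nat) U g : Prop :=
  if k is k'.+1 then
    [/\ forall w, U w -> {for w, continuous g},
        forall w v, U w -> derivable g w v &
        forall v, Ck k' U ('D_v g)]
  else forall w, U w -> {for w, continuous g}.

Lemma Ck_cont k U g w : Ck k U g -> U w -> {for w, continuous g}.
Proof. by case: k => [|k] /=; [apply|case=> gc _ _; apply: gc]. Qed.

Lemma Ck_derivable k U g w v : Ck k.+1 U g -> U w -> derivable g w v.
Proof. by case=> _ gd _ Uw; apply: gd. Qed.

Lemma Ck_is_derive k U g w v : Ck k.+1 U g -> U w -> is_derive w v g ('D_v g w).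
Proof. by move=> gk Uw; apply: derivableP; exact: Ck_derivable gk _. Qed.

Lemma Ck_derive k U g v : Ck k.+1 U g -> Ck k U ('D_v g).
Proof. by move=> [_ _]; exact. Qed.

Lemma CkW k U g : Ck k.+1 U g -> Ck k U g.
Proof.
elim: k g => [|k IH] g [gc gd gD]; first exact: gc.
by split=> // v; apply: IH.
Qed.

Lemma Ck_le k l U g : (l <= k)%N -> Ck k U g -> Ck l U g.
Proof.
move=> /subnK <-; elim: (k - l)%N => [//|d IH] gk; apply: IH.
exact: CkW.
Qed.

Lemma open_near_eq (T : Type) U (g h : R * R -> T) w : open U -> U w -> {in U, g =1 h} ->
  \near w, g w = h w.
Proof.
move=> oU Uw gh; near=> z; apply: gh; rewrite inE.
by near: z; exact: open_nbhs_nbhs.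
Unshelve. all: by end_near. Qed.

Lemma near_eq_continuous_at (T U : topologicalType) (f g : T -> U) (x : T) :
  (\near x, f x = g x) -> {for x, continuous f} -> {for x, continuous g}.
Proof.
move=> fg fc; have fgx : f x = g x by exact: nbhs_singleton fg.
suff : g @ x --> f x by rewrite fgx.
apply: cvg_trans fc; apply: near_eq_cvg; exact: fg.
Qed.

Lemma Ck_ext k U g h : open U -> {in U, g =1 h} -> Ck k U g -> Ck k U h.
Proof.
move=> oU; have cE (f f' : R * R -> R) w : U w -> {in U, f =1 f'} -> {for w, continuous f} ->
    {for w, continuous f'}.
  by move=> Uw ff'; apply: near_eq_continuous_at; exact: open_near_eq ff'.
elim: k g h => [|k IH] g h gh; first by move=> gc w Uw; apply: cE gh _ => //; exact: gc.
move=> [gc gd gD]; split=> [w Uw|w v Uw|v].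
- by apply: cE gh _ => //; exact: gc.
- by apply: near_eq_derivable (gd _ _ Uw); exact: open_near_eq gh.
- apply: IH (gD v) => w; rewrite inE => Uw.
  by apply: near_eq_derive; exact: open_near_eq gh.
Qed.

(** Serves the inductions on [k] below: a formula [dg] for the derivative has to hold on [U] only,
    and the induction hypothesis is applied to the formula. *)
Lemma CkS_intro k U g (dg : R * R -> R * R -> R) : open U ->
  (forall w v, U w -> is_derive w v g (dg v w)) -> (forall w, U w -> {for w, continuous g}) ->
  (forall v, Ck k U (dg v)) -> Ck k.+1 U g.
Proof.
move=> oU gd gc dgk; split=> // [w v Uw|v].
  by have [] := gd w v Uw.
apply: Ck_ext (dgk v) => // w; rewrite inE => Uw.
by have [_ ->] := gd w v Uw.
Qed.

Lemma Ck_cst k U (c : R) : open U -> Ck k U (fun=> c).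
Proof.
move=> oU; elim: k c => [|k IH] c; first by move=> w _; exact: cvg_cst.
by apply: (@CkS_intro _ _ _ (fun _ _ => 0)) => // w _; exact: cvg_cst.
Qed.

Lemma CkD k U g h : open U -> Ck k U g -> Ck k U h -> Ck k U (fun w => g w + h w).
Proof.
move=> oU; elim: k g h => [|k IH] g h gk hk.
  by move=> w Uw; apply: cvgD; [exact: gk|exact: hk].
apply: (@CkS_intro _ _ _ (fun v w => 'D_v g w + 'D_v h w)) => //.
- move=> w v Uw; have ? := Ck_is_derive v gk Uw; have ? := Ck_is_derive v hk Uw.
  exact: is_deriveD.
- by move=> w Uw; apply: cvgD; [exact: Ck_cont gk _|exact: Ck_cont hk _].
- by move=> v; apply: IH; exact: Ck_derive.
Qed.

Lemma CkM k U g h : open U -> Ck k U g -> Ck k U h -> Ck k U (fun w => g w * h w).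
Proof.
move=> oU; elim: k g h => [|k IH] g h gk hk.
  by move=> w Uw; apply: cvgM; [exact: gk|exact: hk].
apply: (@CkS_intro _ _ _ (fun v w => g w * 'D_v h w + h w * 'D_v g w)) => //.
- move=> w v Uw; have ? := Ck_is_derive v gk Uw; have ? := Ck_is_derive v hk Uw.
  exact: is_deriveM.
- by move=> w Uw; apply: cvgM; [exact: Ck_cont gk _|exact: Ck_cont hk _].
- by move=> v; apply: CkD => //; apply: IH; (exact: CkW || exact: Ck_derive).
Qed.

Lemma CkN k U g : open U -> Ck k U g -> Ck k U (fun w => - g w).
Proof.
move=> oU gk; apply: (Ck_ext (g := fun w => (-1) * g w)) => //.
  by move=> w _; rewrite mulN1r.
by apply: CkM => //; exact: Ck_cst.
Qed.

Lemma CkB k U g h : open U -> Ck k U g -> Ck k U h -> Ck k U (fun w => g w - h w).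
Proof. by move=> oU gk hk; apply: CkD => //; exact: CkN. Qed.

Lemma CkX k U g n : open U -> Ck k U g -> Ck k U (fun w => g w ^+ n).
Proof.
move=> oU gk; elim: n => [|n IH]; first exact: (Ck_cst k 1 oU).
apply: (Ck_ext (g := fun w => g w * g w ^+ n)) => //; first by move=> w _; rewrite exprS.
exact: CkM.
Qed.

Lemma Ck_inv k U g : open U -> (forall w, U w -> g w != 0) -> Ck k U g ->
  Ck k U (fun w => (g w)^-1).
Proof.
move=> oU g0; have gc w : U w -> {for w, continuous g} -> {for w, continuous (fun w => (g w)^-1)}.
  by move=> Uw gc; apply: cvgV => //; exact: g0.
elim: k g g0 gc => [|k IH] g g0 gc gk; first by move=> w Uw; apply: gc => //; exact: gk.
apply: (@CkS_intro _ _ _ (fun v w => - ((g w)^-1 ^+ 2 * 'D_v g w))) => //.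
- move=> w v Uw; split; first by apply: derivableV; [exact: g0|exact: Ck_derivable gk _].
  by rewrite deriveV; [rewrite exprVn scaleNr|exact: g0|exact: Ck_derivable gk _].
- by move=> w Uw; apply: gc => //; exact: Ck_cont gk _.
- move=> v; apply: CkN => //; apply: CkM => //; last exact: Ck_derive.
  by apply: CkX => //; apply: IH => //; exact: CkW.
Qed.

(** Of [g] only the derivative along [v] is known, so the one-variable chain rule is applied to its
    restriction to the line through [w]. *)
Lemma is_derive_comp1 {V : normedModType R} (p : R -> R) (g : V -> R) (w v : V) (dp dg : R) :
  is_derive (g w) 1 p dp -> is_derive w v g dg ->
  is_derive w v (p \o g) (dp * dg).
Proof.
move=> pd gd.
set g' := fun h : R => g (h *: v + w).
have gE : g' 0 = g w by rewrite /g' scale0r add0r.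
have dg' : derivable g' 0 1 by case: gd => + _; move/derivable1P.
have DE (f : V -> R) : 'D_v f w = (fun h : R => f (h *: v + w))^`()%classic 0.
  rewrite derive1E /derive; set g1 := fun s : R => s^-1 *: _; set g2 := fun s : R => s^-1 *: _.
  suff -> : g1 = g2 by [].
  by apply/funext => s; rewrite /g1 /g2 /= addr0 scale0r add0r [_%:A]mulr1.
have dc : derivable p (g' 0) 1 by rewrite gE; case: pd.
split.
  apply/derivable1P; apply/derivable1_diffP.
  by apply: (@differentiable_comp _ _ _ _ g' p); apply/derivable1_diffP.
rewrite DE (_ : (fun h : R => (p \o g) (h *: v + w)) = p \o g') // derive1_comp //.
by rewrite gE -DE (@derive_val _ _ _ _ _ _ _ gd) derive1E (@derive_val _ _ _ _ _ _ _ pd).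
Qed.

Lemma Ck_sqrt k U g : open U -> (forall w, U w -> 0 < g w) -> Ck k U g ->
  Ck k U (fun w => Num.sqrt (g w)).
Proof.
move=> oU g0; have gc w : U w -> {for w, continuous g} ->
    {for w, continuous (fun w => Num.sqrt (g w))}.
  by move=> Uw gc; apply: (continuous_comp gc); exact: sqrt_continuous.
elim: k => [|k IH] gk; first by move=> w Uw; apply: gc => //; exact: gk.
apply: (@CkS_intro _ _ _ (fun v w => (2 * Num.sqrt (g w))^-1 * 'D_v g w)) => //.
- move=> w v Uw; have gd := Ck_is_derive v gk Uw.
  by apply: is_derive_comp1; exact: is_derive1_sqrt (g0 _ Uw).
- by move=> w Uw; apply: gc => //; exact: Ck_cont gk _.
- move=> v; apply: CkM => //; last exact: Ck_derive.
  apply: Ck_inv => //.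
    by move=> w Uw; rewrite gt_eqF // mulr_gt0 // sqrtr_gt0 g0.
  by apply: CkM => //; [exact: Ck_cst|apply: IH; exact: CkW].
Qed.

(** A truncated power in place of a smooth cutoff: the derivative of one is a multiple of the
    previous one, so [ramp n.+1] is of class C^n. *)
Definition ramp (n : nat) (s : R) : R := Num.max 0 s ^+ n.

Lemma ramp_continuous n : continuous (ramp n).
Proof.
move=> s; rewrite /ramp.
have mc : {for s, continuous (fun s : R => Num.max 0 s)}.
  by apply: continuous_max => //; exact: cvg_cst.
elim: n => [|n IH]; first exact: cvg_cst.
rewrite (_ : (fun s => _) = fun s => Num.max 0 s * Num.max 0 s ^+ n); last first.
  by apply/funext => x; rewrite exprS.
exact: cvgM.
Qed.

Lemma is_derive_ramp n (s : R) : is_derive s 1 (ramp n.+2) (n.+2%:R * ramp n.+1 s).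
Proof.
have [s0|s0|->] := ltgtP s 0.
- rewrite /ramp (max_l (ltW s0)) expr0n /= mulr0.
  apply: (@near_eq_is_derive _ _ _ (cst 0)).
    near=> x; rewrite /= max_l ?expr0n //.
    by apply: ltW; near: x; exact: lt_nbhsl.
- rewrite /ramp (max_r (ltW s0)).
  apply: (@near_eq_is_derive _ _ _ ((id : R -> R) ^+ n.+2)).
    near=> x; rewrite /= max_r ?exprfctE //.
    by apply: ltW; near: x; exact: lt_nbhsr.
  apply: is_derive_eq; by rewrite /= scaler1.
- have -> : ramp n.+1 0 = 0 by rewrite /ramp maxxx expr0n.
  rewrite mulr0.
  (* At the kink the difference quotient is 0 on the left and a positive power of [t] on the
     right. *)
  have cv : t^-1 *: ((ramp n.+2 \o shift 0) (t *: 1) - ramp n.+2 0) @[t --> 0^'] --> (0:R).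
    apply/cvgrPdist_le => e e0; near=> t.
    have tn0 : t != 0 by near: t; exact: nbhs_dnbhs_neq.
    rewrite /= addr0 /ramp maxxx expr0n subr0 sub0r normrN.
    rewrite [_%:A]mulr1; have [t0|t0] := leP 0 t; last first.
      by rewrite expr0n scaler0 normr0 ltW.
    have -> : t^-1 *: (t ^+ n.+2 : R) = t * t ^+ n.
      by rewrite -[LHS]/(t^-1 * t ^+ n.+2) !exprS mulKf.
    rewrite normrM.
    have h1 : `|t| <= 1 by apply: ltW; near: t; exact: dnbhs0_lt.
    have he : `|t| <= e by apply: ltW; near: t; exact: dnbhs0_lt.
    rewrite -[e]mulr1 ler_pM // normrX exprn_ile1 //.
  by split; [apply/cvg_ex; exists 0|exact: cvg_lim cv].
Unshelve. all: by end_near. Qed.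

Lemma Ck_ramp k U g : open U -> Ck k U g -> Ck k U (fun w => ramp k.+1 (g w)).
Proof.
move=> oU; have gc n w : U w -> {for w, continuous g} ->
    {for w, continuous (fun w => ramp n (g w))}.
  by move=> Uw gc; apply: (continuous_comp gc); exact: ramp_continuous.
elim: k => [|k IH] gk; first by move=> w Uw; apply: gc => //; exact: gk.
apply: (@CkS_intro _ _ _ (fun v w => k.+2%:R * ramp k.+1 (g w) * 'D_v g w)) => //.
- move=> w v Uw; have gd := Ck_is_derive v gk Uw.
  by apply: is_derive_comp1; exact: is_derive_ramp.
- by move=> w Uw; apply: gc => //; exact: Ck_cont gk _.
- move=> v; apply: CkM => //; last exact: Ck_derive.
  apply: CkM => //; first exact: Ck_cst.
  by apply: IH; exact: CkW.
Qed.

Lemma Ck_sum (I : Type) (s : seq I) k U (g : I -> R * R -> R) : open U ->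
  (forall i, Ck k U (g i)) -> Ck k U (fun w => \sum_(i <- s) g i w).
Proof.
move=> oU gk; elim: s => [|i s IH].
  by apply: (Ck_ext (g := fun=> 0)) => //; [move=> w _; rewrite big_nil|exact: Ck_cst].
apply: (Ck_ext (g := fun w => g i w + \sum_(j <- s) g j w)) => //.
  by move=> w _; rewrite big_cons.
exact: CkD.
Qed.

End ScalarCalculus.

(** * Total differentials in the plane and the symmetry of second derivatives *)

Section Frechet.
Context {R : realType}.
Implicit Types (U : set (R * R)) (g h : R * R -> R) (w v : R * R).

Lemma is_derive_line {V : normedModType R} (g : V -> R) (a v : V) (t D : R) :
  is_derive (a + t *: v) v g D -> is_derive t 1 (fun s : R => g (a + s *: v)) D.
Proof.
move=> [gd gE]; set g1 := fun s : R => g (a + s *: v).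
have e : (fun s : R => s^-1 *: ((g1 \o shift t) (s *: 1) - g1 t)) =
         (fun s : R => s^-1 *: ((g \o shift (a + t *: v)) (s *: v) - g (a + t *: v))).
  apply/funext => s; rewrite /g1 /= [_%:A]mulr1 scalerDl.
  by congr (_ *: (g _ - _)); rewrite addrCA.
by split; [rewrite /derivable e|rewrite /derive e].
Qed.

(** The segment is parametrized by [0, 1] with the factor [c] inside, so that [c] may have either
    sign. *)
Lemma MVT_line {V : normedModType R} (g : V -> R) (a v : V) (c : R) :
  (forall s, 0 <= s <= 1 -> derivable g (a + (s * c) *: v) v) ->
  exists2 s, 0 <= s <= 1 & g (a + c *: v) - g a = c * 'D_v g (a + (s * c) *: v).
Proof.
move=> gd.
have dphi (s : R) : 0 <= s <= 1 ->
    is_derive s 1 (fun s : R => g (a + (s * c) *: v)) ('D_v g (a + (s * c) *: v) * c).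
  move=> s01.
  have d1 : is_derive s 1 (fun s : R => s * c) c.
    rewrite (_ : (fun s : R => s * c) = (fun s : R => id s * cst c s)) //.
    by apply: is_derive_eq; rewrite scaler0 add0r scaler1.
  apply: (@is_derive_comp1 R _ (fun t : R => g (a + t *: v)) (fun s : R => s * c)).
  by apply: is_derive_line; apply: derivableP; exact: gd.
have [|| s s01 E] := @MVT_segment R (fun s : R => g (a + (s * c) *: v))
  (fun s : R => 'D_v g (a + (s * c) *: v) * c) 0 1 ler01.
- by move=> s; rewrite in_itv /= => /andP[s0 s1]; apply: dphi; rewrite !ltW.
- apply: derivable_within_continuous => s; rewrite in_itv /= => s01.
  by case: (dphi _ s01).
move: s01; rewrite in_itv /= => s01; exists s => //.
by move: E; rewrite mul1r mul0r scale0r addr0 subr0 mulr1 mulrC.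
Qed.

(** The total differential, in epsilon form. Unlike derivability in each direction it composes,
    which is what changes of charts rest on. *)
Definition hasD g w (a b : R) := forall e : R, 0 < e ->
  \forall h \near (0 : R * R), `|g (w + h) - g w - (h.1 * a + h.2 * b)| <= e * `|h|.

Lemma hasD_derive g w a b v : hasD g w a b -> is_derive w v g (v.1 * a + v.2 * b).
Proof.
move=> gD.
have cv : s^-1 *: ((g \o shift w) (s *: v) - g w) @[s --> 0^'] --> v.1 * a + v.2 * b.
  apply/cvgrPdist_le => e e0.
  have e'0 : 0 < e / (`|v| + 1) by rewrite divr_gt0 // ltr_wpDl.
  have sv : s *: v @[s --> 0^'] --> (0 : R * R).
    rewrite -[X in _ --> X](scale0r v); apply: cvgZr_tmp.
    by apply: cvg_within_filter; exact: cvg_id.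
  near=> s; have s0 : s != 0 by near: s; exact: nbhs_dnbhs_neq.
  have : `|g (w + s *: v) - g w - ((s *: v).1 * a + (s *: v).2 * b)| <=
      e / (`|v| + 1) * `|s *: v|.
    by near: s; exact: (sv _ (gD _ e'0)).
  have -> : (s *: v).1 = s * v.1 by [].
  have -> : (s *: v).2 = s * v.2 by [].
  rewrite /= [s *: v + w]addrC => H.
  have -> : v.1 * a + v.2 * b - s^-1 *: (g (w + s *: v) - g w) =
     - (s^-1 * (g (w + s *: v) - g w - (s * v.1 * a + s * v.2 * b))).
    by rewrite -[_ *: _]/(s^-1 * _); field.
  rewrite normrN normrM normfV ler_pdivrMl ?normr_gt0 //.
  apply: (le_trans H); rewrite normrZ.
  have -> : e / (`|v| + 1) * (`|s| * `|v|) = `|s| * (e * (`|v| / (`|v| + 1))) by ring.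
  apply: ler_wpM2l => //; rewrite -[leRHS]mulr1; apply: ler_wpM2l; first exact: ltW.
  by rewrite ler_pdivrMr ?ltr_wpDl // mul1r lerDl.
by split; [apply/cvg_ex; eexists; exact: cv|exact: cvg_lim cv].
Unshelve. all: by end_near. Qed.

Lemma norm_fst_le w : `|w.1| <= `|w|.
Proof. by rewrite prod_normE le_max lexx. Qed.

Lemma norm_snd_le w : `|w.2| <= `|w|.
Proof. by rewrite prod_normE le_max lexx orbT. Qed.

Lemma pair_basisE w : w = w.2 *: ev + w.1 *: eu.
Proof.
by case: w => x y; congr pair; rewrite /= /GRing.scale /= ?mulr0 ?mulr1 ?add0r ?addr0.
Qed.

(** The increment is split into a step along [ev] followed by one along [eu]. The mean value theorem
    on each leg gives a partial derivative at a nearby point, which continuity compares with the one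
    at [w]. *)
Lemma continuous_partials_hasD U g gu gv w : open U -> U w ->
  (forall z, U z -> is_derive z eu g (gu z)) -> (forall z, U z -> is_derive z ev g (gv z)) ->
  {for w, continuous gu} -> {for w, continuous gv} -> hasD g w (gu w) (gv w).
Proof.
move=> oU Uw gdu gdv guc gvc e e0.
have e20 : 0 < e / 2 by rewrite divr_gt0.
have near_w : \forall z \near w, [/\ U z, `|gu w - gu z| <= e / 2
    & `|gv w - gv z| <= e / 2].
  have Hu : \forall z \near w, `|gu w - gu z| <= e / 2.
    by move/cvgrPdist_le: guc => /(_ _ e20).
  have Hv : \forall z \near w, `|gv w - gv z| <= e / 2.
    by move/cvgrPdist_le: gvc => /(_ _ e20).
  exact: filterS3 (open_nbhs_nbhs (conj oU Uw)) Hu Hv.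
have [d /= d0 dP] := (nbhs_ballP _ _).1 near_w.
apply/nbhs_ballP; exists d => //= h; rewrite -ball_normE /= sub0r normrN => hd.
have h1d : `|h.1| < d by apply: le_lt_trans hd; exact: norm_fst_le.
have h2d : `|h.2| < d by apply: le_lt_trans hd; exact: norm_snd_le.
have inb (x y : R) : `|x| < d -> `|y| < d -> ball w d (w + (x, y)).
  move=> xd yd; rewrite -ball_normE /= opprD addrA subrr sub0r normrN.
  by rewrite prod_normE /= gt_max xd.
have shr (s c : R) : 0 <= s <= 1 -> `|c| < d -> `|s * c| < d.
  move=> /andP[s0 s1]; apply: le_lt_trans; rewrite normrM ger0_norm //.
  by rewrite ler_piMl.
have in1 s : 0 <= s <= 1 -> U (w + h.2 *: ev + (s * h.1) *: eu) /\
    `|gu w - gu (w + h.2 *: ev + (s * h.1) *: eu)| <= e / 2.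
  move=> s01; rewrite -addrA.
  have -> : h.2 *: ev + (s * h.1) *: eu = (s * h.1, h.2) :> R * R.
    congr pair; rewrite /= /GRing.scale /=; by rewrite ?mulr0 ?mulr1 ?add0r ?addr0.
  by have [] := dP _ (inb _ _ (shr _ _ s01 h1d) h2d).
have in2 s : 0 <= s <= 1 -> U (w + (s * h.2) *: ev) /\
    `|gv w - gv (w + (s * h.2) *: ev)| <= e / 2.
  move=> s01; have -> : (s * h.2) *: ev = (0, s * h.2) :> R * R.
    by congr pair; rewrite /= /GRing.scale /= ?mulr0 ?mulr1.
  have z0 : `|0 : R| < d by rewrite normr0.
  by have [] := dP _ (inb _ _ z0 (shr _ _ s01 h2d)).
have [|s1 s101 E1] := @MVT_line _ g (w + h.2 *: ev) eu h.1.
  by move=> s /in1[/gdu[]].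
have [|s2 s201 E2] := @MVT_line _ g w ev h.2.
  by move=> s /in2[/gdv[]].
have [/gdu[_ D1] A1] := in1 _ s101; have [/gdv[_ D2] A2] := in2 _ s201.
rewrite D1 in E1; rewrite D2 in E2.
move: (gu (_ + _)) A1 E1 => a1 A1 E1; move: (gv (_ + _)) A2 E2 => a2 A2 E2.
move: (gu w) (gv w) A1 A2 => b1 b2 A1 A2.
have -> : g (w + h) - g w - (h.1 * b1 + h.2 * b2) = h.1 * (a1 - b1) + h.2 * (a2 - b2).
  by rewrite {1}(pair_basisE h) addrA !mulrBr -E1 -E2; move: (g _) (g _) (g _) => *; ring.
rewrite distrC in A1; rewrite distrC in A2.
have := norm_fst_le h; have := norm_snd_le h.
move: A1 A2; move: (a1 - b1) (a2 - b2) (h.1) (h.2) `|h| => c1 c2 h1 h2 nh A1 A2 H2 H1.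
rewrite (le_trans (ler_normD _ _)) // !normrM [e]splitr mulrDl.
by apply: lerD; rewrite mulrC ler_pM.
Qed.

Lemma C1_hasD U g w : open U -> Ck 1 U g -> U w -> hasD g w ('D_eu g w) ('D_ev g w).
Proof.
move=> oU gk Uw; apply: (@continuous_partials_hasD U g ('D_eu g) ('D_ev g)) => //.
- by move=> z Uz; exact: Ck_is_derive gk Uz.
- by move=> z Uz; exact: Ck_is_derive gk Uz.
- exact: Ck_cont (Ck_derive eu gk) Uw.
- exact: Ck_cont (Ck_derive ev gk) Uw.
Qed.

Lemma C1_deriveE U g w v : open U -> Ck 1 U g -> U w ->
  'D_v g w = v.1 * 'D_eu g w + v.2 * 'D_ev g w.
Proof.
by move=> oU gk Uw; have [_ ->] := hasD_derive v (C1_hasD oU gk Uw).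
Qed.

Lemma Schwarz U g w (a b : R * R) : open U -> Ck 2 U g -> U w ->
  'D_b ('D_a g) w = 'D_a ('D_b g) w.
Proof.
move=> oU gk Uw.
suff main (G1 G2 : R * R -> R) : {for w, continuous G1} -> {for w, continuous G2} ->
    (forall z, U z -> is_derive z b ('D_a g) (G1 z)) ->
    (forall z, U z -> is_derive z a ('D_b g) (G2 z)) -> G1 w = G2 w.
  apply: (main ('D_b ('D_a g)) ('D_a ('D_b g))).
  - exact: Ck_cont (Ck_derive b (Ck_derive a gk)) Uw.
  - exact: Ck_cont (Ck_derive a (Ck_derive b gk)) Uw.
  - by move=> z Uz; exact: Ck_is_derive (Ck_derive a gk) Uz.
  - by move=> z Uz; exact: Ck_is_derive (Ck_derive b gk) Uz.
move=> G1c G2c G1d G2d.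
(* both sides are approximated by the same second difference quotient *)
have key (a' b' : R * R) (G : R * R -> R) :
    (forall z, U z -> is_derive z b' ('D_a' g) (G z)) -> \forall t \near 0^'+, exists2 z : R * R,
    `|z| <= t * (`|a'| + `|b'|) &
    g (w + t *: a' + t *: b') - g (w + t *: a') - g (w + t *: b') + g w =
    t * (t * G (w + z)).
  move=> Gd.
  have small : \forall t \near (0 : R)^'+, forall s s' : R, 0 <= s <= 1 -> 0 <= s' <= 1 ->
      U (w + ((s * t) *: a' + (s' * t) *: b')).
    have [d /= d0 dP] := (nbhs_ballP _ _).1 (open_nbhs_nbhs (conj oU Uw)).
    near=> t => s s' /andP[s0 s1] /andP[s'0 s'1]; apply: dP.
    rewrite -ball_normE /= opprD addrA subrr sub0r normrN.
    have t0 : 0 < t by near: t; exact: nbhs_right_gt.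
    apply: (@le_lt_trans _ _ (t * (`|a'| + `|b'|))).
      rewrite (le_trans (ler_normD _ _)) // !normrZ mulrDr.
      rewrite (ger0_norm s0) (ger0_norm s'0) (gtr0_norm t0).
      by apply: lerD; rewrite ler_wpM2r // ler_piMl // ltW.
    apply: (@le_lt_trans _ _ (t * (`|a'| + `|b'| + 1))).
      by rewrite ler_wpM2l ?(ltW t0) // lerDl.
    rewrite -ltr_pdivlMr; last by rewrite ltr_wpDl // addr_ge0.
    by near: t; apply: nbhs_right_lt; rewrite divr_gt0 // ltr_wpDl // addr_ge0.
  near=> t.
  have t0 : 0 < t by near: t; exact: nbhs_right_gt.
  have sm : forall s s' : R, 0 <= s <= 1 -> 0 <= s' <= 1 ->
      U (w + ((s * t) *: a' + (s' * t) *: b')) by near: t.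
  have i0 : 0 <= (0 : R) <= 1 by rewrite lexx ler01.
  have i1 : 0 <= (1 : R) <= 1 by rewrite lexx ler01.
  have dsh (z : R * R) : U (z + t *: b') ->
      is_derive z a' (fun z => g (z + t *: b')) ('D_a' g (z + t *: b')).
    move=> Uz; have gd : derivable g (z + t *: b') a' by apply: Ck_derivable gk _.
    have e : (fun s : R => s^-1 *: (((fun z => g (z + t *: b')) \o shift z) (s *: a') -
          g (z + t *: b'))) =
        (fun s : R => s^-1 *: ((g \o shift (z + t *: b')) (s *: a') - g (z + t *: b'))).
      by apply/funext => s /=; rewrite addrA.
    by split; [rewrite /derivable e|rewrite /derive e].
  have d1 s : 0 <= s <= 1 -> is_derive (w + (s * t) *: a') a'
     (fun z => g (z + t *: b') - g z)
     ('D_a' g (w + (s * t) *: a' + t *: b') - 'D_a' g (w + (s * t) *: a')).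
    move=> s01; apply: is_deriveB.
      by apply: dsh; rewrite -addrA -[X in X *: b']mul1r; exact: sm.
    apply: Ck_is_derive gk _.
    by rewrite -[(_ * t) *: a']addr0 -(scale0r b') -(mul0r t); exact: sm.
  have [|s s01 E] := @MVT_line _ (fun z => g (z + t *: b') - g z) w a' t.
    by move=> s /d1[].
  have [_ E'] := d1 _ s01.
  rewrite E' in E.
  have [|s' s'01 E2] := @MVT_line _ ('D_a' g) (w + (s * t) *: a') b' t.
    by move=> s' s'01; rewrite -addrA; have /Gd[] := sm _ _ s01 s'01.
  have /Gd[_] := sm _ _ s01 s'01; rewrite addrA => D2; rewrite D2 in E2.
  exists ((s * t) *: a' + (s' * t) *: b').
    rewrite (le_trans (ler_normD _ _)) // !normrZ mulrDr.
    move: s01 s'01 => /andP[s0 s1] /andP[s'0 s'1].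
    rewrite (ger0_norm s0) (ger0_norm s'0) (gtr0_norm t0).
    by apply: lerD; rewrite ler_wpM2r // ler_piMl // ltW.
  by rewrite addrA -E2 -E; ring.
have kab := key a b G1 G1d; have kba := key b a G2 G2d.
apply/eqP; rewrite -subr_eq0 -normr_le0; apply/ler_addgt0Pl => e e0.
rewrite addr0.
have e20 : 0 < e / 2 by rewrite divr_gt0.
move: G1c => /cvgrPdist_le /(_ _ e20) /nbhs_ballP[d1 /= d10 d1P].
move: G2c => /cvgrPdist_le /(_ _ e20) /nbhs_ballP[d2 /= d20 d2P].
have tlt d : 0 < d -> \forall t \near (0 : R)^'+, t * (`|a| + `|b|) < d.
  move=> d0; near=> r.
  have r0 : 0 < r by near: r; exact: nbhs_right_gt.
  apply: (@le_lt_trans _ _ (r * (`|a| + `|b| + 1))).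
    by rewrite ler_wpM2l ?(ltW r0) // lerDl.
  rewrite -ltr_pdivlMr; last by rewrite ltr_wpDl // addr_ge0.
  by near: r; apply: nbhs_right_lt; rewrite divr_gt0 // ltr_wpDl // addr_ge0.
have pos : \forall t \near (0 : R)^'+, 0 < t by exact: nbhs_right_gt.
have FF : ProperFilter ((0 : R)^'+) by exact: at_right_proper_filter.
have FI A B := @filterI _ _ (@filter_filter _ _ FF) A B.
have [t [[[z zt Ez] [y yt Ey]] [t0 [td1 td2]]]] := @filter_ex _ _ FF _
  (FI _ _ (FI _ _ kab kba) (FI _ _ pos (FI _ _ (tlt _ d10) (tlt _ d20)))).
have Ezy : G1 (w + z) = G2 (w + y).
  have tn0 : t != 0 by rewrite gt_eqF.
  apply: (mulfI tn0); apply: (mulfI tn0); rewrite -Ez -Ey.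
  by rewrite (addrAC w (t *: b)); move: (g _) (g _) (g _) (g _) => *; ring.
have bz : ball w d1 (w + z).
  rewrite -ball_normE /= opprD addrA subrr sub0r normrN; exact: (le_lt_trans zt).
have by_ : ball w d2 (w + y).
  rewrite -ball_normE /= opprD addrA subrr sub0r normrN; apply: (le_lt_trans yt).
  by rewrite (addrC `|b|).
have H1 := d1P _ bz; have H2 := d2P _ by_.
rewrite -(subrKA (G1 (w + z))) (le_trans (ler_normD _ _)) //.
by rewrite [e]splitr lerD // Ezy distrC.
Unshelve. all: by end_near. Qed.

End Frechet.

(** * Vector calculus and the connection form *)

Section VectorAlgebra.
Context {R : realType}.
Implicit Types x y z : 'rV[R]_3.

Let i0 : 'I_3 := 0. Let i1 : 'I_3 := 1. Let i2 : 'I_3 := 2%:R.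

Lemma dotE x y : dot x y = x ord0 0 * y ord0 0 + x ord0 1 * y ord0 1
  + x ord0 2%:R * y ord0 2%:R.
Proof.
rewrite /dot !big_ord_recl big_ord0 addr0 addrA.
by congr (_ + _ * _ + _ * _); congr (_ ord0 _); apply: val_inj.
Qed.

Lemma crossE x y : ((cross x y) ord0 0 = x ord0 1 * y ord0 2%:R - x ord0 2%:R * y ord0 1)
  * ((cross x y) ord0 1 = x ord0 2%:R * y ord0 0 - x ord0 0 * y ord0 2%:R)
  * ((cross x y) ord0 2%:R = x ord0 0 * y ord0 1 - x ord0 1 * y ord0 0).
Proof.
by split; [split|]; rewrite !mxE; congr (_ * _ - _ * _); congr (_ ord0 _); apply: val_inj.
Qed.

Lemma row3P x y : x ord0 0 = y ord0 0 -> x ord0 1 = y ord0 1 ->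
  x ord0 2%:R = y ord0 2%:R -> x = y.
Proof.
move=> e0 e1 e2; apply/rowP => -[[|[|[|//]]] ilt].
- by rewrite (_ : Ordinal ilt = 0) //; apply: val_inj.
- by rewrite (_ : Ordinal ilt = 1) //; apply: val_inj.
- by rewrite (_ : Ordinal ilt = 2%:R) //; apply: val_inj.
Qed.

Lemma dotC x y : dot x y = dot y x. Proof. by rewrite !dotE; ring. Qed.
Lemma dotDl x y z : dot (x + y) z = dot x z + dot y z.
Proof. by rewrite !dotE !mxE; ring. Qed.
Lemma dotDr x y z : dot x (y + z) = dot x y + dot x z.
Proof. by rewrite !dotE !mxE; ring. Qed.
Lemma dotZl (c : R) x y : dot (c *: x) y = c * dot x y.
Proof. by rewrite !dotE !mxE; ring. Qed.
Lemma dotZr (c : R) x y : dot x (c *: y) = c * dot x y.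
Proof. by rewrite !dotE !mxE; ring. Qed.
Lemma dotNl x y : dot (- x) y = - dot x y.
Proof. by rewrite !dotE !mxE; ring. Qed.
Lemma dotNr x y : dot x (- y) = - dot x y.
Proof. by rewrite !dotE !mxE; ring. Qed.
Lemma dot0l x : dot 0 x = 0. Proof. by rewrite dotE !mxE; ring. Qed.
Lemma dot0r x : dot x 0 = 0. Proof. by rewrite dotE !mxE; ring. Qed.
Lemma dotBr x y z : dot x (y - z) = dot x y - dot x z.
Proof. by rewrite dotDr dotNr. Qed.
Lemma dotBl x y z : dot (x - y) z = dot x z - dot y z.
Proof. by rewrite dotDl dotNl. Qed.
Lemma dot_sumr (I : Type) (s : seq I) x (F : I -> 'rV[R]_3) :
  dot x (\sum_(i <- s) F i) = \sum_(i <- s) dot x (F i).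
Proof.
by elim: s => [|i s IH]; rewrite ?big_nil ?dot0r // !big_cons dotDr IH.
Qed.

Lemma dot_ge0 x : 0 <= dot x x.
Proof. by rewrite dotE !addr_ge0 // -expr2 sqr_ge0. Qed.

Lemma dot_eq0 x : (dot x x == 0) = (x == 0).
Proof.
apply/eqP/eqP => [|->]; last exact: dot0l.
rewrite dotE => /eqP; rewrite !paddr_eq0 ?addr_ge0 // -?expr2 ?sqr_ge0 //.
rewrite !sqrf_eq0 => /andP[/andP[/eqP e0 /eqP e1] /eqP e2].
by apply: row3P; rewrite ?e0 ?e1 ?e2 !mxE.
Qed.

Lemma dot_gt0 x : (0 < dot x x) = (x != 0).
Proof. by rewrite lt0r dot_ge0 andbT dot_eq0. Qed.

Lemma enorm_gt0 x : (0 < enorm x) = (x != 0).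
Proof. by rewrite sqrtr_gt0 dot_gt0. Qed.

Lemma enorm_ge0 x : 0 <= enorm x. Proof. exact: sqrtr_ge0. Qed.

Lemma enorm_sqr x : enorm x ^+ 2 = dot x x.
Proof. by rewrite sqr_sqrtr // dot_ge0. Qed.

Lemma enormZ (c : R) x : enorm (c *: x) = `|c| * enorm x.
Proof.
by rewrite /enorm dotZl dotZr mulrA -expr2 sqrtrM ?sqr_ge0 // sqrtr_sqr.
Qed.

Lemma enorm_normalize x : x != 0 -> dot ((enorm x)^-1 *: x) ((enorm x)^-1 *: x) = 1.
Proof.
move=> x0; rewrite dotZl dotZr mulrA -enorm_sqr -expr2 -exprMn mulVf ?expr1n //.
by rewrite gt_eqF ?enorm_gt0.
Qed.

Lemma dot_cross_l x y : dot x (cross x y) = 0.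
Proof. by rewrite !dotE !crossE; ring. Qed.

Lemma dot_cross_r x y : dot y (cross x y) = 0.
Proof. by rewrite !dotE !crossE; ring. Qed.

Lemma triple_rot x y z : dot x (cross y z) = dot y (cross z x).
Proof. by rewrite !dotE !crossE; ring. Qed.

Lemma crossDl x y z : cross (x + y) z = cross x z + cross y z.
Proof. by apply: row3P; rewrite !(crossE, mxE); ring. Qed.
Lemma crossDr x y z : cross x (y + z) = cross x y + cross x z.
Proof. by apply: row3P; rewrite !(crossE, mxE); ring. Qed.
Lemma crossZl (c : R) x y : cross (c *: x) y = c *: cross x y.
Proof. by apply: row3P; rewrite !(crossE, mxE); ring. Qed.
Lemma crossZr (c : R) x y : cross x (c *: y) = c *: cross x y.
Proof. by apply: row3P; rewrite !(crossE, mxE); ring. Qed.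
Lemma crossvv x : cross x x = 0.
Proof. by apply: row3P; rewrite !(crossE, mxE); ring. Qed.
Lemma Lagrange_identity x y z t :
  dot (cross x y) (cross z t) = dot x z * dot y t - dot x t * dot y z.
Proof. by rewrite !dotE !crossE; ring. Qed.

Lemma orthonormal_decomposition x y z : dot x x = 1 -> dot y y = 1 -> dot x y = 0 ->
  z = dot z x *: x + dot z y *: y + dot z (cross y x) *: cross y x.
Proof.
move=> xx yy xy.
(* Multiplied by the Gram determinant of [x] and [y], the decomposition becomes a polynomial
   identity, valid for all vectors. *)
suff : (dot y y * dot x x - dot x y ^+ 2) *: z =
    (dot y y * dot z x - dot x y * dot z y) *: x +
    (dot x x * dot z y - dot x y * dot z x) *: y + dot z (cross y x) *: cross y x.
  by rewrite xx yy xy expr0n /= !mul1r !mul0r !subr0 scale1r.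
by apply: row3P; rewrite !(crossE, dotE, mxE); ring.
Qed.

(* In the frame (X, Y, N) with X = Y x N write Nu = pX + qY and Yu = aX - qN,
   and similarly for v; both sides are then multiples of [X, Y, N]. *)
Lemma structure_equation (N Y Nu Nv Yu Yv Yuv : 'rV[R]_3) :
  dot N N = 1 -> dot Y Y = 1 -> dot N Y = 0 ->
  dot Nu N = 0 -> dot Nv N = 0 -> dot Yu Y = 0 -> dot Yv Y = 0 ->
  dot Nu Y + dot N Yu = 0 -> dot Nv Y + dot N Yv = 0 ->
  dot Nu (cross Y Yv) + dot N (cross Yu Yv + cross Y Yuv)
  - (dot Nv (cross Y Yu) + dot N (cross Yv Yu + cross Y Yuv)) = - dot N (cross Nu Nv).
Proof.
move=> NN YY NY NuN NvN YuY YvY uE vE.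
rewrite (orthonormal_decomposition Nu NN YY NY) (orthonormal_decomposition Nv NN YY NY).
rewrite (orthonormal_decomposition Yu NN YY NY) (orthonormal_decomposition Yv NN YY NY).
rewrite NuN NvN YuY YvY (dotC Yu N) (dotC Yv N).
have -> : dot N Yu = - dot Nu Y by move/eqP: uE; rewrite addrC addr_eq0 => /eqP.
have -> : dot N Yv = - dot Nv Y by move/eqP: vE; rewrite addrC addr_eq0 => /eqP.
move: (dot Nu Y) (dot Nv Y) (dot Nu _) (dot Nv _) (dot Yu _) (dot Yv _) => q q' p p' r r'.
rewrite !scale0r !add0r ?addr0.
rewrite ?(crossDl, crossDr, crossZl, crossZr, dotDl, dotDr, dotZl, dotZr).
rewrite !(crossE, dotE); ring.
Qed.

End VectorAlgebra.

(* Locked: unfolding derivatives makes failed unifications very slow. *)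
HB.lock Definition pd {R : realType} (v : R * R) (X : R * R -> 'rV[R]_3) (w : R * R) : 'rV[R]_3 :=
  \row_i 'D_v (fun w => X w ord0 i) w.

(** * Vector-valued functions of two variables *)

Section VectorCalculus.
Context {R : realType}.
Implicit Types (U : set (R * R)) (X Y : R * R -> 'rV[R]_3) (w v : R * R).

Definition CkV k U X := forall i, Ck k U (fun w => X w ord0 i).

Lemma pdE X w v i : pd v X w ord0 i = 'D_v (fun w => X w ord0 i) w.
Proof. by rewrite pd.unlock mxE. Qed.

Lemma pd_coordE X v i : (fun w => pd v X w ord0 i) = 'D_v (fun w => X w ord0 i).
Proof. by apply/funext => w; rewrite pdE. Qed.

Lemma CkV_is_derive k U X w v i : CkV k.+1 U X -> U w ->
  is_derive w v (fun w => X w ord0 i) (pd v X w ord0 i).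
Proof. by move=> Xk Uw; rewrite pdE; exact: Ck_is_derive (Xk i) Uw. Qed.

Lemma derive_pd k U X w v : CkV k.+1 U X -> U w -> 'D_v X w = pd v X w.
Proof.
move=> Xk Uw; have Xd : derivable X w v.
  by apply/derivable_mxP => i j; rewrite ord1; exact: Ck_derivable (Xk j) Uw.
by rewrite (derive_mx Xd) pd.unlock; apply/matrixP => i j; rewrite ord1 mxE [RHS]mxE.
Qed.

Lemma CkV_pd k U X v : CkV k.+1 U X -> CkV k U (pd v X).
Proof. by move=> Xk i; rewrite pd_coordE; exact: Ck_derive. Qed.

Lemma CkV_le k l U X : (l <= k)%N -> CkV k U X -> CkV l U X.
Proof. by move=> lk Xk i; exact: Ck_le lk (Xk i). Qed.

Lemma CkV_cont k U X w : CkV k U X -> U w -> {for w, continuous X}.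
Proof.
move=> Xk Uw; apply/cvgrPdist_le => /= e e0; near=> z.
rewrite /Num.Def.normr /= mx_normrE (bigmax_le _ (ltW e0)) //= => -[i j] _.
rewrite !mxE /= ord1; move: j; near: z; apply: filter_forall => /= j.
by have := Ck_cont (Xk j) Uw; move=> /cvgrPdist_le; apply.
Unshelve. all: by end_near. Qed.

Lemma CkV_Schwarz U X w (a b : R * R) : open U -> CkV 2 U X -> U w ->
  pd b (pd a X) w = pd a (pd b X) w.
Proof.
move=> oU Xk Uw; apply/rowP => i; rewrite (pdE (pd a X)) (pdE (pd b X)).
rewrite (pd_coordE X a i) (pd_coordE X b i).
exact: Schwarz oU (Xk i) Uw.
Qed.

Lemma pd_basisE U X w v : open U -> CkV 1 U X -> U w ->
  pd v X w = v.1 *: pd eu X w + v.2 *: pd ev X w.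
Proof.
move=> oU Xk Uw; apply/rowP => i; rewrite !mxE !pdE.
exact: C1_deriveE oU (Xk i) Uw.
Qed.

Lemma Ck_on_CkV k U (f : R * R -> 'rV[R]_3) : open U -> Ck_on k U f -> CkV k U f.
Proof.
move=> oU; have cc (g : R * R -> 'rV[R]_3) i w : {for w, continuous g} ->
    {for w, continuous (fun w => g w ord0 i)}.
  move=> gc; apply: (@continuous_comp _ _ _ g (fun x : 'rV[R]_3 => x ord0 i)) => //.
  exact: coord_continuous.
elim: k f => [|k IH] f; first by move=> fc i w Uw; apply: cc; exact: fc.
move=> [fc fd fD] i; split=> [w Uw|w v Uw|v].
- by apply: cc; exact: fc.
- exact: ((derivable_mxP f w v).1 (fd w v Uw) ord0 i).
- apply: (Ck_ext _ _ (IH _ (fD v) i)) => // w; rewrite inE => Uw.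
  by rewrite derive_mx ?mxE //; exact: fd.
Qed.

Lemma is_derive_dot U X Y w v : CkV 1 U X -> CkV 1 U Y -> U w ->
  is_derive w v (fun w => dot (X w) (Y w)) (dot (pd v X w) (Y w) + dot (X w) (pd v Y w)).
Proof.
move=> Xk Yk Uw.
have Xd i := CkV_is_derive v i Xk Uw; have Yd i := CkV_is_derive v i Yk Uw.
have H := is_derive_sum (h := fun i => (fun w => X w ord0 i) * (fun w => Y w ord0 i))
  (fun i => is_deriveM (Xd i) (Yd i)).
rewrite (_ : \sum_(i < 3) _ = (fun w => dot (X w) (Y w))) in H; last first.
  by apply/funext => z; rewrite fct_sumE.
apply: (is_derive_eq H).
rewrite /dot -big_split /=; apply: eq_bigr => i _.
by rewrite [LHS]addrC; congr (_ + _); exact: mulrC.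
Qed.

Lemma pd_cross U X Y w v : CkV 1 U X -> CkV 1 U Y -> U w ->
  pd v (fun w => cross (X w) (Y w)) w = cross (pd v X w) (Y w) + cross (X w) (pd v Y w).
Proof.
move=> Xk Yk Uw; apply/rowP => i; rewrite pdE.
rewrite (_ : (fun w => _) = (fun w => X w ord0 (i + 1)) * (fun w => Y w ord0 (i + 2%:R))
   - (fun w => X w ord0 (i + 2%:R)) * (fun w => Y w ord0 (i + 1))); last first.
  by apply/funext => z; rewrite /cross mxE.
have Xd j := CkV_is_derive v j Xk Uw; have Yd j := CkV_is_derive v j Yk Uw.
have [_ ->] := is_deriveB (is_deriveM (Xd (i + 1)) (Yd (i + 2%:R)))
  (is_deriveM (Xd (i + 2%:R)) (Yd (i + 1))).
rewrite [in RHS]mxE ![cross _ _ _ _]mxE.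
move: (pd v X w) (pd v Y w) => dX dY.
by rewrite /GRing.scale /=; ring.
Qed.

Lemma Ck_dot k U X Y : open U -> CkV k U X -> CkV k U Y ->
  Ck k U (fun w => dot (X w) (Y w)).
Proof. by move=> oU Xk Yk; apply: Ck_sum => // i; exact: CkM. Qed.

Lemma CkV_cross k U X Y : open U -> CkV k U X -> CkV k U Y ->
  CkV k U (fun w => cross (X w) (Y w)).
Proof.
move=> oU Xk Yk i.
apply: (Ck_ext (g := fun w => X w ord0 (i + 1) * Y w ord0 (i + 2%:R)
   - X w ord0 (i + 2%:R) * Y w ord0 (i + 1))) => //.
  by move=> w _; rewrite mxE.
by apply: CkB => //; exact: CkM.
Qed.

Lemma CkV_scale k U (g : R * R -> R) X : open U -> Ck k U g -> CkV k U X ->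
  CkV k U (fun w => g w *: X w).
Proof.
move=> oU gk Xk i; apply: (Ck_ext (g := fun w => g w * X w ord0 i)) => //.
  by move=> w _; rewrite mxE.
exact: CkM.
Qed.

Lemma CkV_cst k U (c : 'rV[R]_3) : open U -> CkV k U (fun=> c).
Proof. by move=> oU i; exact: Ck_cst. Qed.

Lemma CkVB k U X Y : open U -> CkV k U X -> CkV k U Y -> CkV k U (fun w => X w - Y w).
Proof.
move=> oU Xk Yk i; apply: (Ck_ext (g := fun w => X w ord0 i - Y w ord0 i)) => //.
  by move=> w _; rewrite !mxE.
exact: CkB.
Qed.

Lemma CkV_sum (I : Type) (s : seq I) k U (X : I -> R * R -> 'rV[R]_3) : open U ->
  (forall i, CkV k U (X i)) -> CkV k U (fun w => \sum_(i <- s) X i w).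
Proof.
move=> oU Xk j; apply: (Ck_ext (g := fun w => \sum_(i <- s) X i w ord0 j)) => //.
  by move=> w _; rewrite summxE.
by apply: Ck_sum => // i; exact: Xk.
Qed.

Definition normalized X w : 'rV[R]_3 := (enorm (X w))^-1 *: X w.

Lemma CkV_normalized k U X : open U -> (forall w, U w -> X w != 0) -> CkV k U X ->
  CkV k U (normalized X).
Proof.
move=> oU X0 Xk; apply: CkV_scale => //; apply: Ck_inv => //.
  by move=> w Uw; rewrite gt_eqF // enorm_gt0 X0.
by apply: Ck_sqrt => //; [move=> w Uw; rewrite dot_gt0 X0|exact: Ck_dot].
Qed.

(** Unit length and orthogonality are constant scalar products; differentiating them gives the
    relations between [N], [Y] and their derivatives, and the Weingarten equations. *)
Lemma pd_dot_const U X Y w v (c : R) : open U -> U w -> CkV 1 U X -> CkV 1 U Y ->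
  (forall z, U z -> dot (X z) (Y z) = c) ->
  dot (pd v X w) (Y w) + dot (X w) (pd v Y w) = 0.
Proof.
move=> oU Uw Xk Yk XYc.
have [_ <-] := is_derive_dot v Xk Yk Uw.
rewrite (near_eq_derive (g := cst c)) ?derive_cst //.
by apply: open_near_eq oU Uw _ => z; rewrite inE => /XYc.
Qed.

End VectorCalculus.

(** * The Gauss map, the connection form and its curl *)

Section ConnectionForm.
Context {R : realType}.
Implicit Types (U : set (R * R)) (f N Y : R * R -> 'rV[R]_3) (w v : R * R).

Definition nrm f w : 'rV[R]_3 := cross (pd eu f w) (pd ev f w).

Definition gauss_map f : R * R -> 'rV[R]_3 := normalized (nrm f).

(** By cyclicity this is the component of the derivative of [Y] along [N x Y]: the speed at which
    [Y] turns in the tangent plane. *)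
Definition connection N Y v w : R := dot (N w) (cross (Y w) (pd v Y w)).

Lemma is_derive_connection U N Y v v' w : open U -> CkV 1 U N -> CkV 2 U Y -> U w ->
  is_derive w v' (connection N Y v) (dot (pd v' N w) (cross (Y w) (pd v Y w)) +
     dot (N w) (cross (pd v' Y w) (pd v Y w) + cross (Y w) (pd v' (pd v Y) w))).
Proof.
move=> oU Nk Yk Uw; have Y1 := CkV_le (isT : (1 <= 2)%N) Yk.
have Yv : CkV 1 U (pd v Y) by exact: CkV_pd.
have Ck : CkV 1 U (fun w => cross (Y w) (pd v Y w)) by exact: CkV_cross.
have H := is_derive_dot v' Nk Ck Uw.
by rewrite (pd_cross v' Y1 Yv Uw) in H.
Qed.

Lemma connection_curl U N Y w : open U -> CkV 2 U N -> CkV 2 U Y ->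
  (forall z, U z -> dot (N z) (N z) = 1) -> (forall z, U z -> dot (Y z) (Y z) = 1) ->
  (forall z, U z -> dot (N z) (Y z) = 0) -> U w ->
  'D_eu (connection N Y ev) w - 'D_ev (connection N Y eu) w =
  - dot (N w) (cross (pd eu N w) (pd ev N w)).
Proof.
move=> oU Nk Yk NN YY NY Uw.
have N1 := CkV_le (isT : (1 <= 2)%N) Nk; have Y1 := CkV_le (isT : (1 <= 2)%N) Yk.
have [_ ->] := is_derive_connection ev eu oU N1 Yk Uw.
have [_ ->] := is_derive_connection eu ev oU N1 Yk Uw.
(* Now both terms contain the same mixed derivative of [Y], and it cancels. *)
rewrite (CkV_Schwarz ev eu oU Yk Uw).
have half (c : R) : c + c = 0 -> c = 0 by lra.
have self v X : CkV 1 U X -> (forall z, U z -> dot (X z) (X z) = 1) ->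
    dot (pd v X w) (X w) = 0.
  move=> Xk XX; apply: half; rewrite [in X in _ + X]dotC.
  exact: (pd_dot_const v oU Uw Xk Xk XX).
apply: structure_equation; rewrite ?NN ?YY ?NY ?self //.
- exact: (pd_dot_const _ oU Uw N1 Y1 NY).
- exact: (pd_dot_const _ oU Uw N1 Y1 NY).
Qed.

Lemma normal_fieldE U f w : CkV 1 U f -> U w -> normal_field f w = nrm f w.
Proof. by move=> fk Uw; rewrite /normal_field !(derive_pd _ fk Uw). Qed.

Lemma CkV_nrm k U f : open U -> CkV k.+1 U f -> CkV k U (nrm f).
Proof. by move=> oU fk; apply: CkV_cross => //; exact: CkV_pd. Qed.

Lemma CkV_gauss_map k U f : open U -> CkV k.+1 U f ->
  (forall w, U w -> nrm f w != 0) -> CkV k U (gauss_map f).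
Proof. by move=> oU fk f0; apply: CkV_normalized => //; exact: CkV_nrm. Qed.

Lemma gauss_map_unit f w : nrm f w != 0 -> dot (gauss_map f w) (gauss_map f w) = 1.
Proof. exact: enorm_normalize. Qed.

Lemma gauss_map_tangent f w :
  (dot (pd eu f w) (gauss_map f w) = 0) * (dot (pd ev f w) (gauss_map f w) = 0).
Proof. by rewrite !dotZr dot_cross_l dot_cross_r !mulr0. Qed.

(** The pull-back of the area form of the unit sphere under the Gauss map, that is [K] times the
    length of [nrm f]. *)
Definition curvature_density f w : R :=
  dot (gauss_map f w) (cross (pd eu (gauss_map f) w) (pd ev (gauss_map f) w)).

Lemma enorm_nrm_sqr f w : enorm (nrm f w) ^+ 2 =
  dot (pd eu f w) (pd eu f w) * dot (pd ev f w) (pd ev f w) -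
  dot (pd eu f w) (pd ev f w) ^+ 2.
Proof. by rewrite enorm_sqr Lagrange_identity (dotC (pd ev f w) (pd eu f w)) -expr2. Qed.

(* The Weingarten equations give L N - M^2 = (f_u x f_v).(N_u x N_v). *)
Lemma curvature_inE U f w : open U -> CkV 3 U f -> (forall w, U w -> nrm f w != 0) ->
  U w -> curvature_in f w = curvature_density f w / enorm (nrm f w).
Proof.
move=> oU fk f0 Uw.
have f1 := CkV_le (isT : (1 <= 3)%N) fk; have f2 := CkV_le (isT : (2 <= 3)%N) fk.
have N1 : CkV 1 U (gauss_map f) by exact: CkV_gauss_map.
have f11 v : CkV 1 U (pd v f) by exact: CkV_pd.
have dd a b : 'D_b ('D_a f) w = pd b (pd a f) w.
  rewrite -(derive_pd b (f11 a) Uw); apply: near_eq_derive.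
  apply: open_near_eq oU Uw _ => z; rewrite inE => Uz; exact: derive_pd f1 Uz.
rewrite /curvature_in !dd !(derive_pd _ f1 Uw) (normal_fieldE f1 Uw).
rewrite -[(enorm _)^-1 *: _]/(gauss_map f w).
have wein a b : (a = eu \/ a = ev) ->
    dot (pd b (pd a f) w) (gauss_map f w) = - dot (pd a f w) (pd b (gauss_map f) w).
  move=> ae; apply/eqP; rewrite -addr_eq0; apply/eqP.
  apply: (pd_dot_const b oU Uw (f11 a) N1 (c := 0)) => z Uz.
  by case: ae => ->; rewrite gauss_map_tangent.
rewrite [X in _ - X]expr2 [in X in _ * _ - X * _](CkV_Schwarz eu ev oU f2 Uw).
rewrite !wein; do ?by [left|right].
have en0 : enorm (nrm f w) != 0 by rewrite gt_eqF // enorm_gt0 f0.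
rewrite -enorm_nrm_sqr /curvature_density.
have -> : - dot (pd eu f w) (pd eu (gauss_map f) w) * - dot (pd ev f w) (pd ev (gauss_map f) w)
   - - dot (pd ev f w) (pd eu (gauss_map f) w) * - dot (pd eu f w) (pd ev (gauss_map f) w) =
   enorm (nrm f w) * dot (gauss_map f w) (cross (pd eu (gauss_map f) w) (pd ev (gauss_map f) w)).
  rewrite -dotZl scalerA mulfV // scale1r Lagrange_identity; ring.
by field.
Qed.

End ConnectionForm.

(** * Changes of charts *)

Section ChartChange.
Context {R : realType}.
Implicit Types (S : set 'rV[R]_3) (U : set (R * R)) (f : R * R -> 'rV[R]_3) (w v : R * R).

(** The norm here is the sup norm, whence the factor 3 in this form of Cauchy-Schwarz. *)
Lemma norm_dot_le (x y : 'rV[R]_3) : `|dot x y| <= 3 * `|y| * `|x|.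
Proof.
have c (z : 'rV[R]_3) i : `|z ord0 i| <= `|z|.
  by rewrite [leRHS]/Num.Def.normr /= mx_normrE; exact: (le_bigmax _ _ (ord0, i)).
rewrite dotE; apply: (@le_trans _ _ (`|x| * `|y| + `|x| * `|y| + `|x| * `|y|)).
  rewrite (le_trans (ler_normD _ _)) // lerD //; last by rewrite normrM ler_pM // c.
  by rewrite (le_trans (ler_normD _ _)) // lerD // normrM ler_pM // c.
by move: `|x| `|y| => *; lra.
Qed.

Lemma norm_row_le (x : 'rV[R]_3) (e : R) : 0 <= e -> (forall i, `|x ord0 i| <= e) ->
  `|x| <= e.
Proof.
move=> e0 xe; rewrite /Num.Def.normr /= mx_normrE bigmax_le //= => -[i j] _.
by rewrite /= ord1.
Qed.

Lemma parametrization_smooth k S U f : local_parametrization S U f -> CkV k U f.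
Proof. by case=> oU fs _ _; apply: Ck_on_CkV => //; exact: fs. Qed.

Lemma parametrization_open S U f : local_parametrization S U f -> open U.
Proof. by case. Qed.

Lemma parametrization_nrm S U f w : local_parametrization S U f -> U w -> nrm f w != 0.
Proof.
move=> fP Uw; have [_ _ f0 _] := fP; have := f0 w Uw.
by rewrite (normal_fieldE (parametrization_smooth 1 fP) Uw).
Qed.

(** The inverse [g] is a total function on space, constrained only on the part of [S] inside [W].
    Continuity along [S] is all that a chart provides for it. *)
Definition chart_inverse S U f (W : set 'rV[R]_3) (g : 'rV[R]_3 -> R * R) :=
  [/\ open W, forall w, U w -> [/\ S (f w), W (f w) & g (f w) = w],
      forall y, S y -> W y -> U (g y) /\ f (g y) = y &
      forall y, S y -> W y -> g z @[z --> within S (nbhs y)] --> g y].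

Lemma parametrization_inverse S U f : local_parametrization S U f ->
  exists W g, chart_inverse S U f W g.
Proof.
case=> oU _ _ [W [oW [[fS fI fJ] _ [g [gc gK]]]]]; exists W, g; split=> //.
- by move=> w Uw; have [] := fS w Uw; split=> //; exact: gK.
- by move=> y Sy Wy; have [w Uw <-] := fJ y (conj Sy Wy); rewrite gK.
- move=> y Sy Wy; have SWy : (S `&` W) y by [].
  have /subspace_continuousP /(_ _ SWy) := gc; apply: cvg_trans; apply: cvg_app.
  move=> A SWA; have oWy : nbhs y W by exact: open_nbhs_nbhs.
  have {}SWA : nbhs y [set z | (S `&` W) z -> A z] by exact: SWA.
  by apply: filterS2 SWA oWy => z H Wz Sz; exact: H.
Qed.

(* A chart-free differentiability along [S], with gradient [l], through which the
   derivatives in two charts are compared without differentiating the transition map. *)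
Definition hasDS S (F : 'rV[R]_3 -> R) (x l : 'rV[R]_3) := forall e : R, 0 < e ->
  \forall y \near x, S y -> `|F y - F x - dot (y - x) l| <= e * `|y - x|.

Lemma CkV_hasD U f w : open U -> CkV 1 U f -> U w -> forall e : R, 0 < e ->
  \forall h \near (0 : R * R),
    `|f (w + h) - f w - (h.1 *: pd eu f w + h.2 *: pd ev f w)| <= e * `|h|.
Proof.
move=> oU fk Uw e e0.
have fi i := C1_hasD oU (fk i) Uw e0.
have := @filter_forall (R * R)%type 'I_3
  (fun i h => `|f (w + h) ord0 i - f w ord0 i - (h.1 * 'D_eu (fun w => f w ord0 i) w
     + h.2 * 'D_ev (fun w => f w ord0 i) w)| <= e * `|h|) _ (nbhs_filter _) fi.
apply: filterS => h hi; apply: norm_row_le => [|i].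
  by rewrite mulr_ge0 // ltW.
by rewrite !mxE !pdE; exact: hi.
Qed.

(** Together with [dual_v], the basis of the tangent plane dual to [(f_u, f_v)]: a function with
    partial derivatives [a], [b] in the chart has tangential gradient
    [a *: dual_u f w + b *: dual_v f w]. *)
Definition dual_u f w : 'rV[R]_3 :=
  (dot (nrm f w) (nrm f w))^-1 *: cross (pd ev f w) (nrm f w).
Definition dual_v f w : 'rV[R]_3 :=
  (dot (nrm f w) (nrm f w))^-1 *: cross (nrm f w) (pd eu f w).

Lemma dualE f w : nrm f w != 0 ->
  [/\ dot (pd eu f w) (dual_u f w) = 1, dot (pd ev f w) (dual_u f w) = 0,
      dot (pd eu f w) (dual_v f w) = 0 & dot (pd ev f w) (dual_v f w) = 1].
Proof.
rewrite -dot_eq0 => n0; rewrite !dotZr dot_cross_l dot_cross_r !mulr0.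
have -> : dot (pd eu f w) (cross (pd ev f w) (nrm f w)) = dot (nrm f w) (nrm f w).
  by rewrite -triple_rot.
have -> : dot (pd ev f w) (cross (nrm f w) (pd eu f w)) = dot (nrm f w) (nrm f w).
  by rewrite triple_rot.
by rewrite mulVf.
Qed.

(** Pairing the chord [y - f w] with the dual basis recovers the increment [k] of the parameters up
    to [o(|k|)], so [|k|] is at most a multiple of [|y - f w|]. This estimate replaces a derivative
    of the inverse chart, whose continuity only makes [k] small. *)
Lemma chart_hasDS S U f w (F : 'rV[R]_3 -> R) a b : local_parametrization S U f ->
  U w -> hasD (F \o f) w a b -> hasDS S F (f w) (a *: dual_u f w + b *: dual_v f w).
Proof.
move=> fP Uw FD e e0.
have [W [g [oW fWg gP gc]]] := parametrization_inverse fP.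
have [Sfw Wfw gfw] := fWg _ Uw.
have oU := parametrization_open fP.
have [uu vu uv vv] := dualE (parametrization_nrm fP Uw).
set du := dual_u f w in uu vu *; set dv := dual_v f w in uv vv *.
pose C := 3 * `|du| + 3 * `|dv| + 1.
have C0 : 0 < C by rewrite ltr_wpDl // addr_ge0 // mulr_ge0.
have dC (x : 'rV[R]_3) : `|dot x du| <= C * `|x| /\ `|dot x dv| <= C * `|x|.
  split; apply: (le_trans (norm_dot_le _ _)); rewrite ler_wpM2r // /C -addrA.
    by rewrite lerDl addr_ge0 // mulr_ge0.
  by rewrite addrCA lerDl addr_ge0 // mulr_ge0.
pose M := `|a| + `|b| + 1.
have M0 : 0 < M by rewrite ltr_wpDl // addr_ge0.
(* The total error will be [2 * e1 * |k|], and [|k|] is at most [2 * C] times the length of the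
   chord. *)
pose e1 := e / (4 * C).
have e10 : 0 < e1 by rewrite divr_gt0 // mulr_gt0.
(* The first bound makes the gradient term of the remainder [r] at most [e1 * |k|]; the second lets
   [C * |r|] be absorbed into [|k| / 2]. *)
pose e2 := Num.min (e1 / (C * M)) (2 * C)^-1.
have e20 : 0 < e2 by rewrite lt_min divr_gt0 ?mulr_gt0 //= invr_gt0 mulr_gt0.
have f1 := parametrization_smooth 1 fP.
have H1 := CkV_hasD oU f1 Uw e20; have H2 := FD _ e10.
have gc' : g z - w @[z --> within S (nbhs (f w))] --> (0 : R * R).
  rewrite -(subrr w); apply: cvgB; last exact: cvg_cst.
  by rewrite -{2}gfw; exact: gc.
pose A (h : R * R) := `|f (w + h) - f w - (h.1 *: pd eu f w + h.2 *: pd ev f w)| <= e2 * `|h|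
  /\ `|F (f (w + h)) - F (f w) - (h.1 * a + h.2 * b)| <= e1 * `|h|.
have HA : \forall h \near (0 : R * R), A h by exact: filterI H1 H2.
have K1 : \forall y \near f w, S y -> A (g y - w) by exact: (gc' _ HA).
near=> y => Sy; have Wy : W y by near: y; exact: open_nbhs_nbhs.
have [Ugy fgy] := gP _ Sy Wy.
have : A (g y - w) by move: (Sy); near: y; exact: K1.
rewrite /A [w + _]addrC subrK fgy; move: (g y - w) => k [Hf HF].
set r := y - f w - (k.1 *: _ + k.2 *: _) in Hf.
have ye : y - f w = k.1 *: pd eu f w + k.2 *: pd ev f w + r by rewrite /r [RHS]addrC subrK.
have yu : dot (y - f w) du = k.1 + dot r du.
  by rewrite ye !dotDl !dotZl uu vu mulr1 mulr0 addr0.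
have yv : dot (y - f w) dv = k.2 + dot r dv.
  by rewrite ye !dotDl !dotZl uv vv mulr1 mulr0 add0r.
have [yuC yvC] := dC (y - f w); have [ruC rvC] := dC r.
have re : C * `|r| <= `|k| / 2.
  apply: (@le_trans _ _ (C * (e2 * `|k|))); first by rewrite ler_wpM2l // ltW.
  rewrite mulrA mulrC ler_wpM2l // -ler_pdivlMl // ge_min; apply/orP; right.
  by rewrite invfM mulrC.
have reM : M * (C * `|r|) <= e1 * `|k|.
  apply: (@le_trans _ _ (M * (C * (e2 * `|k|)))).
    by rewrite ler_wpM2l ?(ltW M0) // ler_wpM2l // ltW.
  rewrite mulrA [M * C]mulrC mulrA ler_wpM2r // -ler_pdivlMl ?mulr_gt0 //.
  apply: (@le_trans _ _ (e1 / (C * M))); first by rewrite /e2 ge_min lexx.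
  by rewrite [leLHS]mulrC lexx.
have kC : `|k| <= 2 * C * `|y - f w|.
  have h1 : `|k.1| <= C * `|y - f w| + `|k| / 2.
    rewrite -(addrK (dot r du) k.1) -yu (le_trans (ler_normB _ _)) // lerD //.
    exact: le_trans re.
  have h2 : `|k.2| <= C * `|y - f w| + `|k| / 2.
    rewrite -(addrK (dot r dv) k.2) -yv (le_trans (ler_normB _ _)) // lerD //.
    exact: le_trans re.
  have : `|k| <= C * `|y - f w| + `|k| / 2 by rewrite {1}prod_normE ge_max h1.
  by rewrite -mulrA; move: `|k| (C * _) => *; lra.
rewrite dotDr (dotZr a) (dotZr b) yu yv.
have -> : F y - F (f w) - (a * (k.1 + dot r du) + b * (k.2 + dot r dv)) =
   (F y - F (f w) - (k.1 * a + k.2 * b)) - (a * dot r du + b * dot r dv) by ring.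
rewrite (le_trans (ler_normB _ _)) //.
apply: (@le_trans _ _ (e1 * `|k| + e1 * `|k|)).
  apply: lerD => //; apply: le_trans reM.
  rewrite (le_trans (ler_normD _ _)) // !normrM /M.
  apply: (@le_trans _ _ (`|a| * (C * `|r|) + `|b| * (C * `|r|))).
    by apply: lerD; rewrite ler_wpM2l.
  by rewrite -mulrDl ler_wpM2r ?lerDl // mulr_ge0 // ltW.
rewrite -mulrDl.
apply: (@le_trans _ _ ((e1 + e1) * (2 * C * `|y - f w|))).
  by rewrite ler_wpM2l // addr_ge0 // ltW.
rewrite /e1 mulrA ler_wpM2r // le_eqVlt; apply/orP; left; apply/eqP.
by field; rewrite gt_eqF.
Unshelve. all: by end_near. Qed.

(** The return trip from the surface to a chart. With [chart_hasDS] for one chart and this for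
    another, derivatives pass between charts without a transition map. *)
Lemma hasDS_chart S U f w (F : 'rV[R]_3 -> R) l : local_parametrization S U f ->
  U w -> hasDS S F (f w) l -> hasD (F \o f) w (dot (pd eu f w) l) (dot (pd ev f w) l).
Proof.
move=> fP Uw FD e e0.
have oU := parametrization_open fP; have f1 := parametrization_smooth 1 fP.
pose M := `|pd eu f w| + `|pd ev f w| + 1.
have M0 : 0 < M by rewrite ltr_wpDl // addr_ge0.
pose C := 3 * `|l| + 1.
have C0 : 0 < C by rewrite ltr_wpDl // mulr_ge0.
pose e1 := e / (2 * M); have e10 : 0 < e1 by rewrite divr_gt0 // mulr_gt0.
pose e2 := Num.min 1 (e / (2 * C)).
have e20 : 0 < e2 by rewrite lt_min ltr01 divr_gt0 // mulr_gt0.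
have H1 := CkV_hasD oU f1 Uw e20.
have fc : f (w + h) @[h --> (0 : R * R)] --> f w.
  rewrite -[in X in _ --> X](addr0 w).
  apply: (@cvg_comp _ _ _ (fun h => w + h) f _ (nbhs (w + 0))).
    by apply: cvgD; [exact: cvg_cst|exact: cvg_id].
  by rewrite addr0; exact: CkV_cont f1 Uw.
have wh : w + h @[h --> (0 : R * R)] --> w.
  by rewrite -[in X in _ --> X](addr0 w); apply: cvgD; [exact: cvg_cst|exact: cvg_id].
have [W [g [_ fWg _ _]]] := parametrization_inverse fP.
near=> h.
have Uh : U (w + h) by near: h; apply: wh; exact: open_nbhs_nbhs.
have HF : S (f (w + h)) -> `|F (f (w + h)) - F (f w) - dot (f (w + h) - f w) l| <=
     e1 * `|f (w + h) - f w| by near: h; exact: (fc _ (FD _ e10)).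
have Hf : `|f (w + h) - f w - (h.1 *: pd eu f w + h.2 *: pd ev f w)| <= e2 * `|h|.
  by near: h.
have [Sh _ _] := fWg _ Uh; have {Sh}HF := HF Sh.
set r := f (w + h) - f w - (h.1 *: _ + h.2 *: _) in Hf.
have ye : f (w + h) - f w = h.1 *: pd eu f w + h.2 *: pd ev f w + r.
  by rewrite /r [RHS]addrC subrK.
have yM : `|f (w + h) - f w| <= M * `|h|.
  rewrite ye (le_trans (ler_normD _ _)) // /M mulrDl mul1r; apply: lerD.
    rewrite (le_trans (ler_normD _ _)) // !normrZ mulrDl.
    by apply: lerD; rewrite mulrC ler_wpM2l // ?norm_fst_le ?norm_snd_le.
  apply: (le_trans Hf); rewrite -[leRHS]mul1r ler_wpM2r // /e2 ge_min lexx //.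
have -> : (F \o f) (w + h) - (F \o f) w -
    (h.1 * dot (pd eu f w) l + h.2 * dot (pd ev f w) l) =
    (F (f (w + h)) - F (f w) - dot (f (w + h) - f w) l) + dot r l.
  by rewrite ye !dotDl !dotZl /=; ring.
rewrite (le_trans (ler_normD _ _)) // [e]splitr mulrDl; apply: lerD.
  apply: (le_trans HF); apply: (@le_trans _ _ (e1 * (M * `|h|))).
    by rewrite ler_wpM2l // ltW.
  rewrite mulrA ler_wpM2r // le_eqVlt; apply/orP; left; apply/eqP.
  by rewrite /e1; field; rewrite gt_eqF.
apply: (le_trans (norm_dot_le _ _)); apply: (@le_trans _ _ (C * (e2 * `|h|))).
  by apply: ler_pM => //; rewrite ?mulr_ge0 // /C lerDl.
rewrite mulrA ler_wpM2r //.
apply: (@le_trans _ _ (C * (e / (2 * C)))).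
  by rewrite ler_wpM2l ?(ltW C0) // /e2 ge_min lexx orbT.
rewrite le_eqVlt; apply/orP; left; apply/eqP; by field; rewrite gt_eqF.
Unshelve. all: by end_near. Qed.

End ChartChange.

(** * Derivatives and normals in two charts at the same point *)

Section Invariance.
Context {R : realType}.
Implicit Types (S : set 'rV[R]_3) (U : set (R * R)) (f : R * R -> 'rV[R]_3) (w v : R * R).
Implicit Types (g : R * R -> R).

Lemma cvg_dot (T : Type) (F : set_system T) (X Y : T -> 'rV[R]_3) (x y : 'rV[R]_3) :
  Filter F -> X t @[t --> F] --> x -> Y t @[t --> F] --> y ->
  dot (X t) (Y t) @[t --> F] --> dot x y.
Proof.
move=> FF Xx Yy; rewrite dotE.
rewrite (_ : (fun t => dot (X t) (Y t)) = (fun t => X t ord0 0 * Y t ord0 0 +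
   X t ord0 1 * Y t ord0 1 + X t ord0 2%:R * Y t ord0 2%:R)); last first.
  by apply/funext => t; rewrite dotE.
have co (Z : T -> 'rV[R]_3) (z : 'rV[R]_3) i : Z t @[t --> F] --> z -> Z t ord0 i @[t --> F] --> z ord0 i.
  move=> Zz; apply: (@cvg_comp _ _ _ Z (fun x : 'rV[R]_3 => x ord0 i) _ (nbhs z)) => //.
  exact: coord_continuous.
by apply: cvgD; [apply: cvgD|]; apply: cvgM; exact: co.
Qed.

Lemma hasD_near g h w a b : (\near w, g w = h w) -> hasD g w a b -> hasD h w a b.
Proof.
move=> gh gD e e0; have ghw := nbhs_singleton gh.
have wh : w + h @[h --> (0 : R * R)] --> w.
  by rewrite -[in X in _ --> X](addr0 w); apply: cvgD; [exact: cvg_cst|exact: cvg_id].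
have gh' : \forall k \near (0 : R * R), g (w + k) = h (w + k) by exact: (wh _ gh).
by apply: filterS2 gh' (gD e e0) => k <-; rewrite ghw.
Qed.

Lemma hasDZ g w a b (s : R) : hasD g w a b -> hasD (fun w => s * g w) w (s * a) (s * b).
Proof.
move=> gD e e0; have M0 : 0 < `|s| + 1 by rewrite ltr_wpDl.
have e'0 : 0 < e / (`|s| + 1) by rewrite divr_gt0.
apply: filterS (gD _ e'0) => h H.
have -> : s * g (w + h) - s * g w - (h.1 * (s * a) + h.2 * (s * b)) =
    s * (g (w + h) - g w - (h.1 * a + h.2 * b)) by ring.
rewrite normrM; apply: (@le_trans _ _ ((`|s| + 1) * (e / (`|s| + 1) * `|h|))).
  by rewrite ler_pM // lerDl.
by rewrite mulrA [_ * (e / _)]mulrC divfK // gt_eqF.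
Qed.

Lemma hasD_eu g w a b : hasD g w a b -> 'D_eu g w = a.
Proof. by move=> /(@hasD_derive _ _ _ _ _ eu) [_ ->]; rewrite mul1r mul0r addr0. Qed.

Lemma hasD_ev g w a b : hasD g w a b -> 'D_ev g w = b.
Proof. by move=> /(@hasD_derive _ _ _ _ _ ev) [_ ->]; rewrite mul1r mul0r add0r. Qed.

(* [(al, be, ga, de)] is the Jacobian of the transition map between the charts. *)
Lemma chart_change S U U' f f' w w' :
  local_parametrization S U f -> local_parametrization S U' f' -> U w -> U' w' ->
  f w = f' w' -> exists al be ga de : R, forall g g' (s : R), Ck 1 U g ->
    (\forall z' \near w', forall z, U z -> f z = f' z' -> g' z' = s * g z) ->
    'D_eu g' w' = s * (al * 'D_eu g w + be * 'D_ev g w) /\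
    'D_ev g' w' = s * (ga * 'D_eu g w + de * 'D_ev g w).
Proof.
move=> fP fP' Uw Uw' ff'.
(* The dual basis of [f] reads off the coordinates of the tangent vectors of [f'] in the basis
   [(f_u, f_v)]. They are fixed before [g] and [g'], so one Jacobian serves all functions. *)
exists (dot (pd eu f' w') (dual_u f w)), (dot (pd eu f' w') (dual_v f w)).
exists (dot (pd ev f' w') (dual_u f w)), (dot (pd ev f' w') (dual_v f w)).
move=> g g' s gk gg'.
have [W [k [oW fWk kP kc]]] := parametrization_inverse fP.
have oU := parametrization_open fP; have oU' := parametrization_open fP'.
have gD := C1_hasD oU gk Uw.
(* On the surface [g] becomes [g \o k]; its expansion along [S] is then read in the chart [f']. *)
have FD : hasD ((g \o k) \o f) w ('D_eu g w) ('D_ev g w).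
  apply: hasD_near gD; apply: open_near_eq oU Uw _ => z; rewrite inE => Uz /=.
  by have [_ _ ->] := fWk _ Uz.
have := chart_hasDS fP Uw FD; rewrite ff' => FS.
have := hasDZ s (hasDS_chart fP' Uw' FS) => {}FD.
have FD' : hasD g' w' (s * dot (pd eu f' w') ('D_eu g w *: dual_u f w + 'D_ev g w *: dual_v f w))
    (s * dot (pd ev f' w') ('D_eu g w *: dual_u f w + 'D_ev g w *: dual_v f w)).
  apply: hasD_near FD; have fc' := CkV_cont (parametrization_smooth 1 fP') Uw'.
  have [W' [k' [_ fWk' _ _]]] := parametrization_inverse fP'.
  have Ww : W (f' w') by rewrite -ff'; have [] := fWk _ Uw.
  near=> z'; have Uz' : U' z' by near: z'; exact: open_nbhs_nbhs.
  have Wz' : W (f' z') by near: z'; apply: fc'; exact: open_nbhs_nbhs.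
  have [Sz' _ _] := fWk' _ Uz'; have [Uk fk] := kP _ Sz' Wz'.
  by apply/esym => /=; move: Uk fk; near: z'; apply: filterS gg' => z' H Uk fk; exact: H.
rewrite (hasD_eu FD') (hasD_ev FD') !dotDr.
by split; congr (s * (_ + _)); rewrite dotZr; exact: mulrC.
Unshelve. all: by end_near. Qed.

Lemma chart_change_vec S U U' f f' w w' :
  local_parametrization S U f -> local_parametrization S U' f' -> U w -> U' w' ->
  f w = f' w' -> exists al be ga de : R,
  [/\ forall g g' (s : R), Ck 1 U g ->
      (\forall z' \near w', forall z, U z -> f z = f' z' -> g' z' = s * g z) ->
      'D_eu g' w' = s * (al * 'D_eu g w + be * 'D_ev g w) /\
      'D_ev g' w' = s * (ga * 'D_eu g w + de * 'D_ev g w),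
    forall X X' (s : R), CkV 1 U X ->
      (\forall z' \near w', forall z, U z -> f z = f' z' -> X' z' = s *: X z) ->
      pd eu X' w' = s *: (al *: pd eu X w + be *: pd ev X w) /\
      pd ev X' w' = s *: (ga *: pd eu X w + de *: pd ev X w) &
    nrm f' w' = (al * de - be * ga) *: nrm f w].
Proof.
move=> fP fP' Uw Uw' ff'.
have [al [be [ga [de H]]]] := chart_change fP fP' Uw Uw' ff'.
have HV X X' (s : R) : CkV 1 U X ->
      (\forall z' \near w', forall z, U z -> f z = f' z' -> X' z' = s *: X z) ->
      pd eu X' w' = s *: (al *: pd eu X w + be *: pd ev X w) /\
      pd ev X' w' = s *: (ga *: pd eu X w + de *: pd ev X w).
  move=> Xk XX'.
  have c i := H _ (fun z => X' z ord0 i) s (Xk i).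
  split; apply/rowP => i; rewrite !mxE !pdE.
    apply: (c i _).1; apply: filterS XX' => z' XX' z Uz fz.
    by rewrite (XX' _ Uz fz) mxE.
  apply: (c i _).2; apply: filterS XX' => z' XX' z Uz fz.
  by rewrite (XX' _ Uz fz) mxE.
exists al, be, ga, de; split=> //.
(* The charts themselves are related fields, with [s = 1]. *)
have [|Eu Ev] := HV f f' 1 (parametrization_smooth 1 fP).
  by near=> z' => z _ ->; rewrite scale1r.
rewrite /nrm Eu Ev !scale1r; move: (pd eu f w) (pd ev f w) => x y.
by apply: row3P; rewrite !(crossE, mxE); ring.
Unshelve. all: by end_near. Qed.

Lemma gauss_map_sign S U U' f f' w w' :
  local_parametrization S U f -> local_parametrization S U' f' -> U w -> U' w' ->
  f w = f' w' -> exists2 s : R, s = 1 \/ s = -1 & gauss_map f' w' = s *: gauss_map f w.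
Proof.
move=> fP fP' Uw Uw' ff'.
have [al [be [ga [de [_ _ E]]]]] := chart_change_vec fP fP' Uw Uw' ff'.
have n' := parametrization_nrm fP' Uw'.
have D0 : al * de - be * ga != 0 by apply: contraNneq n' => D0; rewrite E D0 scale0r.
exists (Num.sg (al * de - be * ga)).
  by case: sgrP D0; rewrite ?eqxx //; [left|right].
rewrite /gauss_map /normalized E enormZ !scalerA; congr (_ *: _).
rewrite invfM mulrAC; congr (_ * _).
by rewrite mulrC {1}(numEsg (_ - _)) -mulrA divff ?mulr1 // normr_eq0.
Qed.

(** The chain rule in [chart_change_vec] differentiates the relation between two fields, so a single
    sign must serve a whole neighbourhood of [w']. *)
Lemma gauss_map_sign_near S U U' f f' w w' (s : R) :
  local_parametrization S U f -> local_parametrization S U' f' -> U w -> U' w' ->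
  f w = f' w' -> s = 1 \/ s = -1 -> gauss_map f' w' = s *: gauss_map f w ->
  \forall z' \near w', forall z, U z -> f z = f' z' -> gauss_map f' z' = s *: gauss_map f z.
Proof.
move=> fP fP' Uw Uw' ff' s1 sE.
have [W [k [oW fWk kP kc]]] := parametrization_inverse fP.
have oU := parametrization_open fP; have oU' := parametrization_open fP'.
have [W' [k' [_ fWk' _ _]]] := parametrization_inverse fP'.
have [Sf Wf kf] := fWk _ Uw.
have fc' := CkV_cont (parametrization_smooth 1 fP') Uw'.
have Nk : CkV 1 U (gauss_map f).
  by apply: CkV_gauss_map => //; [exact: parametrization_smooth fP|move=> z; exact: parametrization_nrm fP].
have Nk' : CkV 1 U' (gauss_map f').
  by apply: CkV_gauss_map => //; [exact: parametrization_smooth fP'|move=> z; exact: parametrization_nrm fP'].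
have Nc := CkV_cont Nk Uw; have Nc' := CkV_cont Nk' Uw'.
have ss : s * s = 1 by case: s1 => ->; rewrite ?mulrNN mulr1.
have NN : dot (gauss_map f w) (gauss_map f w) = 1.
  by rewrite gauss_map_unit // (parametrization_nrm fP).
(* the scalar product of the two normals is continuous, and it is s at w' *)
have near_s : \forall z' \near w', forall z, U z -> f z = f' z' ->
    `|dot (gauss_map f z) (gauss_map f' z') - s| < 1.
  pose r := 1 / (3 * (3 * 1 + 1)).
  have kc' : gauss_map f (k (f' z')) @[z' --> w'] --> gauss_map f w.
    apply: (@cvg_comp _ _ _ (fun z' => k (f' z')) (gauss_map f) _ (nbhs w)); last exact: Nc.
    rewrite -kf ff'.
    apply: (@cvg_trans _ (k y @[y --> within S (nbhs (f' w'))])); last first.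
      by rewrite -ff'; exact: kc.
    move=> A HA; have {}HA : nbhs (f' w') [set y | S y -> A (k y)] by exact: HA.
    have H1 : \forall z' \near w', S (f' z') -> A (k (f' z')) by exact: (fc' _ HA).
    have H2 : \forall z' \near w', U' z' by exact: open_nbhs_nbhs.
    suff : \forall z' \near w', A (k (f' z')) by [].
    by apply: filterS2 H1 H2 => z' H3 Uz'; apply: H3; have [] := fWk' _ Uz'.
  have dc : dot (gauss_map f (k (f' z'))) (gauss_map f' z') @[z' --> w'] --> s.
    have -> : s = dot (gauss_map f w) (gauss_map f' w') by rewrite sE dotZr NN mulr1.
    exact: cvg_dot kc' Nc'.
  move/cvgrPdist_lt: dc => /(_ _ ltr01); apply: filterS => z' H z Uz fz.
  have [_ _ kz] := fWk _ Uz.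
  by rewrite distrC; move: H; rewrite -fz kz.
near=> z' => z Uz fz.
have Uz' : U' z' by near: z'; exact: open_nbhs_nbhs.
have [t t1 tE] := gauss_map_sign fP fP' Uz Uz' fz.
rewrite tE; congr (_ *: _).
have : `|dot (gauss_map f z) (gauss_map f' z') - s| < 1 by move: (z) Uz fz; near: z'.
rewrite tE dotZr gauss_map_unit ?(parametrization_nrm fP) // mulr1.
case: t1 => ->; case: s1 => -> //.
  by rewrite opprK ger0_norm => *; lra.
by rewrite ler0_norm => *; lra.
Unshelve. all: by end_near. Qed.

End Invariance.

(** * Densities that do not depend on the chart *)

Section InvariantDensities.
Context {R : realType}.
Implicit Types (S : set 'rV[R]_3) (U : set (R * R)) (f : R * R -> 'rV[R]_3) (w v : R * R).
Implicit Types (V : 'rV[R]_3 -> 'rV[R]_3) (rho : 'rV[R]_3 -> R).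

Lemma gauss_map_signD f f' w w' (D s : R) : nrm f w != 0 -> nrm f' w' = D *: nrm f w ->
  gauss_map f' w' = s *: gauss_map f w -> D = s * `|D|.
Proof.
move=> n0 E sE; have [->|D0] := eqVneq D 0; first by rewrite normr0 mulr0.
have NN := gauss_map_unit n0.
have n0' : `|D| != 0 by rewrite normr_eq0.
have en0 : enorm (nrm f w) != 0 by rewrite gt_eqF // enorm_gt0.
have : dot (gauss_map f' w') (gauss_map f w) = s by rewrite sE dotZl NN mulr1.
have -> : gauss_map f' w' = (D / `|D|) *: gauss_map f w.
  rewrite /gauss_map /normalized E enormZ !scalerA; congr (_ *: _).
  by field; rewrite ?n0' ?en0.
by rewrite dotZl NN mulr1 => <-; rewrite divfK.
Qed.

Lemma gauss_map_Ck k S U f : local_parametrization S U f -> CkV k U (gauss_map f).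
Proof.
move=> fP; apply: CkV_gauss_map; first exact: parametrization_open fP.
  exact: parametrization_smooth fP.
by move=> w; exact: parametrization_nrm fP.
Qed.

(** With [D] the Jacobian and [s] its sign, the numerator is multiplied by [s^3 * D = |D|], and so
    is the length of the normal: no orientation enters. *)
Lemma curvature_density_chart S U U' f f' w w' :
  local_parametrization S U f -> local_parametrization S U' f' -> U w -> U' w' ->
  f w = f' w' -> curvature_density f' w' / enorm (nrm f' w') =
                 curvature_density f w / enorm (nrm f w).
Proof.
move=> fP fP' Uw Uw' ff'.
have [al [be [ga [de [_ HV E]]]]] := chart_change_vec fP fP' Uw Uw' ff'.
have [s s1 sE] := gauss_map_sign fP fP' Uw Uw' ff'.
have [Eu Ev] := HV _ _ s (gauss_map_Ck 1 fP) (gauss_map_sign_near fP fP' Uw Uw' ff' s1 sE).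
have n0 := parametrization_nrm fP Uw; have n0' := parametrization_nrm fP' Uw'.
have DE := gauss_map_signD n0 E sE.
have D0 : `|al * de - be * ga| != 0.
  by rewrite normr_eq0; apply: contraNneq n0' => D0; rewrite E D0 scale0r.
have en0 : enorm (nrm f w) != 0 by rewrite gt_eqF // enorm_gt0.
rewrite E enormZ /curvature_density sE Eu Ev.
move: (gauss_map f w) (pd eu (gauss_map f) w) (pd ev (gauss_map f) w) => N Nu Nv.
have ss : s * s = 1 by case: s1 => ->; rewrite ?mulrNN mulr1.
have -> : dot (s *: N) (cross (s *: (al *: Nu + be *: Nv)) (s *: (ga *: Nu + de *: Nv))) =
    (s * s) * s * (al * de - be * ga) * dot N (cross Nu Nv).
  by rewrite !(crossE, dotE, mxE); ring.
rewrite ss mul1r {1}DE mulrA ss mul1r.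
by field; rewrite en0 D0.
Qed.

(** [gauss_curvature] picks one value among those computed in all charts through the point; they
    agree, so any chart may be used. *)
Lemma gauss_curvatureE S U f w : local_parametrization S U f -> U w ->
  gauss_curvature S (f w) = curvature_density f w / enorm (nrm f w).
Proof.
move=> fP Uw; rewrite /gauss_curvature; case: xgetP => [K _ [U' [f' [w' [fP' Uw' ff' ->]]]]|].
  rewrite (@curvature_inE _ U') //.
  - by apply: curvature_density_chart fP fP' Uw Uw' _.
  - exact: parametrization_open fP'.
  - exact: parametrization_smooth fP'.
  - by move=> z; exact: parametrization_nrm fP'.
by move=> /(_ (curvature_in f w)) []; exists U, f, w.
Qed.

(** Crossing with the normal turns a [V] that is merely not normal into a nonzero tangent vector,
    and makes the field change sign together with the Gauss map. *)
Definition tangent_field V f : R * R -> 'rV[R]_3 :=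
  normalized (fun w => cross (gauss_map f w) (V (f w))).

Definition connection_form V f v : R * R -> R :=
  connection (gauss_map f) (tangent_field V f) v.

Definition twist rho V f w : R :=
  ('D_eu (rho \o f) w * connection_form V f ev w -
   'D_ev (rho \o f) w * connection_form V f eu w) / enorm (nrm f w).

(** [V] may leave the tangent plane but is never normal. Class C^2 is what the curl of the
    connection form takes, as it involves two derivatives of the tangent field. *)
Definition transverse_free S V := forall U f, local_parametrization S U f ->
  CkV 2 U (V \o f) /\ forall w, U w -> cross (gauss_map f w) (V (f w)) != 0.

Lemma tangent_field_C2 S U V f : transverse_free S V -> local_parametrization S U f ->
  CkV 2 U (tangent_field V f).
Proof.
move=> VS fP; have [Vk V0] := VS _ _ fP; have oU := parametrization_open fP.
apply: (@CkV_normalized _ 2 U (fun w => cross (gauss_map f w) (V (f w))) oU V0).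
exact: (@CkV_cross _ 2 U (gauss_map f) (V \o f) oU (gauss_map_Ck 2 fP) Vk).
Qed.

Lemma tangent_field_sign V f f' w w' (s : R) : s = 1 \/ s = -1 -> f w = f' w' ->
  gauss_map f' w' = s *: gauss_map f w -> tangent_field V f' w' = s *: tangent_field V f w.
Proof.
move=> s1 ff' sE; rewrite /tangent_field /normalized sE -ff' crossZl enormZ.
have -> : `|s| = 1 by case: s1 => ->; rewrite ?normrN normr1.
by rewrite mul1r !scalerA mulrC.
Qed.

Lemma connection_formZ (N Y Y' : 'rV[R]_3) (s : R) : s * s = 1 ->
  dot (s *: N) (cross (s *: Y) (s *: Y')) = s * dot N (cross Y Y').
Proof.
by move=> ss; rewrite crossZl crossZr dotZl !dotZr !mulrA ss mul1r.
Qed.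

(** The connection form is cubic in the sign [s], hence multiplied by [s]; the wedge product
    contributes the Jacobian [D]. Since [s * D = |D|], the quotient by the length of the normal is
    unchanged. *)
Lemma twist_chart S U U' V rho f f' w w' : transverse_free S V ->
  local_parametrization S U f -> local_parametrization S U' f' -> Ck 1 U (rho \o f) ->
  U w -> U' w' -> f w = f' w' -> twist rho V f' w' = twist rho V f w.
Proof.
move=> VS fP fP' rk Uw Uw' ff'.
have [al [be [ga [de [H HV E]]]]] := chart_change_vec fP fP' Uw Uw' ff'.
have [s s1 sE] := gauss_map_sign fP fP' Uw Uw' ff'.
have sn := gauss_map_sign_near fP fP' Uw Uw' ff' s1 sE.
have ss : s * s = 1 by case: s1 => ->; rewrite ?mulrNN mulr1.
have Y1 : CkV 1 U (tangent_field V f) := CkV_le (isT : (1 <= 2)%N) (tangent_field_C2 VS fP).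
have Ysn : \forall z' \near w', forall z, U z -> f z = f' z' ->
    tangent_field V f' z' = s *: tangent_field V f z.
  apply: filterS sn => z' Hz z Uz fz.
  exact: tangent_field_sign s1 fz (Hz _ Uz fz).
have [Eu Ev] := HV _ _ s Y1 Ysn.
have [|ru rv] := H _ (rho \o f') 1 rk.
  by near=> z' => z Uz /= ->; rewrite mul1r.
have n0 := parametrization_nrm fP Uw; have n0' := parametrization_nrm fP' Uw'.
have DE := gauss_map_signD n0 E sE.
have D0 : `|al * de - be * ga| != 0.
  by rewrite normr_eq0; apply: contraNneq n0' => D0; rewrite E D0 scale0r.
have en0 : enorm (nrm f w) != 0 by rewrite gt_eqF // enorm_gt0.
rewrite /twist E enormZ ru rv /connection_form /connection sE Eu Ev.
rewrite (tangent_field_sign V s1 ff' sE) !connection_formZ // !mul1r.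
rewrite !crossDr !dotDr !crossZr !dotZr.
move: ('D_eu (rho \o f) w) ('D_ev (rho \o f) w) => p q.
move: (dot _ _) (dot _ _) => b a.
have -> : (al * p + be * q) * (s * (ga * a + de * b)) - (ga * p + de * q) * (s * (al * a + be * b))
   = s * (al * de - be * ga) * (p * b - q * a) by ring.
rewrite {1}DE mulrA ss mul1r.
by field; rewrite en0 D0.
Unshelve. all: by end_near. Qed.

Lemma twist_eq0 S U V rho f w : local_parametrization S U f -> U w ->
  (\forall y \near f w, rho y = 0) -> twist rho V f w = 0.
Proof.
move=> fP Uw r0; have fc := CkV_cont (parametrization_smooth 1 fP) Uw.
have r0' : \forall z \near w, (rho \o f) z = cst 0 z by exact: (fc _ r0).
have D v : 'D_v (rho \o f) w = 0 by rewrite (near_eq_derive _ r0') derive_cst.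
have -> : twist rho V f w = ('D_eu (rho \o f) w * connection_form V f ev w -
  'D_ev (rho \o f) w * connection_form V f eu w) / enorm (nrm f w) by [].
by rewrite (D eu) (D ev) !mul0r subrr mul0r.
Qed.

Lemma curvature_exact S U V f w : transverse_free S V -> local_parametrization S U f -> U w ->
  'D_eu (connection_form V f ev) w - 'D_ev (connection_form V f eu) w =
  - curvature_density f w.
Proof.
move=> VS fP Uw; have [_ V0] := VS _ _ fP.
apply: (@connection_curl _ U) => //.
- exact: parametrization_open fP.
- exact: gauss_map_Ck fP.
- exact: tangent_field_C2 VS fP.
- by move=> z Uz; rewrite gauss_map_unit // (parametrization_nrm fP).
- by move=> z Uz; exact: enorm_normalize (V0 _ Uz).
- by move=> z Uz; rewrite dotZr dot_cross_l mulr0.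
Qed.

Lemma connection_form_C1 S U V f v : transverse_free S V -> local_parametrization S U f ->
  Ck 1 U (connection_form V f v).
Proof.
move=> VS fP; have oU := parametrization_open fP.
have Y2 := tangent_field_C2 VS fP.
apply: (@Ck_dot _ 1 U (gauss_map f) _ oU (gauss_map_Ck 1 fP)).
apply: (@CkV_cross _ 1 U (tangent_field V f) _ oU _ (CkV_pd v Y2)).
exact: CkV_le (isT : (1 <= 2)%N) Y2.
Qed.

End InvariantDensities.

(** * Integration in charts and Stokes' theorem *)

Section DensityPushforward.
Local Open Scope ereal_scope.
Context d1 d2 (T1 : measurableType d1) (T2 : measurableType d2) (R : realType).
Variables (m1 : {measure set T1 -> \bar R}) (m2 : {measure set T2 -> \bar R}).
Variables (U : set T1) (D : set T2) (phi : T1 -> T2) (delta : T1 -> \bar R).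
Hypotheses (mU : measurable U) (mD : measurable D) (mphi : measurable_fun U phi)
  (mdelta : measurable_fun U delta) (delta0 : forall x, 0 <= delta x)
  (phiD : forall x, U x -> D (phi x))
  (m2E : forall B, measurable B -> B `<=` D ->
     m2 B = \int[m1]_(x in U `&` phi @^-1` B) delta x).

Let integral_density_indic (E : set T2) : measurable E ->
  \int[m2]_(y in D) (\1_E y)%:E = \int[m1]_(x in U) ((\1_E (phi x))%:E * delta x).
Proof.
move=> mE; rewrite integral_indic // m2E; last 2 first.
- exact: measurableI.
- by move=> y [].
rewrite integral_mkcondr; apply: eq_integral => x; rewrite inE => Ux.
rewrite patchE; case: ifPn => [|].
  by rewrite inE /= => -[Ex _]; rewrite indicE mem_set // mul1e.
rewrite notin_setE /= => nE; rewrite indicE memNset ?mul0e // => Ex.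
by apply: nE; split => //; exact: phiD.
Qed.

Let mcomp (f : T2 -> \bar R) : measurable_fun setT f ->
  measurable_fun U (fun x => f (phi x) * delta x).
Proof.
move=> mf; apply: emeasurable_funM => //.
exact: (measurable_comp measurableT _ mf mphi).
Qed.

Import HBNNSimple.

Let integral_density_nnsfun (f : {nnsfun T2 >-> R}) :
  \int[m2]_(y in D) (f y)%:E = \int[m1]_(x in U) ((f (phi x))%:E * delta x).
Proof.
under [LHS]eq_integral do rewrite fimfunE -fsumEFin//.
rewrite [LHS]ge0_integral_fsum//; last 2 first.
  - by move=> r; exact/measurable_EFinP/measurableT_comp.
  - by move=> n x _; rewrite EFinM nnfun_muleindic_ge0.
under [RHS]eq_integral.
  move=> x xD; rewrite fimfunE -fsumEFin// ge0_mule_fsuml; last first.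
    by move=> r; rewrite EFinM nnfun_muleindic_ge0.
  over.
rewrite [RHS]ge0_integral_fsum//; last 2 first.
  - move=> r; apply: (mcomp (f := fun y => (r * \1_(f @^-1` [set r]) y)%:E)).
    by apply/measurable_EFinP/measurableT_comp.
  - by move=> n x _; rewrite EFinM mule_ge0 // nnfun_muleindic_ge0.
apply: eq_fsbigr => r rf.
have r0 : (0 <= r)%R.
  by move: rf; rewrite inE => -[y _ <-].
under [LHS]eq_integral do rewrite EFinM.
have m1r : measurable_fun setT (fun y => (\1_(f @^-1` [set r]) y : R)%:E).
  exact/measurable_EFinP/measurable_indic.
rewrite ge0_integralZl //; last exact: measurable_funTS.
rewrite integral_density_indic // -ge0_integralZl //; last first.
- by move=> x _; rewrite mule_ge0 // lee_fin indicE.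
- exact: mcomp m1r.
by apply: eq_integral => x _; rewrite EFinM muleA.
Qed.

(** [m2E] is the case of indicators; linearity gives simple functions and monotone convergence the
    rest. *)
Lemma ge0_integral_density (f : T2 -> \bar R) : measurable_fun setT f ->
  (forall y, 0 <= f y) ->
  \int[m2]_(y in D) f y = \int[m1]_(x in U) (f (phi x) * delta x).
Proof.
move=> mf f0; pose f_ := nnsfun_approx measurableT mf.
have fcvg y : (f_ n y)%:E @[n --> \oo] --> f y by exact: cvg_nnsfun_approx.
have fnd y : nondecreasing_seq (fun n => (f_ n y)%:E).
  by move=> a b ab; rewrite lee_fin; exact/lefP/nd_nnsfun_approx.
transitivity (lim (\int[m2]_(y in D) (f_ n y)%:E @[n --> \oo])).
  rewrite -monotone_convergence//=.
  - by apply: eq_integral => y _; apply/esym/cvg_lim.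
  - by move=> n; exact/measurable_EFinP/measurable_funTS.
  - by move=> n y _; rewrite lee_fin.
transitivity (lim (\int[m1]_(x in U) ((f_ n (phi x))%:E * delta x) @[n --> \oo])).
  by apply: congr_lim; apply/funext => n; exact: integral_density_nnsfun.
rewrite -monotone_convergence//=.
- apply: eq_integral => x _; apply/cvg_lim => //.
  have := fcvg (phi x); move: (fnd (phi x)).
  set u := (fun n => (f_ n (phi x))%:E) => und ucvg.
  have u0 n : 0 <= u n by rewrite lee_fin.
  case: (delta x) (delta0 x) => [r| |//] dr.
  + by rewrite muleC; under eq_fun do rewrite muleC; apply: cvgeZl.
  (* Multiplication by [+oo] is not continuous at 0. A limit 0 forces all terms of the nondecreasing
     sequence to be 0, while a positive limit makes the products eventually [+oo]. *)
  + have [fx0|fx0] := eqVneq (f (phi x)) 0.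
      have uE n : u n = 0.
        apply/eqP; rewrite eq_le u0 andbT -fx0.
        have /ereal_nondecreasing_cvgn := und; move/(cvg_unique _ ucvg) => -> //.
        by apply: ereal_sup_ubound; exists n.
      rewrite fx0 mul0e (_ : (fun n => _) = cst 0); first exact: cvg_cst.
      by apply/funext => n; rewrite -[X in X * _]/(u n) uE mul0e.
    have f0' : 0 < f (phi x) by rewrite lt0e fx0 f0.
    rewrite gt0_muley //.
    have [n0 _ un0] : \forall n \near \oo, 0 < u n by exact: (ucvg _ (open_ereal_gt' f0')).
    apply: cvg_near_cst; exists n0 => // n /un0 /= un.
    by rewrite gt0_muley.
- by move=> n; apply: (mcomp (f := fun y => (f_ n y)%:E)); exact/measurable_EFinP.
- by move=> n x _; rewrite mule_ge0 // lee_fin.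
- by move=> x _ a b ab; rewrite lee_wpmul2r //; exact: fnd.
Qed.

End DensityPushforward.

(** * Measurability and integrability of continuous functions *)

Section BorelPlane.
Context {R : realType}.
Local Notation plane := (measurableTypeR R * measurableTypeR R)%type.
Local Notation lambda2 := (lebesgue_measure \x lebesgue_measure : {measure set plane -> \bar R})%E.
Implicit Types (U : set (R * R)) (h : R * R -> R).

(** The product sigma-algebra is generated by rectangles, not by open sets; [U] is the countable
    union of the squares inside it with rational centre and half side [1 / (n + 1)]. *)
Lemma open_measurable_plane U : open U -> measurable (U : set plane).
Proof.
move=> oU.
pose box (q1 q2 : rat) (n : nat) : set plane :=
  `](ratr q1 - n.+1%:R^-1), (ratr q1 + n.+1%:R^-1)[%classic `*`
  `](ratr q2 - n.+1%:R^-1), (ratr q2 + n.+1%:R^-1)[%classic.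
pose F q1 q2 n := if pselect (box q1 q2 n `<=` U) then box q1 q2 n else set0.
have -> : (U : set plane) = \bigcup_q1 \bigcup_q2 \bigcup_n F q1 q2 n.
  apply/seteqP; split=> [w Uw|w [q1 _ [q2 _ [n _]]]]; last first.
    by rewrite /F; case: pselect => // sU; exact: sU.
  have [d /= d0 dU] := (nbhs_ballP _ _).1 (open_nbhs_nbhs (conj oU Uw)).
  have d20 : 0 < d / 2 by rewrite divr_gt0.
  have [n nd] : exists n : nat, n.+1%:R^-1 < d / 2.
    have [n _ H] := near_infty_natSinv_lt (PosNum d20); exists n.
    by apply: (H n) => /=.
  have n0 : 0 < n.+1%:R^-1 :> R by rewrite invr_gt0.
  have approx (x : R) : exists q : rat, x \in `](ratr q - n.+1%:R^-1), (ratr q + n.+1%:R^-1)[.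
    have lt_x : x < x + n.+1%:R^-1 by rewrite ltrDl.
    have [q] := rat_in_itvoo lt_x; rewrite in_itv /= => /andP[q1 q2]; exists q.
    rewrite in_itv /=; move: q1 q2 n0; move: (n.+1%:R^-1) (ratr q) => e t *.
    by apply/andP; split; lra.
  have [q1 q1P] := approx w.1; have [q2 q2P] := approx w.2.
  exists q1 => //; exists q2 => //; exists n => //.
  suff sU : box q1 q2 n `<=` U by rewrite /F; case: pselect => // _; split.
  move=> z [z1 z2]; apply: dU; move: z1 z2 q1P q2P.
  rewrite -ball_normE /= prod_normE gt_max /= !in_itv /= !ltr_norml.
  move=> H1 H2 H3 H4; move: nd n0 H1 H2 H3 H4; move: (n.+1%:R^-1) (ratr q1) (ratr q2) => e t1 t2 ? ?.
  by do 4 (move=> /andP[? ?]); apply/andP; split; apply/andP; split; lra.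
apply: bigcupT_measurable_rat => q1; apply: bigcupT_measurable_rat => q2.
apply: bigcupT_measurable => n; rewrite /F; case: pselect => sU; last exact: measurable0.
by apply: measurableX; exact: measurable_itv.
Qed.

Lemma measurable_fun_open_preimage d (T : measurableType d) (D : set T) (g : T -> R) :
  (forall O : set R, open O -> measurable (D `&` g @^-1` O)) -> measurable_fun D g.
Proof.
move=> H; apply: (measurability _ (RGenOpens.measurableE R)).
by move=> _ [_ [a [b ->] <-]]; apply: H; exact: interval_open.
Qed.

Lemma Ck0_measurable U h : open U -> Ck 0 U h -> measurable_fun (U : set plane) h.
Proof.
move=> oU hc; apply: measurable_fun_open_preimage => O oO.
apply: open_measurable_plane; rewrite openE => w [Uw Ow].
apply: filterI; first exact: open_nbhs_nbhs.
exact: (hc w Uw _ (open_nbhs_nbhs (conj oO Ow))).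
Qed.

Lemma measurable_to_borel3 U (f : R * R -> 'rV[R]_3) : open U ->
  (forall w, U w -> {for w, continuous f}) ->
  measurable_fun (U : set plane) (f : plane -> @borel3 R).
Proof.
move=> oU fc; apply: (measurability _ (erefl : @measurable _ (@borel3 R) = _)).
move=> _ [A oA <-]; apply: open_measurable_plane; rewrite openE => w [Uw Aw].
apply: filterI; first exact: open_nbhs_nbhs.
exact: (fc w Uw _ (open_nbhs_nbhs (conj oA Aw))).
Qed.

Lemma open_measurable_borel3 (O : set 'rV[R]_3) : open O -> measurable (O : set (@borel3 R)).
Proof. by move=> oO; apply: sub_sigma_algebra. Qed.

Lemma closed_measurable_borel3 (A : set 'rV[R]_3) : closed A -> measurable (A : set (@borel3 R)).
Proof.
by move=> /closed_openC/open_measurable_borel3/measurableC; rewrite setCK.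
Qed.

Lemma within_continuous_measurable_borel3 (D : set 'rV[R]_3) (G : 'rV[R]_3 -> R) :
  measurable (D : set (@borel3 R)) ->
  (forall y, D y -> G z @[z --> within D (nbhs y)] --> G y) ->
  measurable_fun (D : set (@borel3 R)) (G : @borel3 R -> R).
Proof.
move=> mD Gc; apply: measurable_fun_open_preimage => O oO.
pose V : set 'rV[R]_3 := [set z | D z -> O (G z)]°.
have -> : D `&` G @^-1` O = D `&` V.
  apply/seteqP; split=> y [Dy Oy]; split=> //.
    exact: (Gc y Dy _ (open_nbhs_nbhs (conj oO Oy))).
  by have /interior_subset := Oy; exact.
apply: measurableI => //; apply: open_measurable_borel3; exact: open_interior.
Qed.

Lemma finite_square (M : R) : (lambda2 (`[(- M)%R, M] `*` `[(- M)%R, M]) < +oo)%E.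
Proof.
pose I : set (measurableTypeR R) := `[(- M)%R, M]%classic.
have -> : (lambda2 (I `*` I) = lebesgue_measure I * lebesgue_measure I)%E.
  by apply: product_measure1E; exact: measurable_itv.
by rewrite lebesgue_measure_itv /=; case: ifP => _; rewrite ?mule0 // -EFinB -EFinM ltry.
Qed.

Lemma Ck0_integrable h (M : R) : Ck 0 setT h -> (forall w, M < `|w| -> h w = 0) ->
  lambda2.-integrable setT (EFin \o h).
Proof.
move=> hc h0.
set B : set plane := `[- M, M] `*` `[- M, M].
have mB : measurable B by apply: measurableX; exact: measurable_itv.
have outB w : ~ B w -> h w = 0.
  move=> nB; apply: h0; rewrite ltNge; apply/negP; rewrite prod_normE ge_max => /andP[].
  by rewrite !ler_norml => w1 w2; apply: nB; split; rewrite /= in_itv.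
have -> : EFin \o h = (EFin \o h) \_ B.
  apply/funext => w; rewrite patchE; case: ifPn => //.
  by rewrite notin_setE => /outB /= ->.
apply/(integrable_mkcond _ mB); apply: measurable_bounded_integrable => //.
- exact: finite_square.
- apply: (measurable_funS measurableT) => //; apply: Ck0_measurable => //; exact: openT.
- have cB : compact (B : set (R * R)).
    by apply: compact_setX; exact: segment_compact.
  have : compact (h @` (B : set (R * R))).
    apply: continuous_compact => //; apply: continuous_subspaceT => w; exact: hc.
  move=> /compact_bounded [N [Nr HN]]; exists N; split=> // x Nx w Bw.
  by apply: (HN x Nx); exists w.
Qed.

End BorelPlane.

(** * Stokes' theorem for compactly supported functions on the plane *)

Section PlaneStokes.
Context {R : realType}.
Local Notation plane := (measurableTypeR R * measurableTypeR R)%type.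
Local Notation lambda2 := (lebesgue_measure \x lebesgue_measure : {measure set plane -> \bar R})%E.
Implicit Types (U K : set (R * R)) (h P : R * R -> R).

Lemma Ck_setU k U U' h : Ck k U h -> Ck k U' h -> Ck k (U `|` U') h.
Proof.
elim: k h => [|k IH] h; first by move=> hU hU' w [Uw|U'w]; [exact: hU|exact: hU'].
move=> [hc hd hD] [hc' hd' hD']; split.
- by move=> w [Uw|U'w]; [exact: hc|exact: hc'].
- by move=> w v [Uw|U'w]; [exact: hd|exact: hd'].
- by move=> v; apply: IH; [exact: hD|exact: hD'].
Qed.

Lemma plane_closed K : compact K -> closed K.
Proof. by apply: compact_closed; exact: norm_hausdorff. Qed.

(** The open sets [U] and the complement of [K] cover the plane; the extension by zero agrees with
    [h] on the first and vanishes on the second. *)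
Lemma Ck_patch k U K h : open U -> compact K -> K `<=` U ->
  (forall w, U w -> ~ K w -> h w = 0) -> Ck k U h -> Ck k setT (h \_ U).
Proof.
move=> oU cK KU h0 hk.
have -> : [set: R * R] = U `|` ~` K.
  by apply/seteqP; split=> // w _; have [/KU|] := pselect (K w); [left|right].
apply: Ck_setU.
  by apply: (Ck_ext oU _ hk) => w Uw; rewrite patchE Uw.
have oK : open (~` K) by apply: closed_openC; exact: plane_closed cK.
apply: (Ck_ext oK _ (Ck_cst k 0 oK)) => w; rewrite inE => nKw.
by rewrite patchE; case: ifPn => //; rewrite inE => Uw; rewrite h0.
Qed.

Lemma vanish_derive P M v : (forall w, M < `|w| -> P w = 0) ->
  forall w, M < `|w| -> 'D_v P w = 0.
Proof.
move=> P0 w Mw; rewrite (near_eq_derive (g := cst 0)) ?derive_cst //.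
have Mn : \forall z \near w, M < `|z|.
  by have := @norm_continuous _ _ w => /(_ _ (lt_nbhsr Mw)).
by apply: filterS Mn => z /P0.
Qed.

Lemma integral_line_derive (p dp : R -> R) (M : R) : (forall s : R, is_derive s 1 p (dp s)) ->
  continuous dp -> (forall s, M < `|s| -> p s = 0) -> (forall s, M < `|s| -> dp s = 0) ->
  (\int[lebesgue_measure]_s (dp s)%:E = 0 :> \bar R)%E.
Proof.
(* [M] may be negative; [N] is positive and beyond [M], so [p] vanishes at both ends of
   [[-N, N]]. *)
move=> pd dpc p0 dp0; pose N := `|M| + 1.
have MN : M < N by rewrite (le_lt_trans (ler_norm M)) // ltrDl.
have N0 : 0 < N by rewrite ltr_wpDl.
have pc (s : R) : {for s, continuous p}.
  have [pds _] := pd s; exact/differentiable_continuous/derivable1_diffP.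
transitivity (\int[lebesgue_measure]_(s in `[(- N)%R, N]) (dp s)%:E)%E.
  rewrite [RHS]integral_mkcond; apply: eq_integral => s _; rewrite patchE.
  case: ifPn => //; rewrite notin_setE /= in_itv /= => /negP.
  by rewrite -ler_norml -ltNge => Ns; rewrite dp0 // (lt_trans MN).
have NN : - N < N by rewrite (lt_trans _ N0) // oppr_lt0.
rewrite (@continuous_FTC2 _ dp p) //.
- by rewrite !p0 ?subee // ?normrN gtr0_norm.
- exact: continuous_subspaceT.
- split; first by move=> s _; have [] := pd s.
    by apply: cvg_at_right_filter; exact: pc.
  by apply: cvg_at_left_filter; exact: pc.
- by move=> s _; rewrite derive1E; have [_ ->] := pd s.
Qed.

(** By Fubini, integrating first along the lines in the direction of the derivative leaves the
    fundamental theorem of calculus on each line. *)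
Lemma Stokes_eu P M : Ck 1 setT P -> (forall w, M < `|w| -> P w = 0) ->
  (\int[lambda2]_w ('D_eu P w)%:E = 0)%E.
Proof.
move=> Pk P0; have D0 := vanish_derive eu P0.
have Dk : Ck 0 setT ('D_eu P) := Ck_derive eu Pk.
have Di := Ck0_integrable Dk D0.
rewrite -(integral21_prod_meas1 Di) /=; apply: integral0_eq => y _.
apply: (@integral_line_derive (fun x => P (x, y)) _ M).
- move=> s; have e x : (0, y) + x *: eu = (x, y) :> R * R.
    by congr pair; rewrite /= /GRing.scale /= ?mulr1 ?mulr0 ?add0r ?addr0.
  rewrite (_ : (fun x => P (x, y)) = (fun x : R => P ((0, y) + x *: eu))); last first.
    by apply/funext => x; rewrite e.
  by rewrite -[in 'D__ _ _]e; apply: is_derive_line; exact: Ck_is_derive Pk _.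
- move=> s; apply: (@continuous_comp _ _ _ (fun x : R => (x, y)) ('D_eu P)).
    move=> A [[B C] /= [Bs Cy] BC]; suff : nbhs s (fun x => A (x, y)) by [].
    by apply: filterS Bs => x Bx; apply: BC; split=> //=; exact: nbhs_singleton Cy.
  exact: Dk.
- by move=> s Ms; apply: P0; rewrite (lt_le_trans Ms) // prod_normE le_max lexx.
- by move=> s Ms; apply: D0; rewrite (lt_le_trans Ms) // prod_normE le_max lexx.
Qed.

Lemma Stokes_ev P M : Ck 1 setT P -> (forall w, M < `|w| -> P w = 0) ->
  (\int[lambda2]_w ('D_ev P w)%:E = 0)%E.
Proof.
move=> Pk P0; have D0 := vanish_derive ev P0.
have Dk : Ck 0 setT ('D_ev P) := Ck_derive ev Pk.
have Di := Ck0_integrable Dk D0.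
rewrite -(integral12_prod_meas1 Di) /=; apply: integral0_eq => x _.
apply: (@integral_line_derive (fun y => P (x, y)) _ M).
- move=> s; have e y : (x, 0) + y *: ev = (x, y) :> R * R.
    by congr pair; rewrite /= /GRing.scale /= ?mulr1 ?mulr0 ?add0r ?addr0.
  rewrite (_ : (fun y => P (x, y)) = (fun y : R => P ((x, 0) + y *: ev))); last first.
    by apply/funext => y; rewrite e.
  by rewrite -[in 'D__ _ _]e; apply: is_derive_line; exact: Ck_is_derive Pk _.
- move=> s; apply: (@continuous_comp _ _ _ (fun y : R => (x, y)) ('D_ev P)).
    move=> A [[B C] /= [Bx Cs] BC]; suff : nbhs s (fun y => A (x, y)) by [].
    by apply: filterS Cs => y Cy; apply: BC; split=> //=; exact: nbhs_singleton Bx.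
  exact: Dk.
- by move=> s Ms; apply: P0; rewrite (lt_le_trans Ms) // prod_normE le_max lexx orbT.
- by move=> s Ms; apply: D0; rewrite (lt_le_trans Ms) // prod_normE le_max lexx orbT.
Qed.

End PlaneStokes.

(** * Surface integrals computed in a chart *)

Section ChartIntegral.
Context {R : realType}.
Local Notation plane := (measurableTypeR R * measurableTypeR R)%type.
Local Notation lambda2 := (lebesgue_measure \x lebesgue_measure : {measure set plane -> \bar R})%E.
Implicit Types (S : set 'rV[R]_3) (U K : set (R * R)) (f : R * R -> 'rV[R]_3)
  (G : 'rV[R]_3 -> R) (mu : {measure set (@borel3 R) -> \bar R}).

Definition pullback U f G : R * R -> R := (fun w => G (f w) * enorm (nrm f w)) \_ U.

Lemma pullback_Ck S U K f G : local_parametrization S U f -> Ck 0 U (G \o f) ->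
  compact K -> K `<=` U -> (forall w, U w -> ~ K w -> G (f w) = 0) ->
  Ck 0 setT (pullback U f G).
Proof.
move=> fP Gk cK KU G0; have oU := parametrization_open fP.
apply: (Ck_patch oU cK KU) => [w Uw nK|]; first by rewrite G0 // mul0r.
apply: CkM => //; apply: Ck_sqrt => //.
  by move=> w Uw; rewrite dot_gt0 (parametrization_nrm fP).
have nk : CkV 0 U (nrm f) by apply: CkV_nrm => //; exact: parametrization_smooth fP.
exact: Ck_dot.
Qed.

Lemma chart_integral S mu U K f G : closed S -> is_area_measure S mu ->
  local_parametrization S U f -> (forall y, ~ (f @` U) y -> G y = 0) ->
  Ck 0 U (G \o f) -> compact K -> K `<=` U -> (forall w, U w -> ~ K w -> G (f w) = 0) ->
  mu.-integrable S (EFin \o G) /\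
  (\int[mu]_(x in S) (G x)%:E = \int[lambda2]_w (pullback U f G w)%:E)%E.
Proof.
move=> cS [_ muE] fP Goff Gk cK KU G0; have oU := parametrization_open fP.
have [W [g [oW fWg gP gc]]] := parametrization_inverse fP.
have f1 := parametrization_smooth 1 fP.
set D : set (@borel3 R) := f @` U.
have DE : D = (S `&` W : set 'rV[R]_3).
  apply/seteqP; split=> [_ [w Uw <-]|y [Sy Wy]]; first by have [] := fWg _ Uw.
  by have [Ug fg] := gP _ Sy Wy; exists (g y).
have mS : measurable (S : set (@borel3 R)) by exact: closed_measurable_borel3.
have mD : measurable D.
  by rewrite DE; apply: measurableI => //; exact: open_measurable_borel3.
have GD : G \_ D = G.
  apply/funext => y; rewrite patchE; case: ifPn => // /negP nD.
  by rewrite Goff // => Dy; apply: nD; rewrite inE.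
have mG : measurable_fun setT (G : @borel3 R -> R).
  rewrite -GD; apply/(measurable_restrictT _ mD).
  apply: within_continuous_measurable_borel3 => // y Dy.
  have [Sy Wy] : S y /\ W y by move: Dy; rewrite DE.
  have [Ugy fgy] := gP _ Sy Wy.
  (* Continuity is known for [G \o f] only; composing with the inverse chart, continuous along [S],
     gives it for [G] on the image. *)
  have Gg : G (f (g z)) @[z --> within S (nbhs y)] --> G y.
    apply: (@cvg_comp _ _ _ g (G \o f) _ (nbhs (g y))); first exact: gc.
    by rewrite -{2}fgy; exact: (Gk _ Ugy).
  move=> A HA.
  have H1 : \forall z \near y, S z -> A (G (f (g z))) by exact: (Gg _ HA).
  suff : \forall z \near y, D z -> A (G z) by [].
  apply: filterS H1 => z Hz Dz.
  have [Sz Wz] : S z /\ W z by move: Dz; rewrite DE.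
  by have := Hz Sz; have [_ ->] := gP _ Sz Wz.
pose delta w : \bar R := (enorm (normal_field f w))%:E.
have deltaE w : U w -> delta w = (enorm (nrm f w))%:E.
  by move=> Uw; rewrite /delta (normal_fieldE f1 Uw).
have mdelta : measurable_fun (U : set plane) delta.
  apply: (eq_measurable_fun (fun w => (enorm (nrm f w))%:E)).
    by move=> w; rewrite inE => Uw; rewrite deltaE.
  apply/measurable_EFinP; apply: Ck0_measurable => //.
  apply: Ck_sqrt => //.
    by move=> w Uw; rewrite dot_gt0 (parametrization_nrm fP).
  have nk : CkV 0 U (nrm f) by exact: CkV_nrm.
  exact: Ck_dot.
(* Used with the absolute value for integrability, and with the positive and negative parts for the
   value: each is nonnegative and homogeneous under a nonnegative factor, here the length of the
   normal. *)
have key (q : \bar R -> \bar R) : measurable_fun setT q -> (forall x, 0 <= q x)%E ->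
    q 0%E = 0%E -> (forall (x : R) (c : R), (0 <= c)%R -> q (x * c)%R%:E = q x%:E * c%:E)%E ->
    (\int[mu]_(x in S) q (G x)%:E = \int[lambda2]_w q (pullback U f G w)%:E)%E.
  move=> mq q0 q00 qM.
  transitivity (\int[mu]_(x in D) q (G x)%:E)%E.
    rewrite [LHS]integral_mkcond [RHS]integral_mkcond; apply: eq_integral => y _.
    rewrite !patchE; case: ifPn => [|nS]; case: ifPn => [|nD] //.
      by rewrite Goff ?q00 // => Dy; move/negP: nD; rewrite inE.
    by rewrite inE DE => -[Sy _]; move/negP: nS; rewrite inE.
  rewrite (@ge0_integral_density _ _ plane (@borel3 R) R lambda2 mu U D f delta) //.
  - rewrite [LHS]integral_mkcond; apply: eq_integral => w _.
    rewrite /pullback !patchE; case: ifPn => // Uw.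
    by rewrite deltaE ?qM ?enorm_ge0 //; move: Uw; rewrite inE.
  - exact: open_measurable_plane.
  - by apply: measurable_to_borel3 => // w Uw; exact: CkV_cont f1 Uw.
  - by move=> w; rewrite lee_fin enorm_ge0.
  - by move=> w Uw; exists w.
  - by move=> B mB BD; exact: muE.
  - by apply: measurableT_comp => //; exact/measurable_EFinP.
have [M [Mr HM]] := compact_bounded cK.
have out w : M + 1 < `|w| -> pullback U f G w = 0.
  move=> Mw; rewrite /pullback patchE; case: ifPn => //; rewrite inE => Uw.
  rewrite G0 ?mul0r // => Kw.
  have Mlt : M < M + 1 by rewrite ltrDl.
  by have /= := HM _ Mlt w Kw; rewrite leNgt Mw.
have Hk := pullback_Ck fP Gk cK KU G0.
have Hi := Ck0_integrable Hk out.
split.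
  apply/integrableP; split.
    by apply/measurable_EFinP; exact: measurable_funTS.
  rewrite (key abse) //.
  - by have /integrableP[] := Hi.
  - exact: abse0.
  - by move=> x c c0; rewrite /= normrM (ger0_norm c0).
rewrite integralE [RHS]integralE; congr (_ - _)%E.
- rewrite funepos.unlock; apply: (key (fun x => maxe x 0%E)).
  + by apply: measurable_maxe => //; exact: measurable_cst.
  + by move=> x; rewrite le_max lexx orbT.
  + by rewrite maxxx.
  + by move=> x c c0; rewrite -EFin_max -EFin_max -EFinM maxr_pMl // mul0r.
- rewrite funeneg.unlock; apply: (key (fun x => maxe (oppe x) 0%E)).
  + exact: measurable_maxe.
  + by move=> x; rewrite le_max lexx orbT.
  + by rewrite oppe0 maxxx.
  + by move=> x c c0; rewrite -!EFinN -EFin_max -EFin_max -EFinM maxr_pMl // mul0r mulNr.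
Qed.

End ChartIntegral.

(** * The curvature integral of a function supported in one chart *)

Section ChartGaussBonnet.
Context {R : realType}.
Local Notation plane := (measurableTypeR R * measurableTypeR R)%type.
Local Notation lambda2 := (lebesgue_measure \x lebesgue_measure : {measure set plane -> \bar R})%E.
Implicit Types (S : set 'rV[R]_3) (U K : set (R * R)) (f : R * R -> 'rV[R]_3)
  (G rho : 'rV[R]_3 -> R) (mu : {measure set (@borel3 R) -> \bar R}).

Lemma vanish_derive_open U K h v : open U -> compact K ->
  (forall w, U w -> ~ K w -> h w = 0) -> forall w : R * R, U w -> ~ K w -> 'D_v h w = 0 :> R.
Proof.
move=> oU cK h0 w Uw nK; rewrite (near_eq_derive (g := cst 0)) ?derive_cst //.
have oUK : open (U `&` ~` K).
  by apply: openI => //; apply: closed_openC; exact: plane_closed cK.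
apply: (open_near_eq oUK) => [|z]; first by split.
by rewrite inE => -[Uz Kz]; exact: h0.
Qed.

Lemma compact_plane_bound K : compact K -> exists M : R, forall w, M < `|w| -> ~ K w.
Proof.
move=> cK; have [M [Mr HM]] := compact_bounded cK; exists (M + 1) => w Mw Kw.
have Mlt : M < M + 1 by rewrite ltrDl.
by have /= := HM _ Mlt w Kw; rewrite leNgt Mw.
Qed.

(* Stokes' theorem for the 1-form [rho * connection_form], with
   d(connection_form) = - K dA: [twist] is the density of [d rho /\ connection_form]. *)
Lemma chart_gauss_bonnet S mu U K f V rho G1 G2 : closed S -> is_area_measure S mu ->
  local_parametrization S U f -> transverse_free S V -> Ck 1 U (rho \o f) ->
  compact K -> K `<=` U -> (forall w, U w -> ~ K w -> rho (f w) = 0) ->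
  (forall w, U w -> G1 (f w) = rho (f w) * gauss_curvature S (f w)) ->
  (forall w, U w -> G2 (f w) = twist rho V f w) ->
  (forall y, ~ (f @` U) y -> G1 y = 0 /\ G2 y = 0) ->
  [/\ mu.-integrable S (EFin \o G1), mu.-integrable S (EFin \o G2) &
      (\int[mu]_(x in S) (G1 x)%:E = \int[mu]_(x in S) (G2 x)%:E)%E].
Proof.
move=> cS muS fP VS rk cK KU r0 G1E G2E Goff; have oU := parametrization_open fP.
set r := rho \o f in rk; set a := connection_form V f eu; set b := connection_form V f ev.
have ak : Ck 1 U a := connection_form_C1 eu VS fP.
have bk : Ck 1 U b := connection_form_C1 ev VS fP.
pose en w := enorm (nrm f w).
have en0 w : U w -> en w != 0.
  by move=> Uw; rewrite gt_eqF // enorm_gt0 (parametrization_nrm fP).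
have enk : Ck 0 U en.
  apply: Ck_sqrt => //; first by move=> w Uw; rewrite dot_gt0 (parametrization_nrm fP).
  have nk : CkV 0 U (nrm f) by exact: (CkV_nrm oU (parametrization_smooth 1 fP)).
  exact: Ck_dot.
have dk : Ck 0 U (curvature_density f).
  have Nk : CkV 1 U (gauss_map f) := gauss_map_Ck 1 fP.
  apply: Ck_dot => //; first exact: CkV_le (isT : (0 <= 1)%N) Nk.
  by apply: CkV_cross => //; exact: CkV_pd.
have G1d w : U w -> G1 (f w) = r w * (curvature_density f w / en w).
  by move=> Uw; rewrite G1E // (gauss_curvatureE fP Uw).
have G2d w : U w -> G2 (f w) = ('D_eu r w * b w - 'D_ev r w * a w) / en w.
  by move=> Uw; rewrite G2E.
have G1k : Ck 0 U (G1 \o f).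
  apply: (Ck_ext (g := fun w => r w * (curvature_density f w * (en w)^-1)) oU).
    by move=> w; rewrite inE => /G1d /= ->.
  by apply: CkM => //; [exact: CkW|apply: CkM => //; exact: Ck_inv].
have G2k : Ck 0 U (G2 \o f).
  apply: (Ck_ext (g := fun w => ('D_eu r w * b w - 'D_ev r w * a w) * (en w)^-1) oU).
    by move=> w; rewrite inE => /G2d /= ->.
  apply: CkM => //; last exact: Ck_inv.
  by apply: CkB => //; apply: CkM => //; (exact: Ck_derive || exact: CkW).
have r0' w : U w -> ~ K w -> r w = 0 by exact: r0.
have G10 w : U w -> ~ K w -> G1 (f w) = 0.
  by move=> Uw nK; rewrite G1d // r0' // mul0r.
have G20 w : U w -> ~ K w -> G2 (f w) = 0.
  move=> Uw nK; rewrite G2d // (vanish_derive_open eu oU cK r0' Uw nK).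
  by rewrite (vanish_derive_open ev oU cK r0' Uw nK) !mul0r subrr mul0r.
have [i1 e1] := chart_integral cS muS fP (fun y ny => (Goff y ny).1) G1k cK KU G10.
have [i2 e2] := chart_integral cS muS fP (fun y ny => (Goff y ny).2) G2k cK KU G20.
split=> //; rewrite e1 e2.
pose P := (fun w => r w * b w) \_ U; pose Q := (fun w => r w * a w) \_ U.
have Pk : Ck 1 setT P.
  by apply: (Ck_patch oU cK KU) => [w Uw nK|]; [rewrite r0' // mul0r|exact: CkM].
have Qk : Ck 1 setT Q.
  by apply: (Ck_patch oU cK KU) => [w Uw nK|]; [rewrite r0' // mul0r|exact: CkM].
have [M HM] := compact_plane_bound cK.
have patch0 (h : R * R -> R) : (forall w, U w -> ~ K w -> h w = 0) ->
    forall w, M < `|w| -> (h \_ U) w = 0.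
  move=> h0 w /HM nK; rewrite patchE; case: ifPn => //; rewrite inE => Uw; exact: h0.
have P0 : forall w, M < `|w| -> P w = 0.
  by apply: patch0 => w Uw nK; rewrite r0' // mul0r.
have Q0 : forall w, M < `|w| -> Q w = 0.
  by apply: patch0 => w Uw nK; rewrite r0' // mul0r.
have SP := Stokes_eu Pk P0; have SQ := Stokes_ev Qk Q0.
have iP := Ck0_integrable (Ck_derive eu Pk) (vanish_derive eu P0).
have iQ := Ck0_integrable (Ck_derive ev Qk) (vanish_derive ev Q0).
have k1 := pullback_Ck fP G1k cK KU G10; have k2 := pullback_Ck fP G2k cK KU G20.
have j1 : lambda2.-integrable setT (EFin \o pullback U f G1).
  by apply: (Ck0_integrable (M := M)) => //; apply: patch0 => w Uw nK; rewrite G10 // mul0r.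
have j2 : lambda2.-integrable setT (EFin \o pullback U f G2).
  by apply: (Ck0_integrable (M := M)) => //; apply: patch0 => w Uw nK; rewrite G20 // mul0r.
(* In coordinates, [d (rho omega) = d rho /\ omega - rho K dA]; off [U] every term is 0. *)
have pointwise w : 'D_eu P w - 'D_ev Q w = pullback U f G2 w - pullback U f G1 w.
  have [Uw|nU] := pselect (U w); last first.
    have nK : ~ K w by move=> /KU.
    have off (h : R * R -> R) v : (forall z, U z -> ~ K z -> h z = 0) -> 'D_v (h \_ U) w = 0.
      move=> h0; apply: (vanish_derive_open v openT cK) => // z _ nKz.
      by rewrite patchE; case: ifPn => //; rewrite inE => Uz; exact: h0.
    rewrite !off; do ?by move=> z Uz nKz; rewrite r0' // mul0r.
    by rewrite /pullback !patchE memNset.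
  have PE : \near w, P w = (r * b) w.
    by apply: (open_near_eq oU Uw) => z Uz; rewrite /P patchE Uz.
  have QE : \near w, Q w = (r * a) w.
    by apply: (open_near_eq oU Uw) => z Uz; rewrite /Q patchE Uz.
  have dr v := Ck_is_derive v rk Uw; have da v := Ck_is_derive v ak Uw.
  have db v := Ck_is_derive v bk Uw.
  rewrite (near_eq_derive _ PE) (near_eq_derive _ QE).
  have [_ ->] := is_deriveM (dr eu) (db eu); have [_ ->] := is_deriveM (dr ev) (da ev).
  have cE := curvature_exact VS fP Uw; rewrite -/a -/b in cE.
  rewrite /pullback !patchE mem_set // G1d // G2d // -/(en w).
  rewrite -mulrA divfK ?en0 // -[_ / en w * en w]mulrA mulVf ?en0 // mulr1.
  rewrite -[curvature_density f w]opprK -cE /GRing.scale /=.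
  by move: ('D_eu r w) ('D_ev r w) ('D_eu b w) ('D_ev a w) => *; ring.
have D1 : (\int[lambda2]_w ('D_eu P w - 'D_ev Q w)%:E = 0)%E.
  under eq_integral do rewrite EFinB.
  by rewrite integralB //= SP SQ sube0.
have D2 : (\int[lambda2]_w (pullback U f G2 w)%:E - \int[lambda2]_w (pullback U f G1 w)%:E = 0)%E.
  by rewrite -integralB // -[RHS]D1; apply: eq_integral => w _; rewrite pointwise EFinB.
(* In the extended reals a zero difference gives equality only between finite terms. *)
have f1 : (\int[lambda2]_w (pullback U f G1 w)%:E)%E \is a fin_num.
  exact: integrable_fin_num j1.
have f2 : (\int[lambda2]_w (pullback U f G2 w)%:E)%E \is a fin_num.
  exact: integrable_fin_num j2.
by move/eqP: D2; rewrite sube_eq ?fin_num_adde_defl // add0e => /eqP ->.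
Qed.

End ChartGaussBonnet.

(** * Partition of unity *)

Section GlobalGaussBonnet.
Context {R : realType}.
Implicit Types (S : set 'rV[R]_3) (U K : set (R * R)) (f : R * R -> 'rV[R]_3)
  (c x y : 'rV[R]_3) (r : R).

(** The squared Euclidean distance is a polynomial, hence smooth in every chart, which the sup norm
    is not. *)
Definition sqdist c y : R := dot (y - c) (y - c).

Definition bump c r y : R := ramp 3 (r ^+ 2 - sqdist c y).

Lemma sqdist_continuous c : continuous (sqdist c).
Proof.
move=> y; apply: (@cvg_dot R _ (nbhs y) (fun z => z - c) (fun z => z - c));
  by apply: cvgB; [exact: cvg_id|exact: cvg_cst].
Qed.

Lemma bump_ge0 c r y : 0 <= bump c r y.
Proof. by rewrite exprn_ge0 // le_max lexx. Qed.

Lemma bump_gt0 c r y : (0 < bump c r y) = (sqdist c y < r ^+ 2).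
Proof.
rewrite -[RHS]subr_gt0 /bump /ramp; have [le0|gt0] := leP (r ^+ 2 - sqdist c y) 0.
  by rewrite exprS mul0r ltxx.
by rewrite exprn_gt0.
Qed.

Lemma bump_eq0 c r y : r ^+ 2 <= sqdist c y -> bump c r y = 0.
Proof. by move=> ry; rewrite /bump /ramp max_l ?expr0n // subr_le0. Qed.

Lemma bump_C2 U f c r : open U -> CkV 2 U f -> Ck 2 U (bump c r \o f).
Proof.
move=> oU fk; apply: (@Ck_ramp R 2 U (fun w => r ^+ 2 - sqdist c (f w))) => //.
have fc : CkV 2 U (fun w => f w - c) by exact: (CkVB oU fk (CkV_cst 2 c oU)).
exact: (CkB oU (Ck_cst 2 (r ^+ 2) oU) (Ck_dot oU fc fc)).
Qed.

Lemma sqdist_ball (c : 'rV[R]_3) r : 0 < r -> exists2 e, 0 < e &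
  forall y, sqdist c y <= e ^+ 2 -> `|y - c| < r.
Proof.
move=> r0; exists (r / 2); first by rewrite divr_gt0.
move=> y H; apply: (@le_lt_trans _ _ (r / 2)); last by lra.
apply: norm_row_le => [|i]; first by rewrite divr_ge0 // ltW.
have r20 : 0 <= r / 2 by rewrite divr_ge0 // ltW.
rewrite -(ler_pXn2r (n := 2)) // ?nnegrE // (le_trans _ H) //.
rewrite real_normK ?num_real // /sqdist /dot (bigD1 i) //= -expr2 lerDl.
by apply: sumr_ge0 => j _; rewrite -expr2 sqr_ge0.
Qed.

(** [K] contains the parameters of all points of the chart within [r] of [x], so a bump of radius
    [r] at [x] has compact support in the parameter plane, as Stokes' theorem there requires. *)
Definition localized_chart S x (C : set (R * R) * (R * R -> 'rV[R]_3) * set (R * R) * R) :=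
  let: (U, f, K, r) := C in
  [/\ local_parametrization S U f, compact K /\ K `<=` U, 0 < r,
      forall y, S y -> sqdist x y <= r ^+ 2 -> (f @` U) y &
      forall w, U w -> sqdist x (f w) <= r ^+ 2 -> K w].

Lemma smooth_surface_local S x : compact S -> smooth_surface S -> S x ->
  exists C, localized_chart S x C.
Proof.
move=> cS smS Sx; have [U [f [fP [w Uw fw]]]] := smS x Sx.
have [W [g [oW fWg gP gc]]] := parametrization_inverse fP.
have Wx : W x by rewrite -fw; have [] := fWg _ Uw.
have [d /= d0 dW] := (nbhs_ballP _ _).1 (open_nbhs_nbhs (conj oW Wx)).
have [r r0 rd] := sqdist_ball x d0.
have inW y : sqdist x y <= r ^+ 2 -> W y.
  by move=> /rd yd; apply: dW; rewrite -ball_normE /= distrC.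
(* [B] is closed in the compact [S] and lies in the domain where [g] inverts the chart, so its image
   under [g] can serve as [K]. *)
pose B := S `&` [set y | sqdist x y <= r ^+ 2].
have cB : compact B.
  apply: (@subclosed_compact _ B S) => //; last by move=> y [].
  apply: closedI; first by apply: compact_closed => //; exact: norm_hausdorff.
  apply: (@preimage_closed _ _ (sqdist x) [set s | s <= r ^+ 2]); last exact: closed_le.
  by move=> y _; exact: sqdist_continuous.
exists (U, f, g @` B, r); split=> //.
- split.
    apply: continuous_compact => //; apply/subspace_continuousP => y [Sy yr].
    have := gc y Sy (inW y yr); apply: cvg_trans; apply: cvg_app.
    by apply: within_subset => //; move=> z [].
  by move=> _ [y [Sy yr] <-]; have [] := gP _ Sy (inW _ yr).
- by move=> y Sy yr; have [Ug fg] := gP _ Sy (inW _ yr); exists (g y).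
- move=> z Uz zr; have [Sz _ gz] := fWg _ Uz; exists (f z) => //.
Qed.

Lemma sum_cross_eq0 (I : Type) (s : seq I) (p q : I -> R) (a b e : R) :
  \sum_(i <- s) p i = 0 -> \sum_(i <- s) q i = 0 -> \sum_(i <- s) (p i * a - q i * b) / e = 0.
Proof.
by move=> p0 q0; rewrite -mulr_suml big_split /= sumrN -!mulr_suml p0 q0 !mul0r subrr mul0r.
Qed.

Lemma integral_sum_eq d (T : measurableType d) (mu : {measure set T -> \bar R}) (D : set T)
    (I : eqType) (s : seq I) (g h : I -> T -> R) : measurable D ->
  (forall i, i \in s -> [/\ mu.-integrable D (EFin \o g i), mu.-integrable D (EFin \o h i) &
     (\int[mu]_(t in D) (g i t)%:E = \int[mu]_(t in D) (h i t)%:E)%E]) ->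
  [/\ mu.-integrable D (fun t => (\sum_(i <- s) g i t)%:E),
      mu.-integrable D (fun t => (\sum_(i <- s) h i t)%:E) &
     (\int[mu]_(t in D) (\sum_(i <- s) g i t)%:E =
      \int[mu]_(t in D) (\sum_(i <- s) h i t)%:E)%E].
Proof.
move=> mD; elim: s => [_|i s IH H].
  split; try by (under eq_fun do rewrite big_nil); exact: integrable0.
  by apply: eq_integral => t _; rewrite !big_nil.
have [|gs hs E] := IH; first by move=> j js; apply: H; rewrite inE js orbT.
have [gi hi e] := H i (mem_head _ _).
have sE (q : I -> T -> R) : (fun t => (\sum_(j <- i :: s) q j t)%:E) =
    (fun t => (q i t)%:E + (\sum_(j <- s) q j t)%:E)%E.
  by apply/funext => t; rewrite big_cons EFinD.
rewrite !sE; split; [exact: integrableD|exact: integrableD|].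
by rewrite !integralD // e E.
Qed.

Lemma integral_gauss_curvature_eq0 S V (mu : {measure set (@borel3 R) -> \bar R}) :
  compact S -> smooth_surface S -> transverse_free S V -> is_area_measure S mu ->
  (\int[mu]_(x in S) (gauss_curvature S x)%:E = 0)%E.
Proof.
move=> cS smS VS muS.
have clS : closed S by apply: compact_closed => //; exact: norm_hausdorff.
have mS : measurable (S : set (@borel3 R)) by exact: closed_measurable_borel3.
have /choice[F HF] : forall x, exists C, S x -> localized_chart S x C.
  move=> x.
  have [Sx|nS] := pselect (S x); last by exists (set0, fun=> 0, set0, 0).
  by have [C HC] := smooth_surface_local cS smS Sx; exists C.
pose rad x := (F x).2; pose Uof x := (F x).1.1.1; pose fof x := (F x).1.1.2.
pose Kof x := (F x).1.2.
have {}HF x : S x -> [/\ local_parametrization S (Uof x) (fof x),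
      compact (Kof x) /\ Kof x `<=` Uof x, 0 < rad x,
      forall y, S y -> sqdist x y <= rad x ^+ 2 -> (fof x @` Uof x) y &
      forall w, Uof x w -> sqdist x (fof x w) <= rad x ^+ 2 -> Kof x w].
  by move=> /HF; rewrite /localized_chart /Uof /fof /Kof /rad; case: (F x) => [[[? ?] ?] ?].
have [s sS covS] : exists2 s : seq 'rV[R]_3, (forall x, x \in s -> S x) &
    forall y, S y -> exists2 x, x \in s & sqdist x y < rad x ^+ 2.
  have := cS; rewrite compact_cover => /(_ 'rV[R]_3 S
    (fun x => [set y | sqdist x y < rad x ^+ 2])) [x Sx|y Sy|D' D'S cov].
  - apply: (@open_comp _ _ (sqdist x) [set t | t < rad x ^+ 2]); last exact: open_lt.
    by move=> y _; exact: sqdist_continuous.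
  - exists y => //=; rewrite /sqdist subrr dot0l exprn_gt0 //.
    by have [] := HF _ Sy.
  - exists (finmap.enum_fset D') => [x /D'S|y /cov[x xD' xy]]; first by rewrite inE.
    by exists x.
pose b x := bump x (rad x).
pose Phi y := \sum_(x <- s) b x y.
have Phi0 y : S y -> 0 < Phi y.
  move=> /covS[x xs xy]; rewrite /Phi (big_rem x) //= ltr_wpDr //.
    by apply: sumr_ge0 => z _; exact: bump_ge0.
  by rewrite bump_gt0.
pose rho x y := b x y / Phi y.
have param_in U f w : local_parametrization S U f -> U w -> S (f w).
  by move=> fP Uw; have [W [g [_ /(_ _ Uw)[]]]] := parametrization_inverse fP.
have rho1 y : S y -> \sum_(x <- s) rho x y = 1.
  by move=> Sy; rewrite /rho -mulr_suml divff // gt_eqF // Phi0.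
have rhok x U f : local_parametrization S U f -> Ck 1 U (rho x \o f).
  move=> fP; have oU := parametrization_open fP; have f2 := parametrization_smooth 2 fP.
  have bk z : Ck 1 U (b z \o f) by apply: CkW; exact: bump_C2.
  apply: CkM; [by []|exact: bk|apply: Ck_inv => //].
    by move=> w Uw; rewrite gt_eqF // Phi0 //; exact: param_in fP Uw.
  exact: (@Ck_sum R _ s 1 U (fun z => b z \o f) oU bk).
have rho_eq0 x y : rad x ^+ 2 <= sqdist x y -> rho x y = 0.
  by move=> H; rewrite /rho /b bump_eq0 // mul0r.
(* The integrands are functions on space whereas [twist] is evaluated at a parameter; [inv] chooses
   one, and [twist_chart] makes the value independent of the choice. *)
pose inv x y := xget (0 : R * R) [set w | Uof x w /\ fof x w = y].
have invP x w : S x -> Uof x w -> Uof x (inv x (fof x w)) /\ fof x (inv x (fof x w)) = fof x w.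
  move=> Sx Uw; rewrite /inv; case: xgetP => [z _ //|/(_ w) []]; by split.
pose G1 x y := if pselect ((fof x @` Uof x) y) then rho x y * gauss_curvature S y else 0.
pose G2 x y := if pselect ((fof x @` Uof x) y) then twist (rho x) V (fof x) (inv x y) else 0.
have GB x : x \in s -> [/\ mu.-integrable S (EFin \o G1 x), mu.-integrable S (EFin \o G2 x) &
      (\int[mu]_(y in S) (G1 x y)%:E = \int[mu]_(y in S) (G2 x y)%:E)%E].
  move=> /sS Sx; have [fP [cK KU] r0 _ HK] := HF _ Sx.
  apply: (chart_gauss_bonnet (U := Uof x) (K := Kof x) (f := fof x) (V := V) (rho := rho x)) => //.
  - exact: rhok.
  - move=> w Uw nK; apply: rho_eq0; rewrite leNgt; apply/negP => /ltW H.
    exact: nK (HK _ Uw H).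
  - by move=> w Uw; rewrite /G1; case: pselect => // -[]; exists w.
  - move=> w Uw; rewrite /G2; case: pselect => [fw|[]]; last by exists w.
    have [Uz fz] := invP _ _ Sx Uw.
    by apply: (twist_chart VS fP fP _ Uw Uz (esym fz)); exact: rhok.
  - by move=> y ny; rewrite /G1 /G2; case: pselect.
have S1 y : S y -> gauss_curvature S y = \sum_(x <- s) G1 x y.
  move=> Sy; rewrite -[LHS]mul1r -(rho1 _ Sy) mulr_suml big_seq [RHS]big_seq.
  apply: eq_bigr => x xs; rewrite /G1; case: pselect => // ny.
  rewrite rho_eq0 ?mul0r // leNgt; apply/negP => /ltW H; apply: ny.
  by have [_ _ _ /(_ _ Sy H)] := HF _ (sS _ xs).
(* All terms are transported to one chart at [y]. There they share the same connection form, and the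
   sum bears on the derivatives of a partition of 1 alone. *)
have S2 y : S y -> \sum_(x <- s) G2 x y = 0.
  move=> Sy; have [U [f [fP [w Uw fw]]]] := smS y Sy; have oU := parametrization_open fP.
  transitivity (\sum_(x <- s) twist (rho x) V f w).
    rewrite big_seq [RHS]big_seq; apply: eq_bigr => x xs; rewrite /G2.
    have [fxP _ _ HU _] := HF _ (sS _ xs).
    case: pselect => [[z Uz fz]|ny].
      have [Uz' fz'] := invP _ _ (sS _ xs) Uz; rewrite fz in Uz' fz'.
      apply: (twist_chart VS fP fxP _ Uw Uz'); last by rewrite fw fz'.
      exact: rhok.
    (* The chart at [x] covers the points of [S] in the closed ball of radius [rad x]. So [y] lies
       strictly outside that ball, and [rho x] vanishes near [y]. *)
    apply/esym; apply: (twist_eq0 V fP Uw); rewrite fw.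
    have xy : rad x ^+ 2 < sqdist x y.
      by rewrite ltNge; apply/negP => H; exact: ny (HU _ Sy H).
    have : \forall z \near y, rad x ^+ 2 < sqdist x z.
      exact: (sqdist_continuous (lt_nbhsr xy)).
    by apply: filterS => z /ltW; exact: rho_eq0.
  have D v : \sum_(x <- s) 'D_v (rho x \o f) w = 0.
    have E : 'D_v (fun z => \sum_(x <- s) (rho x \o f) z) w = 0.
      rewrite (near_eq_derive (g := cst (1 : R))) ?derive_cst //.
      apply: (open_near_eq oU Uw) => z; rewrite inE => Uz /=.
      by rewrite rho1 //; exact: param_in fP Uz.
    suff lin t : \sum_(x <- t) 'D_v (rho x \o f) w =
        'D_v (fun z => \sum_(x <- t) (rho x \o f) z) w by rewrite lin E.
    elim: t => [|x t IH].
      rewrite (_ : (fun z => _) = cst (0 : R)) ?derive_cst ?big_nil //.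
      by apply/funext => z; rewrite big_nil.
    rewrite big_cons IH.
    have d1 := Ck_is_derive v (rhok x _ _ fP) Uw.
    have kt : Ck 1 U (fun z => \sum_(x <- t) (rho x \o f) z).
      by apply: Ck_sum => // i; exact: rhok.
    have d2 := Ck_is_derive v kt Uw.
    have [_ <-] := is_deriveD d1 d2.
    by apply: near_eq_derive; near=> z; rewrite big_cons.
  exact: (@sum_cross_eq0 _ s (fun x => 'D_eu (rho x \o f) w) (fun x => 'D_ev (rho x \o f) w)
    _ _ _ (D eu) (D ev)).
transitivity (\int[mu]_(y in S) (\sum_(x <- s) G1 x y)%:E)%E.
  by apply: eq_integral => y; rewrite inE => /S1 ->.
have [_ _ ->] := integral_sum_eq mS GB.
by apply: integral0_eq => y /S2 ->.
Unshelve. all: by end_near. Qed.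

End GlobalGaussBonnet.

(** * The tangent field of a torus *)

Section Chords.
Context {R : realType}.
Implicit Types (S : set 'rV[R]_3) (U : set (R * R)) (f : R * R -> 'rV[R]_3) (w : R * R).

Lemma double_cross (N y : 'rV[R]_3) : dot N N = 1 ->
  y = dot N y *: N - cross N (cross N y).
Proof.
move=> NN; suff : dot N N *: y = dot N y *: N - cross N (cross N y).
  by rewrite NN scale1r.
by apply: row3P; rewrite !(crossE, dotE, mxE); ring.
Qed.

Lemma cross_eq0_parallel (N y : 'rV[R]_3) : dot N N = 1 -> cross N y = 0 ->
  y = dot N y *: N.
Proof.
move=> NN c0; rewrite {1}(double_cross y NN) c0.
have -> : cross N 0 = 0 by apply: row3P; rewrite !(crossE, mxE); ring.
by rewrite subr0.
Qed.

(** Meant for the products of [Df(c) d] and [Df(w) d]: at two different points the mixed products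
    differ, and [M] is their sum. *)
Lemma posdef2 (P Q M x y : R) : 0 < P -> M ^+ 2 < 4 * P * Q -> (x != 0) || (y != 0) ->
  0 < x ^+ 2 * P + x * y * M + y ^+ 2 * Q.
Proof.
move=> P0 D xy; have P40 : 0 < 4 * P by lra.
rewrite -(pmulr_rgt0 _ P40).
have -> : 4 * P * (x ^+ 2 * P + x * y * M + y ^+ 2 * Q) =
   (2 * P * x + M * y) ^+ 2 + (4 * P * Q - M ^+ 2) * y ^+ 2 by ring.
have D0 : 0 < 4 * P * Q - M ^+ 2 by rewrite subr_gt0.
have [y0|y0] := eqVneq y 0.
  move: xy; rewrite y0 eqxx orbF => x0.
  rewrite !mulr0 addr0 expr0n /= mulr0 addr0 exprn_even_gt0 //= mulf_neq0 //.
  by rewrite gt_eqF // mulr_gt0.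
rewrite ltr_wpDl ?sqr_ge0 // mulr_gt0 // exprn_even_gt0 //=.
Qed.

(* By the mean value theorem <f w' - f w, Df(w) d> = <Df(c) d, Df(w) d> with d = w' - w,
   which is positive when the points are close. *)
Lemma local_chord S U f w0 : local_parametrization S U f -> U w0 ->
  exists2 e, 0 < e & forall w w', ball w0 e w -> ball w0 e w' -> w != w' ->
    [/\ U w, U w' & cross (gauss_map f w) (f w' - f w) != 0].
Proof.
move=> fP Uw0; have oU := parametrization_open fP; have f1 := parametrization_smooth 1 fP.
pose P (a b : R * R) := dot (pd eu f a) (pd eu f b).
pose Q (a b : R * R) := dot (pd ev f a) (pd ev f b).
pose M (a b : R * R) := dot (pd eu f a) (pd ev f b) + dot (pd ev f a) (pd eu f b).
have uc : pd eu f z @[z --> w0] --> pd eu f w0.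
  exact: (CkV_cont (CkV_pd eu f1) Uw0).
have vc : pd ev f z @[z --> w0] --> pd ev f w0.
  exact: (CkV_cont (CkV_pd ev f1) Uw0).
have n0 := parametrization_nrm fP Uw0.
have D0 : 0 < dot (nrm f w0) (nrm f w0) by rewrite dot_gt0.
have DE : dot (nrm f w0) (nrm f w0) = P w0 w0 * Q w0 w0 - (dot (pd eu f w0) (pd ev f w0)) ^+ 2.
  by rewrite -enorm_sqr enorm_nrm_sqr.
have P0 : 0 < P w0 w0.
  rewrite dot_gt0; apply: contraNneq n0 => u0; rewrite /nrm u0.
  by apply/eqP/row3P; rewrite !(crossE, mxE); ring.
have fst_cvg : fst z @[z --> (w0, w0)] --> w0 by exact: cvg_fst.
have snd_cvg : snd z @[z --> (w0, w0)] --> w0 by exact: cvg_snd.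
have u1 : pd eu f z.1 @[z --> (w0, w0)] --> pd eu f w0 by exact: cvg_comp fst_cvg uc.
have u2 : pd eu f z.2 @[z --> (w0, w0)] --> pd eu f w0 by exact: cvg_comp snd_cvg uc.
have v1 : pd ev f z.1 @[z --> (w0, w0)] --> pd ev f w0 by exact: cvg_comp fst_cvg vc.
have v2 : pd ev f z.2 @[z --> (w0, w0)] --> pd ev f w0 by exact: cvg_comp snd_cvg vc.
have Pc : P z.1 z.2 @[z --> (w0, w0)] --> P w0 w0 by exact: (cvg_dot _ u1 u2).
have Qc : Q z.1 z.2 @[z --> (w0, w0)] --> Q w0 w0 by exact: (cvg_dot _ v1 v2).
have Mc : M z.1 z.2 @[z --> (w0, w0)] --> M w0 w0.
  by apply: cvgD; [exact: (cvg_dot _ u1 v2)|exact: (cvg_dot _ v1 u2)].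
(* The discriminant of the form in [posdef2]; on the diagonal it is four times the squared length of
   the normal, so it stays positive for nearby pairs. *)
pose H (z : (R * R) * (R * R)) := 4 * P z.1 z.2 * Q z.1 z.2 - M z.1 z.2 * M z.1 z.2.
have Hc : H z @[z --> (w0, w0)] --> 4 * P w0 w0 * Q w0 w0 - M w0 w0 * M w0 w0.
  by apply: cvgB; apply: cvgM => //; apply: cvgM => //; exact: cvg_cst.
have H0 : 0 < 4 * P w0 w0 * Q w0 w0 - M w0 w0 * M w0 w0.
  have -> : M w0 w0 = 2 * dot (pd eu f w0) (pd ev f w0).
    by rewrite /M [X in _ + X]dotC; ring.
  move: D0; rewrite DE expr2; move: (P _ _) (Q _ _) (dot _ _) => p q m; lra.
have [e e0 He] : exists2 e, 0 < e & forall a b, ball w0 e a -> ball w0 e b ->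
    [/\ U a, 0 < P a b & 0 < H (a, b)].
  have N1 : \forall z \near (w0, w0), 0 < P z.1 z.2.
    exact: (Pc _ (lt_nbhsr P0)).
  have N2 : \forall z \near (w0, w0), 0 < H z by exact: (Hc _ (lt_nbhsr H0)).
  have N3 : \forall z \near (w0, w0), U z.1.
    exact: (fst_cvg _ (open_nbhs_nbhs (conj oU Uw0))).
  have /nbhs_ballP[e /= e0 He] : \forall z \near (w0, w0),
      [/\ U z.1, 0 < P z.1 z.2 & 0 < H z].
    by apply: filterS3 N3 N1 N2 => z; split.
  exists e => // a b ba bb; have := He (a, b); apply.
  by split.
exists e => // w w' bw bw' ww'.
have [Uw _ _] := He _ _ bw bw; have [Uw' _ _] := He _ _ bw' bw'; split=> //.
pose d := w' - w; pose T := d.1 *: pd eu f w + d.2 *: pd ev f w.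
have seg s : 0 <= s <= 1 -> ball w0 e (w + (s * 1) *: d).
  move=> /andP[s0 s1]; rewrite mulr1 -ball_normE /=.
  have -> : w0 - (w + s *: d) = (1 - s) *: (w0 - w) + s *: (w0 - w').
    by rewrite /d; move: (w0) (w) (w') => [? ?] [? ?] [? ?]; congr pair;
      rewrite /= /GRing.scale /=; ring.
  move: bw bw'; rewrite -ball_normE /= => bw bw'.
  rewrite (le_lt_trans (ler_normD _ _)) // !normrZ (ger0_norm s0) ger0_norm ?subr_ge0 //.
  move: bw bw'; move: (`|w0 - w|) (`|w0 - w'|) => n n' nn nn'.
  have [->|sn0] := eqVneq s 0; first by rewrite subr0 mul1r mul0r addr0.
  have sp : 0 < s by rewrite lt0r sn0.
  have h1 : (1 - s) * n <= (1 - s) * e by rewrite ler_wpM2l ?subr_ge0 // ltW.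
  have h2 : s * n' < s * e by rewrite ltr_pM2l.
  apply: (@le_lt_trans _ _ ((1 - s) * e + s * n')); first exact: lerD.
  apply: (@lt_le_trans _ _ ((1 - s) * e + s * e)); first by rewrite ltrD2l.
  by rewrite -mulrDl subrK mul1r.
have Td : CkV 1 U (fun=> T) by exact: CkV_cst.
have pdT z : U z -> is_derive z d (fun z => dot (f z) T) (dot (pd d f z) T).
  move=> Uz; have := is_derive_dot d f1 Td Uz.
  have -> : pd d (fun=> T) z = 0.
    by apply/rowP => i; rewrite pdE [RHS]mxE; exact: derive_cst.
  by rewrite dot0r addr0.
have [s s01|s s01 E] := @MVT_line R _ (fun z => dot (f z) T) w d 1.
  by have [Us _ _] := He _ _ (seg s s01) bw; have [] := pdT _ Us.
have [Us P1 H1] := He _ _ (seg s s01) bw.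
have [_ ES] := pdT _ Us.
rewrite ES scale1r mul1r in E.
have wE : w + d = w' by rewrite /d addrC subrK.
rewrite wE -dotBl (pd_basisE d oU f1 Us) in E.
have pos : 0 < dot (f w' - f w) T.
  rewrite E /T dotDl !dotDr !dotZl !dotZr.
  move: P1 H1; rewrite /H /M /P /Q /=.
  set z := w + _; move=> P1 H1.
  have := @posdef2 (P z w) (Q z w) (M z w) d.1 d.2 P1.
  rewrite expr2 -subr_gt0 => /(_ H1).
  have -> : (d.1 != 0) || (d.2 != 0).
    rewrite -negb_and; apply: contra ww' => /andP[/eqP d1 /eqP d2].
    by rewrite eq_sym -subr_eq0 -/d; apply/eqP; case: (d) d1 d2 => ? ? /= -> ->.
  move=> /(_ isT); rewrite /M /P /Q.
  by rewrite /d /=; congr (0 < _); ring.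
(* A chord parallel to the normal would be orthogonal to the tangent vector [T]. *)
apply: contraTneq pos => c0; rewrite -leNgt.
have NN := gauss_map_unit (parametrization_nrm fP Uw).
rewrite (cross_eq0_parallel NN c0) dotZl; move: (dot (gauss_map f w) (f w' - f w)) => q.
rewrite /T dotDr !dotZr.
rewrite (dotC (gauss_map f w) (pd eu f w)) (dotC (gauss_map f w) (pd ev f w)).
by rewrite !gauss_map_tangent !mulr0 addr0 mulr0.
Qed.

End Chords.

(** * From a fixed-point free motion to a nowhere normal field *)

Section VectorField.
Context {R : realType}.
Implicit Types (S : set 'rV[R]_3) (U : set (R * R)) (f : R * R -> 'rV[R]_3) (w z : R * R)
  (F : R * R -> 'rV[R]_3) (x y N D : 'rV[R]_3).

(* The squared length of the part of [D] orthogonal to the unit vector [N]. *)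
Definition normal_gap N D : R := dot D D - dot N D ^+ 2.

Lemma normal_gapE N D : dot N N = 1 -> normal_gap N D = dot (cross N D) (cross N D).
Proof. by move=> NN; rewrite Lagrange_identity NN mul1r (dotC D N) -expr2. Qed.

Lemma normal_gap_chart S U U' f f' w w' D :
  local_parametrization S U f -> local_parametrization S U' f' -> U w -> U' w' ->
  f w = f' w' -> normal_gap (gauss_map f' w') D = normal_gap (gauss_map f w) D.
Proof.
move=> fP fP' Uw Uw' ff'; have [s s1 ->] := gauss_map_sign fP fP' Uw Uw' ff'.
by rewrite /normal_gap dotZl exprMn; case: s1 => ->; rewrite ?sqrrN expr1n mul1r.
Qed.

(** By Cauchy-Schwarz every vector near [D] lies in the open half-space of the tangential part of
    [D]. Positive combinations of such vectors stay there, so none of them is normal. *)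
Lemma tangential_part N D (e : R) : dot N N = 1 -> 0 < e -> e < normal_gap N D ->
  dot (D - dot N D *: N) N = 0 /\
  forall D', sqdist D D' < e -> 0 < dot D' (D - dot N D *: N).
Proof.
move=> NN e0 gapD; set T := D - _.
have TN : dot T N = 0 by rewrite dotBl dotZl NN mulr1 dotC subrr.
have NT : dot N T = 0 by rewrite dotC.
have TT : dot T T = normal_gap N D.
  by rewrite {1}/T dotBl dotZl NT mulr0 subr0 dotBr dotZr (dotC D N) -expr2.
have DT : dot D T = dot T T by rewrite [RHS]dotBl dotZl NT mulr0 subr0.
split=> // D' De; have TT0 : 0 < dot T T by rewrite TT (lt_trans e0).
have -> : dot D' T = dot T T + dot (D' - D) T by rewrite -DT (dotBl D') addrC subrK.
move: De; rewrite /sqdist; move: (D' - D) => d De.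
have CS : dot d T ^+ 2 <= dot d d * dot T T.
  rewrite -subr_ge0 (_ : _ - _ = dot (cross d T) (cross d T)) ?dot_ge0 //.
  by rewrite Lagrange_identity (dotC T d) expr2.
have : dot d T ^+ 2 < dot T T ^+ 2.
  by apply: (le_lt_trans CS); rewrite expr2 ltr_pM2r // TT; exact: (lt_trans De).
rewrite -real_normK ?num_real // ltr_pXn2r // ?nnegrE // ?(ltW TT0) //.
by rewrite ltr_norml => /andP[+ _]; rewrite -subr_gt0 opprK addrC.
Qed.

(** [local_chord] compares points of one chart. A chart is a homeomorphism onto a relatively open
    part of [S], so points of [S] that are close in space have close parameters; compactness makes
    the distance uniform. *)
Lemma chord_lemma S : compact S -> smooth_surface S -> exists2 d : R, 0 < d &
  forall x y, S x -> S y -> y != x -> `|y - x| < d ->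
  forall U f w, local_parametrization S U f -> U w -> f w = x ->
    0 < normal_gap (gauss_map f w) (y - x).
Proof.
move=> cS smS.
pose P (d : R) x := S x -> forall y, S y -> y != x -> `|y - x| < d ->
  forall U f w, local_parametrization S U f -> U w -> f w = x ->
    0 < normal_gap (gauss_map f w) (y - x).
have : \forall d \near (0 : R)^'+, S `<=` P d.
  apply: (iffLR (compact_near_coveringP S) cS) => x0 Sx0.
  have [U [f [fP [w0 Uw0 fw0]]]] := smS x0 Sx0.
  have [W [g [oW fWg gP gc]]] := parametrization_inverse fP.
  have [e e0 He] := local_chord fP Uw0.
  have Wx0 : W x0 by rewrite -fw0; have [] := fWg _ Uw0.
  have gx0 : g x0 = w0 by rewrite -fw0; have [] := fWg _ Uw0.
  have N1 : \forall y \near x0, S y -> ball w0 e (g y).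
    by rewrite -gx0; exact: (gc _ Sx0 Wx0 _ (nbhsx_ballx (g x0) e e0)).
  have N2 : \forall y \near x0, W y by exact: open_nbhs_nbhs.
  have /nbhs_ballP[d /= d0 Hd] : \forall y \near x0, W y /\ (S y -> ball w0 e (g y)).
    by apply: filterS2 N2 N1.
  have d20 : 0 < d / 2 by rewrite divr_gt0.
  exists (ball x0 (d / 2), [set r | r < d / 2]).
    split=> /=; first exact: nbhsx_ballx.
    exact: nbhs_right_lt.
  move=> [x r] /= [xb rd] Sx y Sy yx yr U' f' w' fP' Uw' fw'.
  have xd : ball x0 d x by apply: le_ball xb; lra.
  have yd : ball x0 d y.
    move: xb; rewrite -!ball_normE /= => xb.
    rewrite -(subrKA x) (le_lt_trans (ler_normD _ _)) // [d]splitr ltrD //.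
    by rewrite distrC (lt_trans yr).
  have [Wx /(_ Sx) bx] := Hd _ xd; have [Wy /(_ Sy) by_] := Hd _ yd.
  have [Ux fx] := gP _ Sx Wx; have [Uy fy] := gP _ Sy Wy.
  have gxy : g x != g y by apply: contraNneq yx => gxy; rewrite -fx -fy gxy.
  have [_ _ c0] := He _ _ bx by_ gxy.
  rewrite (normal_gap_chart _ fP fP' Ux Uw'); last by rewrite fx fw'.
  rewrite normal_gapE; last by rewrite gauss_map_unit // (parametrization_nrm fP).
  by rewrite dot_gt0; rewrite fx fy in c0.
move=> H; have pos : \forall d \near (0 : R)^'+, 0 < d by exact: nbhs_right_gt.
have FF : ProperFilter ((0 : R)^'+) by exact: at_right_proper_filter.
have [d [d0 Hd]] := @filter_ex _ _ FF _ (@filterI _ _ (@filter_filter _ _ FF) _ _ pos H).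
by exists d => // x y Sx; exact: (Hd x Sx Sx).
Qed.

(** A translation of the torus, lifted to the covering plane. *)
Definition shift_u (t : R) z : R * R := z + (t, 0).

Lemma at_right_ex (P : set R) : (\forall d \near (0 : R)^'+, P d) ->
  exists2 d, 0 < d < 1 & P d.
Proof.
move=> H; have pos : \forall d \near (0 : R)^'+, 0 < d by exact: nbhs_right_gt.
have lt1 : \forall d \near (0 : R)^'+, d < 1 by exact: nbhs_right_lt.
have FF : ProperFilter ((0 : R)^'+) by exact: at_right_proper_filter.
have FI A B := @filterI _ _ (@filter_filter _ _ FF) A B.
have [d [d0 [d1 Hd]]] := @filter_ex _ _ FF _ (FI _ _ pos (FI _ _ lt1 H)).
by exists d => //; rewrite d0.
Qed.

Lemma small_shift F (d : R) : continuous F -> 0 < d ->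
  exists2 t, 0 < t < 1 & forall z, unit_square z -> `|F (shift_u t z) - F z| < d.
Proof.
move=> Fc d0; apply: at_right_ex.
have csq : compact (unit_square : set (R * R)).
  by apply: compact_setX; exact: segment_compact.
apply: (iffLR (compact_near_coveringP _) csq (R : Type) _
  (fun t z => `|F (shift_u t z) - F z| < d)) => z0 _.
have d20 : 0 < d / 2 by rewrite divr_gt0.
have /nbhs_ballP[e /= e0 He] : \forall z \near z0, `|F z0 - F z| < d / 2.
  by have := Fc z0; move=> /cvgrPdist_lt /(_ _ d20).
have e20 : 0 < e / 2 by rewrite divr_gt0.
exists (ball z0 (e / 2), [set r | 0 < r < e / 2]).
  split=> /=; first exact: nbhsx_ballx.
  near=> r; apply/andP; split; near: r; [exact: nbhs_right_gt|exact: nbhs_right_lt].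
move=> [z r] /= [zb /andP[r0 re]].
have ze : ball z0 e z by apply: le_ball zb; lra.
have ze' : ball z0 e (shift_u r z).
  move: zb; rewrite -!ball_normE /= /shift_u => zb.
  rewrite opprD addrA (le_lt_trans (ler_normB _ _)) // [e]splitr ltrD //.
  by rewrite prod_normE /= normr0 gt_max (gtr0_norm r0) re e20.
rewrite -(subrKA (F z0)) (le_lt_trans (ler_normD _ _)) // [d]splitr ltrD //.
  by rewrite distrC; exact: He.
exact: He.
Unshelve. all: by end_near. Qed.

Lemma cvg_sqdist (T : Type) (G : set_system T) (X Y : T -> 'rV[R]_3) x y : Filter G ->
  X s @[s --> G] --> x -> Y s @[s --> G] --> y ->
  sqdist (X s) (Y s) @[s --> G] --> sqdist x y.
Proof. by move=> FG Xx Yy; apply: cvg_dot; apply: cvgB. Qed.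

(** [F] unrolls [S] over the plane. The last two hypotheses say that a translation in [u] induces a
    self-map of [S], and that this map has no fixed point when [0 < t < 1]. *)
Lemma transverse_free_exists S F : compact S -> smooth_surface S -> continuous F ->
  (forall z, S (F z)) -> (forall x, S x -> exists2 z, unit_square z & F z = x) ->
  (forall t z z', unit_square z -> unit_square z' -> F z = F z' ->
     F (shift_u t z) = F (shift_u t z')) ->
  (forall t z, 0 < t < 1 -> unit_square z -> F (shift_u t z) != F z) ->
  exists V, transverse_free S V.
Proof.
move=> cS smS Fc FS Fsurj Fshift Ffree.
have [d d0 chord] := chord_lemma cS smS.
have [t t01 tsmall] := small_shift Fc d0.
pose D z := F (shift_u t z) - F z.
have csq : compact (unit_square : set (R * R)).
  by apply: compact_setX; exact: segment_compact.
have shc z0 : shift_u t z @[z --> z0] --> shift_u t z0.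
  by apply: cvgD; [exact: cvg_id|exact: cvg_cst].
have Dc z0 : D z @[z --> z0] --> D z0.
  by apply: cvgB; [exact: (cvg_comp _ _ (shc z0) (Fc _))|exact: Fc].
have gap0 z U f w : unit_square z -> local_parametrization S U f -> U w -> f w = F z ->
    0 < normal_gap (gauss_map f w) (D z).
  move=> sz fP Uw fw; apply: (chord (F z)) fP Uw fw; [exact: FS|exact: FS| |].
    exact: Ffree.
  exact: tsmall.
(* by compactness, the chord is uniformly transverse to the normal *)
have [e /andP[e0 _] gape] : exists2 e : R, 0 < e < 1 & unit_square `<=`
    [set z | unit_square z -> forall U f w, local_parametrization S U f -> U w -> f w = F z ->
    e < normal_gap (gauss_map f w) (D z)].
  apply: at_right_ex; apply: (iffLR (compact_near_coveringP _) csq (R : Type) _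
    (fun e z => unit_square z -> forall U f w, local_parametrization S U f -> U w -> f w = F z ->
    e < normal_gap (gauss_map f w) (D z))) => z0 sz0.
  have [U [f [fP [w0 Uw0 fw0]]]] := smS _ (FS z0).
  have [W [g [oW fWg gP gc]]] := parametrization_inverse fP.
  have WF : W (F z0) by rewrite -fw0; have [] := fWg _ Uw0.
  have gF : g (F z0) = w0 by rewrite -fw0; have [] := fWg _ Uw0.
  have gFc : g (F z) @[z --> z0] --> w0.
    rewrite -gF; move=> A HA.
    have H1 : \forall y \near F z0, S y -> A (g y) by exact: (gc _ (FS z0) WF _ HA).
    have H2 : \forall z \near z0, S (F z) -> A (g (F z)) by exact: (Fc z0 _ H1).
    by apply: filterS H2 => z; apply; exact: FS.
  have Nc : gauss_map f (g (F z)) @[z --> z0] --> gauss_map f w0.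
    exact: (cvg_comp _ _ gFc (CkV_cont (gauss_map_Ck 1 fP) Uw0)).
  have qc : normal_gap (gauss_map f (g (F z))) (D z) @[z --> z0] -->
      normal_gap (gauss_map f w0) (D z0).
    have Nd : dot (gauss_map f (g (F z))) (D z) @[z --> z0] --> dot (gauss_map f w0) (D z0).
      by exact: (cvg_dot _ Nc (Dc z0)).
    have Dd : dot (D z) (D z) @[z --> z0] --> dot (D z0) (D z0).
      by exact: (cvg_dot _ (Dc z0) (Dc z0)).
    by rewrite /normal_gap; apply: cvgB Dd _; exact: (cvgM Nd Nd).
  have q0 := gap0 _ _ _ _ sz0 fP Uw0 fw0.
  set q := normal_gap _ _ in q0 qc.
  have q20 : 0 < q / 2 by rewrite divr_gt0.
  have N1 : \forall z \near z0, q / 2 < normal_gap (gauss_map f (g (F z))) (D z).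
    by apply: (qc _ (lt_nbhsr _)); rewrite ltr_pdivrMr // ltr_pMr // ltr1n.
  have N2 : \forall z \near z0, W (F z) by exact: (Fc z0 _ (open_nbhs_nbhs (conj oW WF))).
  exists ([set z | W (F z) /\ q / 2 < normal_gap (gauss_map f (g (F z))) (D z)],
    [set r | r < q / 2]).
    by split=> /=; [exact: filterI N2 N1|exact: nbhs_right_lt].
  move=> [z r] /= [[Wz qz] rq] sz U' f' w' fP' Uw' fw'.
  have [Ug fg] := gP _ (FS z) Wz.
  rewrite (normal_gap_chart _ fP fP' Ug Uw'); last by rewrite fg fw'.
  exact: lt_trans qz.
(* D is constant on the fibres of F, hence a uniformly continuous function on S *)
have [r /andP[r0 _] close] : exists2 r : R, 0 < r < 1 & unit_square `*` unit_square `<=`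
    [set zz : (R * R) * (R * R) | (unit_square `*` unit_square) zz ->
       sqdist (F zz.1) (F zz.2) < r -> sqdist (D zz.1) (D zz.2) < e].
  apply: at_right_ex; apply: (iffLR (compact_near_coveringP _) (compact_setX csq csq) (R : Type) _
    (fun r zz => (unit_square `*` unit_square) zz ->
       sqdist (F zz.1) (F zz.2) < r -> sqdist (D zz.1) (D zz.2) < e)) => -[z1 z2] [/= s1 s2].
  have f1 : fst z @[z --> (z1, z2)] --> z1 by exact: cvg_fst.
  have f2 : snd z @[z --> (z1, z2)] --> z2 by exact: cvg_snd.
  have Fd : sqdist (F z.1) (F z.2) @[z --> (z1, z2)] --> sqdist (F z1) (F z2).
    by apply: cvg_sqdist; [exact: (cvg_comp _ _ f1 (Fc z1))|exact: (cvg_comp _ _ f2 (Fc z2))].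
  have Dd : sqdist (D z.1) (D z.2) @[z --> (z1, z2)] --> sqdist (D z1) (D z2).
    by apply: cvg_sqdist; [exact: (cvg_comp _ _ f1 (Dc z1))|exact: (cvg_comp _ _ f2 (Dc z2))].
  have [Fz|Fz] := eqVneq (F z1) (F z2).
    have Dz : sqdist (D z1) (D z2) = 0.
      by rewrite /D Fz (Fshift t z1 z2) // /sqdist subrr dot0l.
    have N1 : \forall z \near (z1, z2), sqdist (D z.1) (D z.2) < e.
      by apply: (Dd _ (lt_nbhsl _)); rewrite Dz.
    exists ([set z | sqdist (D z.1) (D z.2) < e], setT).
      by split=> //=; exact: filterT.
    by move=> [z s] /= [].
  have c0 : 0 < sqdist (F z1) (F z2).
    by rewrite /sqdist dot_gt0 subr_eq0 eq_sym.
  set c := sqdist _ _ in Fd c0.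
  have c20 : 0 < c / 2 by rewrite divr_gt0.
  have N1 : \forall z \near (z1, z2), c / 2 < sqdist (F z.1) (F z.2).
    by apply: (Fd _ (lt_nbhsr _)); rewrite ltr_pdivrMr // ltr_pMr // ltr1n.
  exists ([set z | c / 2 < sqdist (F z.1) (F z.2)], [set s | s < c / 2]).
    by split=> //=; exact: nbhs_right_lt.
  move=> [z s] /= [cz sc] _ /(lt_trans cz) /lt_trans /(_ sc).
  by rewrite ltxx.
pose rr := Num.sqrt r.
have rr2 : rr ^+ 2 = r by rewrite sqr_sqrtr // ltW.
have /choice[zof zofP] : forall x, exists z, S x -> unit_square z /\ F z = x.
  move=> x; have [Sx|nS] := pselect (S x); last by exists 0.
  by have [z sz Fz] := Fsurj _ Sx; exists z.
have [s sS covS] : exists2 s : seq 'rV[R]_3, (forall x, x \in s -> S x) &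
    forall y, S y -> exists2 x, x \in s & sqdist x y < r.
  have := cS; rewrite compact_cover => /(_ 'rV[R]_3 S
    (fun x => [set y | sqdist x y < r])) [x Sx|y Sy|D' D'S cov].
  - apply: (@open_comp _ _ (sqdist x) [set t | t < r]); last exact: open_lt.
    by move=> y _; exact: sqdist_continuous.
  - by exists y => //=; rewrite /sqdist subrr dot0l.
  - exists (finmap.enum_fset D') => [x /D'S|y /cov[x xD' xy]]; first by rewrite inE.
    by exists x.
(* The chord attached to each centre is a constant vector, so the regularity is that of the bumps.
   The weights are not normalized, since a positive factor does not affect being normal. *)
exists (fun y => \sum_(x <- s) bump x rr y *: D (zof x)) => U f fP.
have oU := parametrization_open fP; split.
  apply: (@CkV_sum R _ s 2 U (fun x w => bump x rr (f w) *: D (zof x)) oU) => x.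
  apply: (CkV_scale oU (bump_C2 x rr oU (parametrization_smooth 2 fP))).
  exact: CkV_cst.
move=> w Uw; set N := gauss_map f w; set y := f w.
have Sy : S y by have [W [g [_ /(_ _ Uw)[]]]] := parametrization_inverse fP.
have [z sz Fz] := Fsurj _ Sy.
have NN : dot N N = 1 by rewrite gauss_map_unit // (parametrization_nrm fP).
have gapz : e < normal_gap N (D z) by apply: (gape z sz sz U f w fP Uw); rewrite Fz.
have [TN posT] := tangential_part NN e0 gapz.
move: (D z - dot N (D z) *: N) TN posT => T TN posT.
apply/eqP => c0.
have par := cross_eq0_parallel NN c0.
(* Centres with nonzero weight at [y] have chords so close to [D z] that their products with [T] are
   positive, whereas a multiple of [N] has product 0. *)
have : 0 < dot (\sum_(x <- s) bump x rr y *: D (zof x)) T.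
  rewrite dotC dot_sumr.
  have tge x : x \in s -> 0 <= dot T (bump x rr y *: D (zof x)) /\
      (sqdist x y < r -> 0 < dot T (bump x rr y *: D (zof x))).
    move=> xs; rewrite dotZr (dotC T).
    have [xy|xy] := ltP (sqdist x y) r; last first.
      by rewrite bump_eq0 ?mul0r ?rr2.
    have [sx Fx] := zofP _ (sS _ xs).
    have pT : 0 < dot (D (zof x)) T.
      apply: posT; apply: (close (z, zof x)); [by split|by split|].
      rewrite /= Fz Fx; move: xy; rewrite /sqdist.
      by rewrite -opprB dotNl dotNr opprK.
    have bp : 0 < bump x rr y by rewrite bump_gt0 rr2.
    by split=> [|_]; [rewrite ltW // mulr_gt0|rewrite mulr_gt0].
  have [x xs xy] := covS _ Sy.
  rewrite (big_rem x) //= ltr_wpDr //; last by have [_ ->] := tge x xs.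
  rewrite big_seq; apply: sumr_ge0 => x' x's; have [] := tge x' => //.
  exact: mem_rem x's.
by rewrite par dotZl (dotC N T) TN mulr0 ltxx.
Qed.

End VectorField.

(** * Unrolling the closed Bézier surface *)

Section TorusParametrization.
Context {R : realType}.
Implicit Types (n m : nat) (p : nat -> nat -> 'rV[R]_3) (w z : R * R) (u v : R).

Definition frac u : R := u - (Num.floor u)%:~R.

Lemma frac_bounds u : 0 <= frac u < 1.
Proof.
have := floor_itv u; rewrite intrD => /andP[h1 h2].
by rewrite /frac subr_ge0 h1 /= ltrBlDl.
Qed.

Lemma frac_id u : 0 <= u < 1 -> frac u = u.
Proof. by move=> u01; rewrite /frac (@floor_def _ _ 0) ?subr0 // add0r. Qed.

Lemma frac_addz u (k : int) : frac (u + k%:~R) = frac u.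
Proof. by rewrite /frac floorDrz ?intr_int // intrKfloor intrD; ring. Qed.

(** [frac] is continuous except at the integers, where it drops from the limit 1 to 0, two values
    between which [q] does not distinguish. To the left of [k] the formula is [z.1 - (k - 1)], to
    its right [z.1 - k]. *)
Lemma continuous_frac (T : topologicalType) (q : R * R -> T) : continuous q ->
  (forall v, q (0, v) = q (1, v)) -> continuous (fun w => q (frac w.1, w.2)).
Proof.
move=> qc q01 -[u0 v0]; set k : R := (Num.floor u0)%:~R.
have sh (c : R) : (z.1 - c, z.2) @[z --> (u0, v0)] --> (u0 - c, v0).
  rewrite (_ : (fun z : R * R => _) = fun z => z - (c, 0)); last first.
    by apply/funext => -[x y]; congr pair; rewrite /= subr0.
  rewrite (_ : (u0 - c, v0) = (u0, v0) - (c, 0)); last by congr pair; rewrite /= subr0.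
  by apply: cvgB; [exact: cvg_id|exact: cvg_cst].
have := frac_bounds u0; rewrite /frac -/k => /andP[k0 k1] A /= HA.
have H1 : \forall z \near (u0, v0), A (q (z.1 - k, z.2)) by exact: (sh k _ (qc _ _ HA)).
have fstc : z.1 @[z --> (u0, v0)] --> u0 by exact: cvg_fst.
have lt1 : \forall z \near (u0, v0), z.1 < k + 1.
  by apply: (fstc _ (lt_nbhsl _)); lra.
suff gek : \forall z \near (u0, v0), k <= z.1 \/
    k - 1 <= z.1 < k /\ A (q (z.1 - (k - 1), z.2)).
  apply: filterS3 H1 lt1 gek => -[x y] /= Ax xk [kx|[/andP[kx xk'] Ax']].
    by rewrite /frac (@floor_def _ _ (Num.floor u0)) // intrD kx xk.
  rewrite /frac (@floor_def _ _ (Num.floor u0 - 1)) ?intrD ?mulrNz //= ?intrB //.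
  by rewrite kx /= subrK.
have [k0'|uk] := ltP k u0.
  have : \forall z \near (u0, v0), k < z.1 by exact: (fstc _ (lt_nbhsr k0')).
  by apply: filterS => z /ltW; left.
have u0k : u0 = k by apply/eqP; rewrite eq_le uk -subr_ge0.
have HA' : nbhs (q (u0 - (k - 1), v0)) A.
  have -> : u0 - (k - 1) = 1 by rewrite u0k; ring.
  have fE : frac u0 = 0 by rewrite /frac -/k u0k subrr.
  by rewrite -q01; move: HA; rewrite /= ?fE /frac -?/k ?u0k ?subrr.
have H2 : \forall z \near (u0, v0), A (q (z.1 - (k - 1), z.2)).
  exact: (sh (k - 1) _ (qc _ _ HA')).
have gt1 : \forall z \near (u0, v0), k - 1 < z.1.
  by apply: (fstc _ (lt_nbhsr _)); lra.
apply: filterS2 H2 gt1 => z Az zk; have [zk'|] := leP k z.1; first by left.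
by move=> zk'; right; split => //; apply/andP; split => //; exact: ltW.
Qed.

Lemma bernstein0 n i : bernstein n i (0 : R) = (i == 0%N)%:R.
Proof.
rewrite /bernstein subr0 expr1n mulr1; case: i => [|i]; first by rewrite bin0 expr0 mulr1.
by rewrite exprS mul0r mulr0.
Qed.

Lemma bernstein1 n i : (i <= n)%N -> bernstein n i (1 : R) = (i == n)%:R.
Proof.
move=> lin; rewrite /bernstein subrr expr1n mulr1 expr0n subn_eq0.
have [->|ne] := eqVneq i n; first by rewrite leqnn binn mulr1.
by rewrite leqNgt ltn_neqAle ne lin mulr0.
Qed.

Lemma bezier_u0 n m p v : bezier n m p (0, v) = \sum_(j < m.+1) bernstein m j v *: p 0%N j.
Proof.
rewrite /bezier (bigD1 ord0) //= [X in _ + X]big1 ?addr0 => [|i i0].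
  by apply: eq_bigr => j _; rewrite bernstein0 mul1r.
apply: big1 => j _; rewrite bernstein0 (_ : (i == 0%N :> nat) = false) ?mul0r ?scale0r //.
exact: negbTE.
Qed.

Lemma bezier_u1 n m p v : bezier n m p (1, v) = \sum_(j < m.+1) bernstein m j v *: p n j.
Proof.
rewrite /bezier (bigD1 ord_max) //= [X in _ + X]big1 ?addr0 => [|i i0].
  by apply: eq_bigr => j _; rewrite bernstein1 // eqxx mul1r.
apply: big1 => j _; rewrite bernstein1 -1?ltnS //.
by rewrite (_ : (i == n :> nat) = false) ?mul0r ?scale0r //; apply: negbTE.
Qed.

Lemma bezier_v0 n m p u : bezier n m p (u, 0) = \sum_(i < n.+1) bernstein n i u *: p i 0%N.
Proof.
rewrite /bezier; apply: eq_bigr => i _; rewrite (bigD1 ord0) //= big1 ?addr0 => [|j j0].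
  by rewrite bernstein0 mulr1.
rewrite bernstein0 (_ : (j == 0%N :> nat) = false) ?mulr0 ?scale0r //; exact: negbTE.
Qed.

Lemma bezier_v1 n m p u : bezier n m p (u, 1) = \sum_(i < n.+1) bernstein n i u *: p i m.
Proof.
rewrite /bezier; apply: eq_bigr => i _; rewrite (bigD1 ord_max) //= big1 ?addr0 => [|j j0].
  by rewrite bernstein1 // eqxx mulr1.
rewrite bernstein1 -1?ltnS //.
by rewrite (_ : (j == m :> nat) = false) ?mulr0 ?scale0r //; apply: negbTE.
Qed.

Lemma bezier_continuous n m p : continuous (bezier n m p).
Proof.
have oT : open [set: R * R] by exact: openT.
have bk (q : R * R -> R) k i : Ck 0 setT q -> Ck 0 setT (fun w => bernstein k i (q w)).
  move=> qk; apply: (CkM oT); first by apply: (CkM oT (Ck_cst 0 _ oT)); exact: CkX.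
  by apply: (CkX _ oT); apply: (CkB oT (Ck_cst 0 1 oT)).
have f1 : Ck 0 setT (fst : R * R -> R) by move=> w _; exact: cvg_fst.
have f2 : Ck 0 setT (snd : R * R -> R) by move=> w _; exact: cvg_snd.
move=> w; apply: (@CkV_cont R 0 setT) => //.
apply: (CkV_sum _ oT) => i; apply: (CkV_sum _ oT) => j.
apply: (CkV_scale oT); last exact: CkV_cst.
by apply: (CkM oT); exact: bk.
Qed.

(** The motion is in [u] only, so in the other variable a constant extension beyond [0, 1] is enough
    to have a continuous map on the whole plane. *)
Definition clamp v : R := Num.max 0 (Num.min v 1).

Lemma clamp_id v : 0 <= v <= 1 -> clamp v = v.
Proof. by move=> /andP[v0 v1]; rewrite /clamp min_l // max_r. Qed.

Lemma clamp_bounds v : 0 <= clamp v <= 1.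
Proof. by rewrite /clamp le_max lexx ge_max ler01 ge_min lexx orbT. Qed.

Lemma clamp_continuous : continuous clamp.
Proof.
move=> v; apply: (@continuous_max R R (fun=> 0) (fun v => Num.min v 1)); first exact: cvg_cst.
by apply: (@continuous_min R R id (fun=> 1)); [exact: cvg_id|exact: cvg_cst].
Qed.

Lemma torus_parametrization n m p (S : set 'rV[R]_3) : closed_net n m p ->
  non_self_intersecting n m p -> homeomorphic S (bezier_surface n m p) ->
  exists F : R * R -> 'rV[R]_3,
  [/\ continuous F /\ (forall z, S (F z)),
      forall x, S x -> exists2 z, unit_square z & F z = x,
      forall t z z', unit_square z -> unit_square z' -> F z = F z' ->
        F (shift_u t z) = F (shift_u t z') &
      forall t z, 0 < t < 1 -> unit_square z -> F (shift_u t z) != F z].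
Proof.
move=> [pcv pcu] inj [h [[hS hI hJ] _ [g [gc gK]]]].
set b := bezier n m p in inj *; set B := bezier_surface n m p in hS hJ gc.
have b01 v : b (0, v) = b (1, v).
  by rewrite /b bezier_u0 bezier_u1; apply: eq_bigr => j _; rewrite pcu // -ltnS.
have c01 u : b (u, 0) = b (u, 1).
  by rewrite /b bezier_v0 bezier_v1; apply: eq_bigr => i _; rewrite pcv // -ltnS.
have gB y : B y -> S (g y) /\ h (g y) = y.
  by move=> /hJ[x Sx <-]; rewrite gK.
pose q w := b (w.1, clamp w.2); pose bf w := q (frac w.1, w.2).
have bfB w : B (bf w).
  exists (frac w.1, clamp w.2) => //; split=> /=; rewrite in_itv /=.
    by have /andP[-> /ltW ->] := frac_bounds w.1.
  exact: clamp_bounds.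
have bfc : continuous bf.
  apply: continuous_frac => [w|v]; last by rewrite /q /= b01.
  apply: (@continuous_comp _ _ _ (fun w : R * R => (w.1, clamp w.2)) b); last exact: bezier_continuous.
  apply: (cvg_pair (F := nbhs w) (G := nbhs w.1) (H := nbhs (clamp w.2))); first exact: cvg_fst.
  by apply: (@cvg_comp _ _ _ snd clamp _ (nbhs w.2)); [exact: cvg_snd|exact: clamp_continuous].
have bf_sq z : unit_square z -> bf z = b z.
  case: z => u v [/=]; rewrite !in_itv /= => /andP[u0 u1] v01.
  rewrite /bf /q /= clamp_id //; move: u1; rewrite le_eqVlt => /orP[/eqP->|u1].
    by rewrite -[1]add0r -[1 in X in frac X]/(1%:~R) frac_addz frac_id ?lexx ?ltr01 // add0r b01.
  by rewrite frac_id // u0.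
have gI z z' : g (bf z) = g (bf z') -> bf z = bf z'.
  by move=> e; have [_ <-] := gB _ (bfB z); have [_ <-] := gB _ (bfB z'); rewrite e.
exists (g \o bf); split.
- split; last by move=> z; have [] := gB _ (bfB z).
  move=> z; have /subspace_continuousP /(_ _ (bfB z)) gz := gc.
  move=> A HA; have H1 : \forall y \near bf z, B y -> A (g y) by exact: (gz _ HA).
  have H2 : \forall x \near z, B (bf x) -> A (g (bf x)) by exact: (bfc z _ H1).
  by apply: filterS H2 => x; apply; exact: bfB.
- move=> x Sx; have [w sw Ew] := hS x Sx; exists w => //=.
  by rewrite bf_sq // /b Ew gK.
- move=> t z z' sz sz' /= /gI; rewrite (bf_sq _ sz) (bf_sq _ sz') => /(inj _ _ sz sz') [ui vi].
  congr g; rewrite /bf /q /shift_u /=; rewrite !addr0.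
  have -> : frac (z.1 + t) = frac (z'.1 + t).
    (* Translation modulo 1 respects the identification of the end points. *)
    have f1 : frac (1 + t) = frac (0 + t).
      by rewrite add0r addrC -[1]/(1%:~R) frac_addz.
    by case: ui => [->//|[-> ->]|[-> ->]]; rewrite f1.
  case: vi => [->//|[-> ->]|[-> ->]]; rewrite !clamp_id ?lexx ?ler01 //.
- move=> t z /andP[t0 t1] sz; apply/eqP => /= /gI.
  rewrite /bf /q /shift_u /= addr0 => /inj [||/= ui _].
  + split=> /=; rewrite in_itv /=; last exact: clamp_bounds.
    by have /andP[-> /ltW ->] := frac_bounds (z.1 + t).
  + split=> /=; rewrite in_itv /=; last exact: clamp_bounds.
    by have /andP[-> /ltW ->] := frac_bounds z.1.
  have /andP[_ a1] := frac_bounds (z.1 + t); have /andP[_ a2] := frac_bounds z.1.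
  case: ui => [e|[_ e]|[e _]]; [|by rewrite e ltxx in a2|by rewrite e ltxx in a1].
  (* Equal fractional parts make [t] an integer, which is impossible strictly between 0 and 1. *)
  have tE : t = (Num.floor (z.1 + t) - Num.floor z.1)%:~R.
    by move: e; rewrite /frac intrB => e; lra.
  move: t0 t1; rewrite tE ltr0z ltrz1; lia.
Qed.

End TorusParametrization.

(** * Total curvature of the control surface *)

Section Polyhedral.
Context {R : realType}.
Implicit Types (a b c x y : 'rV[R]_3) (P : nat -> nat -> 'rV[R]_3) (n m K N M : nat).

Lemma noncollinear_cross a b c : ~ collinear a b c -> cross (b - a) (c - a) != 0.
Proof.
move=> nc; apply/eqP => c0; apply: nc.
have [ba|ba] := eqVneq (b - a) 0.
  have {}ba : b = a by apply/eqP; rewrite -subr_eq0 ba.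
  exists a, (c - a) => x [->|->|->].
  - by exists 0; rewrite scale0r addr0.
  - by exists 0; rewrite scale0r addr0.
  - by exists 1; rewrite scale1r addrC subrK.
exists a, (b - a); have uu : dot (b - a) (b - a) != 0 by rewrite dot_eq0.
have cE : c - a = (dot (b - a) (c - a) / dot (b - a) (b - a)) *: (b - a).
  move: (b - a) (c - a) uu c0 => u v uu c0.
  have : dot u u *: v = dot u v *: u - cross u (cross u v).
    by apply: row3P; rewrite !(crossE, dotE, mxE); ring.
  rewrite c0 (_ : cross u 0 = 0) ?subr0 => [E|].
    by rewrite mulrC -scalerA -E scalerA mulVf // scale1r.
  by apply: row3P; rewrite !(crossE, mxE); ring.
move=> x [->|->|->].
- by exists 0; rewrite scale0r addr0.
- by exists 1; rewrite scale1r addrC subrK.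
- by exists (dot (b - a) (c - a) / dot (b - a) (b - a)); rewrite -cE addrC subrK.
Qed.

(** By Lagrange's identity, 1 minus the square of the argument of [acos] is the square of the
    claimed sine; so the argument lies in [-1, 1] and both values follow. *)
Lemma angle_cos_sin (u v : 'rV[R]_3) : cross u v != 0 ->
  let A := acos (dot u v / (enorm u * enorm v)) in
  [/\ cos A = dot u v / (enorm u * enorm v), sin A = enorm (cross u v) / (enorm u * enorm v),
      0 <= A & A <= pi].
Proof.
move=> c0 A.
have u0 : 0 < enorm u.
  by rewrite enorm_gt0; apply: contraNneq c0 => ->; apply/eqP/row3P; rewrite !(crossE, mxE); ring.
have v0 : 0 < enorm v.
  by rewrite enorm_gt0; apply: contraNneq c0 => ->; apply/eqP/row3P; rewrite !(crossE, mxE); ring.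
set r := dot u v / _ in A *.
have L : 1 - r ^+ 2 = (enorm (cross u v) / (enorm u * enorm v)) ^+ 2.
  rewrite /r !expr_div_n enorm_sqr Lagrange_identity (dotC v u) -expr2.
  rewrite !exprMn -(enorm_sqr u) -(enorm_sqr v).
  by field; rewrite !gt_eqF.
have s0 : 0 <= enorm (cross u v) / (enorm u * enorm v).
  by rewrite divr_ge0 ?enorm_ge0 // mulr_ge0 // enorm_ge0.
have r1 : -1 <= r <= 1.
  rewrite -ler_norml -(ler_pXn2r (n := 2)) ?nnegrE // expr1n real_normK ?num_real //.
  by rewrite -subr_ge0 L sqr_ge0.
split.
- by rewrite acosK // in_itv.
- by rewrite sin_acos // L sqrtr_sqr ger0_norm.
- exact: acos_ge0.
- exact: acos_lepi.
Qed.

(** The three corners have the same cross product, so the addition formulas give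
    [cos (A + B) = cos (pi - C)] and [sin (A + B) > 0]. The latter yields [A + B <= pi], and the
    cosine is injective on [0, pi]. *)
Lemma angle_sum a b c : ~ collinear a b c ->
  angle a b c + angle b c a + angle c a b = pi.
Proof.
move=> /noncollinear_cross nc.
have e1 : cross (c - b) (a - b) = cross (b - a) (c - a).
  by apply: row3P; rewrite !(crossE, mxE); ring.
have e2 : cross (a - c) (b - c) = cross (b - a) (c - a).
  by apply: row3P; rewrite !(crossE, mxE); ring.
have [] := angle_cos_sin nc; rewrite -/(angle a b c) => cA sA A0 Api.
have nc1 : cross (c - b) (a - b) != 0 by rewrite e1.
have nc2 : cross (a - c) (b - c) != 0 by rewrite e2.
have [] := angle_cos_sin nc1; rewrite -/(angle b c a) e1 => cB sB B0 Bpi.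
have [] := angle_cos_sin nc2; rewrite -/(angle c a b) e2 => cC sC C0 Cpi.
move: (angle a b c) (angle b c a) (angle c a b) cA sA A0 Api cB sB B0 Bpi cC sC C0 Cpi.
move=> A B C cA sA A0 Api cB sB B0 Bpi cC sC C0 Cpi.
have eN x y : enorm (x - y) = enorm (y - x).
  by rewrite -opprB /enorm dotNl dotNr opprK.
have pos x y : x - y != 0 -> enorm (x - y) != 0 by move=> ?; rewrite gt_eqF // enorm_gt0.
have ba : enorm (b - a) != 0.
  apply: pos; apply: contraNneq nc => ->.
  by apply/eqP/row3P; rewrite !(crossE, mxE); ring.
have ca : enorm (c - a) != 0.
  apply: pos; apply: contraNneq nc => ->.
  by apply/eqP/row3P; rewrite !(crossE, mxE); ring.
have cb : enorm (c - b) != 0.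
  apply: pos; apply: contraNneq nc1 => ->.
  by apply/eqP/row3P; rewrite !(crossE, mxE); ring.
have s0 : 0 < enorm (cross (b - a) (c - a)) by rewrite enorm_gt0.
rewrite (eN a b) in cB sB; rewrite (eN a c) (eN b c) in cC sC.
have sAB : sin (A + B) = enorm (cross (b - a) (c - a)) / (enorm (c - a) * enorm (c - b)).
  rewrite sinD sA cA sB cB; move: (enorm (cross _ _)) => s.
  have -> : s / (enorm (b - a) * enorm (c - a)) *
      (dot (c - b) (a - b) / (enorm (c - b) * enorm (b - a))) +
    dot (b - a) (c - a) / (enorm (b - a) * enorm (c - a)) *
      (s / (enorm (c - b) * enorm (b - a))) =
    s * (dot (c - b) (a - b) + dot (b - a) (c - a)) /
      (enorm (b - a) ^+ 2 * enorm (c - a) * enorm (c - b)).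
    by field; rewrite ba ca cb.
  have -> : dot (c - b) (a - b) + dot (b - a) (c - a) = enorm (b - a) ^+ 2.
    by rewrite enorm_sqr !(dotE, mxE); ring.
  by field; rewrite ba ca cb.
have cAB : cos (A + B) = cos (pi - C).
  have -> : cos (pi - C) = - cos C.
    by rewrite cosB cospi sinpi mul0r addr0 mulN1r.
  rewrite cosD cA cB sA sB cC.
  have -> : dot (b - a) (c - a) / (enorm (b - a) * enorm (c - a)) *
      (dot (c - b) (a - b) / (enorm (c - b) * enorm (b - a))) -
    enorm (cross (b - a) (c - a)) / (enorm (b - a) * enorm (c - a)) *
      (enorm (cross (b - a) (c - a)) / (enorm (c - b) * enorm (b - a))) =
    (dot (b - a) (c - a) * dot (c - b) (a - b) - enorm (cross (b - a) (c - a)) ^+ 2) /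
      (enorm (b - a) ^+ 2 * enorm (c - a) * enorm (c - b)).
    by field; rewrite ba ca cb.
  have -> : dot (b - a) (c - a) * dot (c - b) (a - b) - enorm (cross (b - a) (c - a)) ^+ 2 =
      - (enorm (b - a) ^+ 2 * dot (a - c) (b - c)).
    by rewrite !enorm_sqr !(crossE, dotE, mxE); ring.
  by field; rewrite ba ca cb.
have ABpi : A + B <= pi.
  rewrite leNgt; apply/negP => pAB.
  have : 0 < sin (A + B).
    by rewrite sAB divr_gt0 // mulr_gt0 // lt0r ?ca ?cb enorm_ge0.
  rewrite -[A + B](subrK pi) sinDpi oppr_gt0 ltNge sin_ge0_pi //.
  by rewrite subr_ge0 (ltW pAB) /= lerBlDr lerD.
have : A + B = pi - C.
  by apply: cos_inj => //; rewrite in_itv /=; apply/andP; split; lra.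
by move=> ->; rewrite subrK.
Qed.

Definition lower_triangle P (ij : nat * nat) : triangle (R := R) :=
  (P ij.1 ij.2, P ij.1.+1 ij.2, P ij.1.+1 ij.2.+1).
Definition upper_triangle P (ij : nat * nat) : triangle (R := R) :=
  (P ij.1 ij.2, P ij.1 ij.2.+1, P ij.1.+1 ij.2.+1).

(** Non-collinearity makes the corners distinct, so the successive tests in [corner_angle] select
    three different angles. *)
Lemma sum_corner_angle (s : seq 'rV[R]_3) (t : triangle (R := R)) : uniq s ->
  (forall x, corner t x -> x \in s) -> ~ collinear t.1.1 t.1.2 t.2 ->
  \sum_(x <- s) (if pselect (corner t x) then corner_angle t x else 0) = pi.
Proof.
case: t => [[a b] c] us ts /= nc.
have [ab bc ca] : [/\ a != b, b != c & c != a].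
  have cr := noncollinear_cross nc; split.
  - apply: contraNneq cr => ->; rewrite subrr.
    by apply/eqP/row3P; rewrite !(crossE, mxE); ring.
  - by apply: contraNneq cr => ->; rewrite crossvv.
  - apply: contraNneq cr => ->; rewrite subrr.
    by apply/eqP/row3P; rewrite !(crossE, mxE); ring.
have ut : uniq [:: a; b; c] by rewrite /= !inE negb_or ab bc [a == c]eq_sym ca.
rewrite -(angle_sum nc) fsbig_seq //.
transitivity (\sum_(x \in [set` s] `&` [set x | corner (a, b, c) x]) corner_angle (a, b, c) x).
  rewrite fsbig_mkcondr; apply: eq_fsbigr => x _; case: pselect => [Cx|nC].
    by rewrite mem_set.
  by rewrite memNset.
have -> : [set` s] `&` [set x | corner (a, b, c) x] = [set` [:: a; b; c]].
  apply/seteqP; split=> [x [_ /= [->|->|->]]|x /=]; rewrite !inE ?eqxx ?orbT //.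
  by move=> /or3P[/eqP->|/eqP->|/eqP->]; split; try apply: ts; [constructor 1|constructor 1|
    constructor 2|constructor 2|constructor 3|constructor 3].
rewrite -fsbig_seq // !big_cons big_nil /= addr0 !eqxx.
by rewrite (eq_sym b a) (negbTE ab) (negbTE ca) (eq_sym c b) (negbTE bc) addrA.
Qed.

End Polyhedral.

(** * Angle counting on a closed net, and closedness under subdivision *)

Section NetCurvature.
Context {R : realType}.
Implicit Types (P q : nat -> nat -> 'rV[R]_3) (n m K N M : nat).

Lemma collinear_dup (a b : 'rV[R]_3) : collinear a b a.
Proof.
exists a, (b - a) => x [->|->|->]; [exists 0|exists 1|exists 0]; rewrite ?scale0r ?addr0 //.
by rewrite scale1r addrC subrK.
Qed.

Lemma collinear_dup_l (a b : 'rV[R]_3) : collinear a a b.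
Proof.
exists a, (b - a) => x [->|->|->]; [exists 0|exists 0|exists 1]; rewrite ?scale0r ?addr0 //.
by rewrite scale1r addrC subrK.
Qed.

(** With a single row or column of cells, closedness would identify two corners of a cell, and three
    of its corners would be collinear. *)
Lemma regular_net_gt1 N M P : (0 < N)%N -> (0 < M)%N -> closed_net N M P ->
  regular_net N M P -> (1 < N)%N /\ (1 < M)%N.
Proof.
move=> N0 M0 [cv cu] [_ nc]; have [h1 h2 _ _] := nc 0%N 0%N N0 M0; split.
- case: N N0 cu h1 {cv h2 nc} => [//|[|//]] _ cu [].
  by rewrite -cu //; exact: collinear_dup.
- case: M M0 cv h2 h1 {cu nc} => [//|[|//]] _ cv _ [].
  by rewrite -cv //; exact: collinear_dup_l.
Qed.

Lemma net_total_curvature N M P : (0 < N)%N -> (0 < M)%N -> closed_net N M P ->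
  regular_net N M P ->
  \sum_(x \in vertices (net_surface N M P)) total_curvature (net_surface N M P) x = 0.
Proof.
move=> N0 M0 cP rP; have [N1 M1] := regular_net_gt1 N0 M0 cP rP.
have [cv cu] := cP; have [inj nc] := rP.
(* The same pairs index the cells and, the last row and column being copies of the first, the
   vertices of the torus. *)
pose I := [seq (i, j) | i <- iota 0 N, j <- iota 0 M].
have memI i j : ((i, j) \in I) = (i < N)%N && (j < M)%N.
  apply/allpairsP/andP => [[[i' j'] /= [+ + [-> ->]]]|[iN jM]].
    by rewrite !mem_iota.
  by exists (i, j); rewrite /= !mem_iota.
have uI : uniq I by apply: allpairs_uniq; rewrite ?iota_uniq // => -[? ?] [? ?] _ _.
have sI : size I = (N * M)%N by rewrite size_allpairs !size_iota.
have injI i j i' j' : (i < N)%N -> (j < M)%N -> (i' < N)%N -> (j' < M)%N ->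
    P i j = P i' j' -> i = i' /\ j = j'.
  move=> iN jM iN' jM' /inj; rewrite !modn_small // => -[] //; exact: ltnW.
set s := [seq P ij.1 ij.2 | ij <- I].
have us : uniq s.
  rewrite map_inj_in_uniq // => -[i j] [i' j'] /=; rewrite !memI.
  by move=> /andP[iN jM] /andP[iN' jM'] /injI [] // -> ->.
have mems i j : (i <= N)%N -> (j <= M)%N -> P i j \in s.
  have in_s i' j' : (i' < N)%N -> (j' < M)%N -> P i' j' \in s.
    by move=> iN jM; apply/mapP; exists (i', j'); rewrite // memI iN.
  rewrite leq_eqVlt => /orP[/eqP->|iN]; rewrite leq_eqVlt => /orP[/eqP->|jM].
  - by rewrite -cv // -cu //; exact: in_s.
  - by rewrite -cu ?(ltnW jM) //; exact: in_s.
  - by rewrite -cv ?(ltnW iN) //; exact: in_s.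
  - exact: in_s.
set F := net_surface N M P.
set t := [seq lower_triangle P ij | ij <- I] ++ [seq upper_triangle P ij | ij <- I].
have FE : F = [set` t].
  apply/seteqP; split=> [_ [i [j [iN jM [->|->]]]]|x]; rewrite /= mem_cat.
  - by apply/orP; left; apply/mapP; exists (i, j); rewrite // memI iN.
  - by apply/orP; right; apply/mapP; exists (i, j); rewrite // memI iN.
  - by move=> /orP[] /mapP[[i j]]; rewrite memI => /andP[iN jM] ->; exists i, j; split=> //;
      [left|right].
have ut : uniq t.
  rewrite cat_uniq !map_inj_in_uniq ?uI ?andbT /=; last 2 first.
  - move=> -[i j] [i' j']; rewrite !memI => /andP[iN jM] /andP[iN' jM'] [+ _ _].
    by move=> /injI [] // -> ->.
  - move=> -[i j] [i' j']; rewrite !memI => /andP[iN jM] /andP[iN' jM'] [+ _ _].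
    by move=> /injI [] // -> ->.
  apply/hasPn => _ /mapP[[i j] + ->]; rewrite memI => /andP[iN jM].
  apply/negP => /mapP[[i' j'] + [e1 e2 _]]; rewrite memI => /andP[iN' jM'].
  have [? ?] := injI _ _ _ _ iN jM iN' jM' e1; subst i' j'.
  (* A triangle occurring in both families would give [i = i + 1] modulo [N], against [1 < N]. *)
  have [+ _] := inj i j.+1 i.+1 j (ltnW iN) jM iN (ltnW jM) e2.
  rewrite (modn_small iN); move: (iN); rewrite leq_eqVlt => /orP[/eqP e|lt].
    by rewrite e modnn => i0; move: N1; rewrite -e i0.
  by rewrite modn_small //; lia.
have corner_s x u : u \in t -> corner u x -> x \in s.
  rewrite mem_cat => /orP[] /mapP[[i j] + ->]; rewrite memI => /andP[iN jM] /= [->|->|->];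
    by apply: mems; rewrite // ltnW.
have VE : vertices F = [set` s].
  apply/seteqP; split=> [x [u Fu ux]|x /= /mapP[[i j] + ->]].
    by apply: (corner_s x u) ux; move: Fu; rewrite FE.
  rewrite memI => /andP[iN jM]; exists (lower_triangle P (i, j)); last by constructor 1.
  by exists i, j; split=> //; left.
have tc x : total_curvature F x = 2%:R * pi -
    \sum_(u <- t) (if pselect (corner u x) then corner_angle u x else 0).
  rewrite /total_curvature; congr (_ - _).
  rewrite (_ : [set u | F u /\ corner u x] = F `&` [set u | corner u x]) //.
  rewrite fsbig_mkcondr FE -fsbig_seq //; apply: eq_bigr => u _.
  by case: pselect => [Cu|nC]; [rewrite mem_set|rewrite memNset].
rewrite VE -fsbig_seq //; under eq_bigr do rewrite tc.
(* Double counting: the angles are added triangle by triangle instead of vertex by vertex. *)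
rewrite big_split /= sumrN exchange_big /=.
have -> : \sum_(u <- t) \sum_(x <- s) (if pselect (corner u x) then corner_angle u x else 0) =
    \sum_(u <- t) (pi : R).
  rewrite big_seq [RHS]big_seq; apply: eq_bigr => u ut'.
  apply: sum_corner_angle => //; first by move=> x; exact: corner_s.
  move: ut'; rewrite mem_cat => /orP[] /mapP[[i j] + ->]; rewrite memI => /andP[iN jM] /=.
    by have [_ _ ? _] := nc _ _ iN jM.
  by have [_ ? _ _] := nc _ _ iN jM.
rewrite !big_const_seq !count_predT !iter_addr_0 size_cat !size_map sI.
by rewrite mulr_natl -mulrnA mulrnDr mul2n -addnn mulrnDr subrr.
Qed.

Lemma eq_de_casteljau (V : lmodType R) (q q' : nat -> V) l i :
  (forall j, (i <= j <= i + l)%N -> q j = q' j) -> de_casteljau q l i = de_casteljau q' l i.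
Proof.
elim: l i => [|l IH] i e /=; first by apply: e; rewrite addn0 leqnn.
rewrite (IH i) ?(IH i.+1) // => j /andP[ij jl]; apply: e; lia.
Qed.

Lemma eq_subdivide_curve (V : lmodType R) n K (q q' : nat -> V) a : (0 < n)%N ->
  (forall i, (i <= K * n)%N -> q i = q' i) -> (a <= K.*2 * n)%N ->
  subdivide_curve n q a = subdivide_curve n q' a.
Proof.
move=> n0 e aK; rewrite /subdivide_curve; set c := (a %/ _)%N; set i := (a %% _)%N.
have aE : a = (c * n.*2 + i)%N := divn_eq a n.*2.
have i2 : (i < n.*2)%N by rewrite ltn_mod double_gt0.
(* At [i = 0] only the junction point [q (c * n)] is read, and [c = K] may occur; otherwise a whole
   piece is read, but then [c < K]. *)
have cK : (c * n + (if i == 0%N then 0 else n) <= K * n)%N.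
  case: eqP => [i0|/eqP i0]; first by rewrite addn0 leq_mul2r; nia.
  have : (c < K)%N by nia.
  by nia.
clearbody i c; apply: eq_de_casteljau => j jb; apply: e; move: jb cK i2.
move: (c * n)%N (K * n)%N => cn Kn.
by case: (leqP i n) => ?; case: eqP => ?; lia.
Qed.

(** Subdivision keeps the junction points of the pieces, in particular both ends, which is why it
    preserves closedness. *)
Lemma subdivide_curve_even (V : lmodType R) n K (q : nat -> V) : (0 < n)%N ->
  subdivide_curve n q (K.*2 * n) = q (K * n)%N.
Proof.
move=> n0; rewrite /subdivide_curve -doubleMl doubleMr mulnK ?double_gt0 // modnMl /=.
by rewrite sub0n addn0.
Qed.

Lemma closed_subdivide n m K q : (0 < n)%N -> (0 < m)%N ->
  closed_net (K * n) (K * m) q -> closed_net (K.*2 * n) (K.*2 * m) (subdivide n m q).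
Proof.
move=> n0 m0 [cv cu]; split=> [i iK|j jK].
- rewrite /subdivide; apply: (eq_subdivide_curve (K := K)) => // l lK.
  have := subdivide_curve_even 0 (q l) m0; rewrite double0 !mul0n => ->.
  by rewrite subdivide_curve_even // cv.
- rewrite /subdivide; set c := fun i => _.
  have := subdivide_curve_even 0 c n0; rewrite double0 !mul0n => ->.
  by rewrite subdivide_curve_even // /c; apply: (eq_subdivide_curve (K := K)).
Qed.

Lemma closed_control_net n m p k : (0 < n)%N -> (0 < m)%N -> closed_net n m p ->
  closed_net (2 ^ k * n) (2 ^ k * m) (@control_net R n m p k).
Proof.
move=> n0 m0 cp; elim: k => [|k IH]; first by rewrite expn0 !mul1n.
by rewrite expnS mul2n; exact: closed_subdivide.
Qed.

End NetCurvature.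

(** * Vanishing of the curvature integral and conclusion *)

Section GaussBonnetTorus.
Context {R : realType}.
Implicit Types (S : set 'rV[R]_3) (n m : nat) (p : nat -> nat -> 'rV[R]_3).

Lemma bernstein_deg0 (u : R) : bernstein 0 0 u = 1.
Proof. by rewrite /bernstein !expr0 !mulr1. Qed.

Lemma not_end_identified_half : ~ end_identified (0 : R) 2^-1.
Proof.
have half0 : 0 < (2^-1 : R) by rewrite invr_gt0 ltr0n.
have half1 : (2^-1 : R) < 1 by rewrite invf_lt1 ?ltr0n // ltr1n.
by case=> [e|[_ e]|[e _]]; lra.
Qed.

(** A degree 0 makes the surface constant in one parameter, so that the values at 0 and 1/2 coincide
    although they are not identified end points. *)
Lemma non_self_intersecting_deg n m p : non_self_intersecting n m p -> (0 < n)%N /\ (0 < m)%N.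
Proof.
move=> inj; have s00 : unit_square ((0, 0) : R * R).
  by split; rewrite /= in_itv /= lexx ler01.
have half : 0 <= (2^-1 : R) <= 1 by rewrite invr_ge0 ler0n invf_le1 // ler1n.
have h0 : 0 <= (0 : R) <= 1 by rewrite lexx ler01.
have s01 : unit_square ((0, 2^-1) : R * R) by split; rewrite /= in_itv.
have s10 : unit_square ((2^-1, 0) : R * R) by split; rewrite /= in_itv.
split; rewrite lt0n; apply/eqP => e; subst.
  have [|+ _] := inj _ _ s00 s10; last exact: not_end_identified_half.
  by rewrite /bezier !big_ord1 /= !bernstein_deg0.
have [|_] := inj _ _ s00 s01; last exact: not_end_identified_half.
by rewrite /bezier; apply: eq_bigr => i _; rewrite !big_ord1 /= !bernstein_deg0.
Qed.

Lemma compact_homeomorphic (T V : topologicalType) (A : set T) (B : set V) :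
  homeomorphic A B -> compact B -> compact A.
Proof.
move=> [h [[hS _ hJ] _ [g [gc gK]]]] cB.
have -> : A = g @` B.
  apply/seteqP; split=> [x Ax|_ [y /hJ[x Ax <-] <-]]; last by rewrite gK.
  by exists (h x); [exact: hS|exact: gK].
exact: continuous_compact.
Qed.

Lemma torus_total_curvature n m p S : closed_net n m p -> compact (bezier_surface n m p) ->
  non_self_intersecting n m p -> smooth_surface S -> homeomorphic S (bezier_surface n m p) ->
  (\int[area_measure S]_(x in S) (gauss_curvature S x)%:E = 0)%E.
Proof.
move=> cp cB inj smS hS; have cS := compact_homeomorphic hS cB.
(* In the default case [area_measure S] is the zero measure, and the integral is 0 as well. *)
rewrite /area_measure; case: pselect => [e|_]; last exact: integral_measure_zero.
have [F [[Fc FS] Fsurj Fshift Ffree]] := torus_parametrization cp inj hS.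
have [V VS] := transverse_free_exists cS smS Fc FS Fsurj Fshift Ffree.
apply: (integral_gauss_curvature_eq0 cS smS VS).
exact: (projT2 (cid e)).
Qed.

End GaussBonnetTorus.

Theorem theorem1p3 (R : realType) (n m : nat) (p : nat -> nat -> 'rV[R]_3)
    (S : set 'rV[R]_3)
    (b_closed : closed_net n m p)
    (b_compact : compact (bezier_surface n m p))
    (b_simple : non_self_intersecting n m p)
    (b_regular : forall k,
       regular_net (2 ^ k * n) (2 ^ k * m) (control_net n m p k))
    (S_approx : smooth_approximation n m p S) :
  \forall k \near \oo,
    (\sum_(x \in vertices (control_surface n m p k))
        total_curvature (control_surface n m p k) x)%:E =
    (\int[area_measure S]_(x in S) (gauss_curvature S x)%:E)%E.
Proof.
have [n0 m0] := non_self_intersecting_deg b_simple.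
have [bs [bsP _ [q q0 ->]]] := S_approx; have [smS hS _] := bsP _ q0.
(* Both sides are 0 at every level of subdivision, so the threshold is 0. *)
exists 0%N => // k _; rewrite /= (torus_total_curvature b_closed b_compact b_simple smS hS).
rewrite /control_surface net_total_curvature // ?muln_gt0 ?expn_gt0 //.
exact: closed_control_net.
Qed.
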